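(* Let $R_0>0$ be fixed. For all sufficiently large $\sigma$ (how large depending on $c,S,R_0$) the following holds. Suppose $$q<\frac{1}{4\mu(1+\delta\sigma R_0)(\sigma+cS)}\qquad\text{and}\qquad \tau'-\tau\le\min\left\{1;\ \frac{1}{\lambda\sigma R_0}\left(\frac{1}{4q_\sigma(\sigma+cS)}-\mu\right)\right\}.$$ Then the problem $\Sigma_{\tau,\tau'}$ admits a unique non-negative continuous (thus bounded) solution $N=(N_i)_{i=1}^4$ with bounded derivatives such that $$\max_{1\le i\le4}\|N_i\|_1\le\frac{1-\sqrt{1-4p_\sigma q_\sigma}}{2p_\sigma}.$$
   Context: Fix constants $c,S>0$, reals $a_1<b_1$, $a_2<b_2$, put $\Omega=[a_1,b_1]\times[a_2,b_2]$, let $0\le\tau<\tau'<\infty$ and $\mathscr P=[\tau,\tau']\times\Omega$. For a 4-tuple $N=(N_1,N_2,N_3,N_4)$ of real functions of $(t,x,y)$ put $Q(N)=2cS(N_2N_3-N_1N_4)$. The four-velocity planar Broadwell system is $$\partial_tN_1+c\,\partial_xN_1=Q(N),\quad \partial_tN_2+c\,\partial_yN_2=-Q(N),\quad \partial_tN_3-c\,\partial_yN_3=-Q(N),\quad \partial_tN_4-c\,\partial_xN_4=Q(N).$$ Problem $\Sigma_{\tau,\tau'}$: the system on $\mathscr P$ with initial conditions $N_i(\tau,x,y)=N_i^\tau(x,y)$ on $\Omega$, $i=1,\dots,4$, and boundary conditions, for $t\in[\tau,\tau']$, $x\in[a_1,b_1]$, $y\in[a_2,b_2]$: $N_1(t,a_1,y)=N_1^-(t,y)$,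 $N_2(t,x,a_2)=N_2^-(t,x)$, $N_3(t,x,b_2)=N_3^+(t,x)$, $N_4(t,b_1,y)=N_4^+(t,y)$. The data satisfy the compatibility conditions $N_1^\tau(a_1,y)=N_1^-(\tau,y)$, $N_2^\tau(x,a_2)=N_2^-(\tau,x)$, $N_3^\tau(x,b_2)=N_3^+(\tau,x)$, $N_4^\tau(b_1,y)=N_4^+(\tau,y)$. All data are non-negative, continuous and bounded, with continuous and bounded first-order partial derivatives. A solution is a 4-tuple of real functions continuous on $\mathscr P$, having continuous first-order partial derivatives in the interior of $\mathscr P$ except possibly on a finite number of planes, satisfying the system at interior points outside these planes, and satisfying the initial and boundary conditions. Norms: $\|u\|_\infty$ is the supremum of $|u|$ over the domain of $u$; $\|g\|_1=\max\{\|g\|_\infty,\|\partial_tg\|_\infty,\|\partial_xg\|_\infty,\|\partial_yg\|_\infty\}$ (suprema of derivatives over the points where they exist). Transported data (each defined at the points $(t,x,y)\in\mathscr P$ where the right-hand side makes sense): $\overline{N_1^\tau}(t,x,y)=N_1^\tau(x-c(t-\tau),y)$, $\overline{N_2^\tau}(t,x,y)=N_2^\tau(x,y-c(t-\tau))$, $\overline{N_3^\tau}(t,x,y)=N_3^\tau(x,y+c(t-\tau))$, $\overline{N_4^\tau}(t,x,y)=N_4^\tau(x+c(t-\tau),y)$, $\overline{N_1^-}(t,x,y)=N_1^-(t-\frac{x-a_1}{c},y)$, $\overline{N_2^-}(t,x,y)=N_2^-(t-\frac{y-a_2}{c},x)$, $\overline{N_3^+}(t,x,y)=N_3^+(t-\frac{b_2-y}{c},x)$,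 $\overline{N_4^+}(t,x,y)=N_4^+(t-\frac{b_1-x}{c},y)$. Constants: $\mu=8+\frac4c+8c$, $\lambda=16+16c$, $\delta=\frac4c+8+4c$, $q=\max_{1\le i\le4}\{\|\overline{N_i^\tau}\|_1,\|\overline{N_1^-}\|_1,\|\overline{N_2^-}\|_1,\|\overline{N_3^+}\|_1,\|\overline{N_4^+}\|_1\}$, $q_\sigma=q(1+\delta\sigma R_0)$, $p_\sigma=(\mu+\lambda\sigma R_0(\tau'-\tau))(\sigma+cS)$. If $q=0$, $\frac{1}{4q_\sigma(\sigma+cS)}$ is read as $+\infty$. *)

(* Defs.v *)
From HB Require Import structures.
From mathcomp Require Import all_boot all_order all_algebra.
From mathcomp Require Import all_classical all_reals all_analysis.

Set Implicit Arguments.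
Unset Strict Implicit.
Unset Printing Implicit Defensive.

Import Order.TTheory GRing.Theory Num.Theory.
Import numFieldNormedType.Exports.

Local Open Scope classical_set_scope.
Local Open Scope ring_scope.

Notation i1 := (@Ordinal 4 0 isT).
Notation i2 := (@Ordinal 4 1 isT).
Notation i3 := (@Ordinal 4 2 isT).
Notation i4 := (@Ordinal 4 3 isT).

Section Calculus.
Context {R : realType}.

(* A point of space-time is (t, x, y) : R * R * R; the partial derivatives in
   t, x, y are the directional derivatives along et, ex, ey. *)
Definition et : R * R * R := (1, 0, 0).
Definition ex : R * R * R := (0, 1, 0).
Definition ey : R * R * R := (0, 0, 1).
Definition e1 : R * R := (1, 0).
Definition e2 : R * R := (0, 1).
Definition tc (p : R * R * R) : R := p.1.1.
Definition xc (p : R * R * R) : R := p.1.2.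
Definition yc (p : R * R * R) : R := p.2.

Section Norms.
Context {V : normedModType R}.

Definition C1_at (es : seq V) (f : V -> R) (p : V) : Prop :=
  forall e, e \in es -> derivable f p e /\ {for p, continuous ('D_e f)}.

(* Partial derivatives are taken at interior points of the domain A only, so
   that they do not depend on the values of f outside A. *)
Definition diff_dom (A : set V) (f : V -> R) (e : V) : set V :=
  A° `&` [set p | derivable f p e].

(* Extended-real valued: an unbounded function has norm +oo. *)
Definition norm_oo (A : set V) (f : V -> R) : \bar R :=
  ereal_sup [set `|f p|%:E | p in A].

Definition norm_oo_der (A : set V) (f : V -> R) (e : V) : \bar R :=
  norm_oo (diff_dom A f e) ('D_e f).

Definition bounded_der (es : seq V) (A : set V) (f : V -> R) : Prop :=
  forall e, e \in es -> [bounded 'D_e f p | p in diff_dom A f e].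

End Norms.

Definition norm1 (A : set (R * R * R)) (g : R * R * R -> R) : \bar R :=
  maxe (norm_oo A g)
    (maxe (norm_oo_der A g et)
      (maxe (norm_oo_der A g ex) (norm_oo_der A g ey))).

Definition is_plane (H : set (R * R * R)) : Prop :=
  exists (n : R * R * R) (d : R), n != 0 /\
    H = [set p | tc n * tc p + xc n * xc p + yc n * yc p = d].

Definition rect (a b a' b' : R) : set (R * R) := `[a, b] `*` `[a', b'].

Definition good_datum (D : set (R * R)) (g : R * R -> R) : Prop :=
  [/\ forall p, D p -> 0 <= g p,
      {within D, continuous g},
      [bounded g p | p in D],
      forall p, D° p -> C1_at [:: e1; e2] g p
    & bounded_der [:: e1; e2] D g].

End Calculus.

Section Broadwell.
Context {R : realType}.
Variables (c S : R) (a1 b1 a2 b2 tau tau' : R).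

Definition Omega : set (R * R) := rect a1 b1 a2 b2.
Definition Pdom : set (R * R * R) := (`[tau, tau'] `*` `[a1, b1]) `*` `[a2, b2].

Definition Q (N : 'I_4 -> R * R * R -> R) (p : R * R * R) : R :=
  2 * c * S * (N i2 p * N i3 p - N i1 p * N i4 p).

Definition broadwell_at (N : 'I_4 -> R * R * R -> R) (p : R * R * R) : Prop :=
  [/\ 'D_et (N i1) p + c * 'D_ex (N i1) p = Q N p,
      'D_et (N i2) p + c * 'D_ey (N i2) p = - Q N p,
      'D_et (N i3) p - c * 'D_ey (N i3) p = - Q N p
    & 'D_et (N i4) p - c * 'D_ex (N i4) p = Q N p].

(* Initial data are functions of (x, y); N1m and N4p are functions of (t, y),
   N2m and N3p functions of (t, x). *)
Variables (Ntau : 'I_4 -> R * R -> R) (N1m N2m N3p N4p : R * R -> R).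

Definition good_data : Prop :=
  [/\ forall i, good_datum Omega (Ntau i),
      good_datum (rect tau tau' a2 b2) N1m,
      good_datum (rect tau tau' a1 b1) N2m,
      good_datum (rect tau tau' a1 b1) N3p
    & good_datum (rect tau tau' a2 b2) N4p].

Definition compatible_data : Prop :=
  (forall y, a2 <= y <= b2 ->
     Ntau i1 (a1, y) = N1m (tau, y) /\ Ntau i4 (b1, y) = N4p (tau, y)) /\
  (forall x, a1 <= x <= b1 ->
     Ntau i2 (x, a2) = N2m (tau, x) /\ Ntau i3 (x, b2) = N3p (tau, x)).

Definition initial_cond (N : 'I_4 -> R * R * R -> R) : Prop :=
  forall i x y, Omega (x, y) -> N i (tau, x, y) = Ntau i (x, y).

Definition boundary_cond (N : 'I_4 -> R * R * R -> R) : Prop :=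
  forall t x y, Pdom (t, x, y) ->
    [/\ N i1 (t, a1, y) = N1m (t, y),
        N i2 (t, x, a2) = N2m (t, x),
        N i3 (t, x, b2) = N3p (t, x)
      & N i4 (t, b1, y) = N4p (t, y)].

Definition is_solution (N : 'I_4 -> R * R * R -> R) : Prop :=
  [/\ forall i, {within Pdom, continuous (N i)},
      exists Pi : set (set (R * R * R)),
        [/\ finite_set Pi,
            forall H, Pi H -> is_plane H
          & forall p, Pdom° p -> (forall H, Pi H -> ~ H p) ->
              (forall i, C1_at [:: et; ex; ey] (N i) p) /\ broadwell_at N p],
      initial_cond N
    & boundary_cond N].

(* norm1 of the transported datum g \o phi on the set of points of Pdom that
   phi sends into the domain D of g. *)
Definition transported_norm1 (D : set (R * R)) (g : R * R -> R)
    (phi : R * R * R -> R * R) : \bar R :=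
  norm1 (Pdom `&` phi @^-1` D) (g \o phi).

Definition q_ext : \bar R :=
  \big[maxe/-oo%E]_(v <- [::
    transported_norm1 Omega (Ntau i1) (fun p => (xc p - c * (tc p - tau), yc p));
    transported_norm1 Omega (Ntau i2) (fun p => (xc p, yc p - c * (tc p - tau)));
    transported_norm1 Omega (Ntau i3) (fun p => (xc p, yc p + c * (tc p - tau)));
    transported_norm1 Omega (Ntau i4) (fun p => (xc p + c * (tc p - tau), yc p));
    transported_norm1 (rect tau tau' a2 b2) N1m
      (fun p => (tc p - (xc p - a1) / c, yc p));
    transported_norm1 (rect tau tau' a1 b1) N2m
      (fun p => (tc p - (yc p - a2) / c, xc p));
    transported_norm1 (rect tau tau' a1 b1) N3p
      (fun p => (tc p - (b2 - yc p) / c, xc p));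
    transported_norm1 (rect tau tau' a2 b2) N4p
      (fun p => (tc p - (b1 - xc p) / c, yc p))]) v.

(* q_ext is a finite real whenever 0 < c, the intervals are nondegenerate and
   good_data holds. *)
Definition q : R := fine q_ext.

Definition mu : R := 8 + 4 / c + 8 * c.
Definition lambda : R := 16 + 16 * c.
Definition delta : R := 4 / c + 8 + 4 * c.

Variables (R0 sigma : R).

Definition q_sigma : R := q * (1 + delta * sigma * R0).
Definition p_sigma : R :=
  (mu + lambda * sigma * R0 * (tau' - tau)) * (sigma + c * S).

Definition inv_4q_sigma : \bar R :=
  if q == 0 then +oo%E else (1 / (4 * q_sigma * (sigma + c * S)))%:E.

Definition time_bound : \bar R :=
  mine 1%:E ((1 / (lambda * sigma * R0))%:E * (inv_4q_sigma - mu%:E))%E.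

Definition norm_bound : R :=
  (1 - Num.sqrt (1 - 4 * p_sigma * q_sigma)) / (2 * p_sigma).

Definition is_bounded_solution (N : 'I_4 -> R * R * R -> R) : Prop :=
  [/\ is_solution N,
      forall i p, Pdom p -> 0 <= N i p,
      forall i, bounded_der [:: et; ex; ey] Pdom (N i)
    & (\big[maxe/-oo%E]_(i < 4) norm1 Pdom (N i) <= norm_bound%:E)%E].

End Broadwell.

(* Main.v *)
Require Import Defs.
From mathcomp Require Import all_boot all_order all_algebra.
From mathcomp Require Import all_classical all_reals all_analysis.
From mathcomp Require Import ring lra.
Import Order.TTheory GRing.Theory Num.Theory.
Import numFieldNormedType.Exports.
Local Open Scope classical_set_scope.
Local Open Scope ring_scope.

(** Write X for the right-hand side of the norm bound. It is the smaller root of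
    q_sigma + p X^2 = X, and the part of the bound on tau' - tau that involves q
    ensures that this root is real. For sigma >= c S the constants mu, lambda and
    delta are generous: they give p >= 16 c S + 8 S, hence
      q + (12 c S + 4 S) X^2 <= X  and  8 c S X <= 1/2   ([bound_constants]).
    Together with tau' - tau <= 1, these two inequalities carry the whole analysis.

    Existence. Along its characteristic direction the i-th equation reads
    (d/dr) N_i = src_i, so a solution is the value of the datum at the point where
    the characteristic enters the box plus the integral of src_i since then. The
    right-hand side, [picard], maps the set of quadruples that are bounded by X and
    X-Lipschitz in each coordinate into itself, and halves sup distances there (at least);
    its iterates converge to a fixed point in that set ([picard_fixpoint]). The
    bounds on N_i and on its derivatives are then immediate.

    Regularity. The fixed point is Lipschitz, and differentiability has to be
    gained from the equation itself. Measure the failure of differentiability of f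
    at p in a direction by its defect: the asymptotic oscillation of the difference
    quotients of f near p. Defect 0 means strict differentiability, which at all
    points of an open set is the same as being C1 there ([defect0_sderiv],
    [sderiv_C1]). The defect of an integral along segments is at most the integral
    of the defect, by dominated convergence ([slope_defect_prim], [defect_prim]).
    The datum is C1 off the plane of points whose characteristic enters through the
    edge between t = tau and the wall, the kink plane of index i; and a
    characteristic of index i that avoids its own kink plane crosses the other ones
    finitely often ([kink_crossings]). So if w bounds the defects of all the N_i
    off their kink planes, then so does 8 c S X w <= w / 2 ([defect_halving]).
    Starting from 2 X, which is what the Lipschitz bound gives, the defects are 0
    ([mild_C1]), and differentiating along the characteristics gives the system
    ([mild_dir], [mild_broadwell]).

    Sign. If all N_j >= - m, then src_i >= - 4 c S X m wherever N_i < 0, so that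
    N_i >= - m / 2, since N_i >= 0 where its characteristic enters ([src_lower],
    [barrier], [nonneg_halving]); iterate.

    Uniqueness. If two solutions differ by at most B, their difference vanishes
    where the characteristics enter and has characteristic derivative at most B / 2
    off the exceptional planes of the two. A characteristic may lie inside such a
    plane, but some parallel line arbitrarily close to it lies in none of them, and
    it meets their union finitely often; by continuity the difference is at most
    B / 2 ([lip_off_planes], [sol_unique]); iterate. The same lemma makes the
    constant q, which only sees the data on either side of the kink planes, a
    Lipschitz constant of the data across them ([datum_lip]). *)

Set Implicit Arguments.
Unset Strict Implicit.
Unset Printing Implicit Defensive.

(** * Primitives of continuous functions *)

Section Primitive.
Context {R : realType}.
Implicit Types (f g : R -> R) (x y k : R).
Local Notation leb := (@lebesgue_measure R).

Definition prim f x : R := \int[leb]_(r in `[0, x]) f r.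

Lemma continuous_integrable f (a b : R) : continuous f ->
  leb.-integrable `[a, b] (EFin \o f).
Proof.
move=> cf; apply: continuous_compact_integrable; first exact: segment_compact.
exact: continuous_subspaceT.
Qed.

Lemma prim0 f : prim f 0 = 0.
Proof. by rewrite /prim set_itv1 Rintegral_set1. Qed.

Lemma primB f g x : continuous f -> continuous g ->
  prim (fun r => f r - g r) x = prim f x - prim g x.
Proof. by move=> cf cg; rewrite /prim RintegralB//; exact: continuous_integrable. Qed.

Lemma primZ k f x : continuous f -> prim (fun r => k * f r) x = k * prim f x.
Proof. by move=> cf; rewrite /prim RintegralZl//; exact: continuous_integrable. Qed.

Lemma le_prim f g x : continuous f -> continuous g ->
  (forall r, 0 <= r <= x -> f r <= g r) -> prim f x <= prim g x.
Proof.
move=> cf cg fg; apply: le_Rintegral => //.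
- exact: continuous_integrable.
- exact: continuous_integrable.
Qed.

Lemma prim_cst k x : 0 <= x -> prim (fun=> k) x = k * x.
Proof.
move=> x0; rewrite /prim Rintegral_cst//= lebesgue_measure_itv/= lte_fin.
by case: ltgtP x0 => //= [_ _|<- _]; rewrite ?oppr0 ?addr0 ?mulr0.
Qed.

Lemma norm_prim f x : continuous f -> `|prim f x| <= prim (fun r => `|f r|) x.
Proof. by move=> cf; apply: le_normr_Rintegral => //; exact: continuous_integrable. Qed.

(** Used with k = 0, where it says that prim f is Lipschitz, and with k a nearby
    value of f, where it compares prim f with its linear part. *)
Lemma prim_increment f k (M : R) x y : continuous f -> 0 <= x -> x <= y ->
  (forall r, x <= r <= y -> `|f r - k| <= M) ->
  `|prim f y - prim f x - (y - x) * k| <= M * (y - x).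
Proof.
move=> cf x0 xy fk.
have intk z : (\int[leb]_(r in `[x, y]) z)%R = (y - x) * z.
  rewrite Rintegral_cst//= lebesgue_measure_itv/= lte_fin.
  by case: ltgtP xy => //= [_ _|-> _]; rewrite ?subrr ?mulr0 ?mul0r // mulrC.
have -> : prim f y - prim f x = \int[leb]_(r in `[x, y]) f r.
  rewrite /prim Rintegral_itvB ?bnd_simp//; last exact: continuous_integrable.
  apply: Rintegral_itv_obnd_cbnd.
  apply: integrableS (@continuous_integrable f x y cf) => //.
  by apply: subset_itvr; rewrite bnd_simp.
rewrite -(intk k) -RintegralB//; [|exact: continuous_integrable|
  exact: (@continuous_integrable (fun=> k) _ _ (@cst_continuous _ _ _))].
have cfk : continuous (fun r => f r - k).
  by move=> r; apply: continuousB; [exact: cf|exact: cst_continuous].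
have := @le_normr_Rintegral _ _ _ leb `[x, y] (fun r => f r - k) _
  (@continuous_integrable _ x y cfk).
move=> /(_ (measurable_itv _)) /le_trans; apply.
rewrite mulrC -(intk M); apply: le_Rintegral => //.
- apply: (@continuous_integrable (fun r => `|f r - k|) _ _) => r.
  exact: (continuous_comp (cfk r) (@norm_continuous _ _ _)).
- exact: (@continuous_integrable (fun=> M) _ _ (@cst_continuous _ _ _)).
Qed.

Lemma is_derive_prim f x : continuous f -> 0 < x ->
  is_derive x 1 (prim f) (f x).
Proof.
move=> cf x0.
have x1 : x < x + 1 by rewrite ltrDl.
have [dF fE] := continuous_FTC1_closed x1
  (@continuous_integrable f 0 (x + 1) cf) x0 (cf x).
by apply: (DeriveDef dF); rewrite -derive1E.
Qed.

(** Turns an integral that runs backwards along a characteristic into one that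
    starts at the fixed entry point. *)
Lemma prim_rev f x : continuous f -> 0 <= x ->
  prim (fun r => f (x - r)) x = prim f x.
Proof.
move=> cf x0.
have D1 : ((fun r : R => x - r) : R -> R)^`()%classic = cst (-1)%R.
  by apply/funext => z; rewrite derive1E deriveB// derive_cst derive_id sub0r.
have cx : continuous (fun r : R => x - r).
  by move=> r; apply: continuousB; [exact: cst_continuous|exact: cvg_id].
have := @integration_by_substitution_decreasing R (fun r => x - r) f 0 x x0.
rewrite subrr subr0 => sub; rewrite /prim /Rintegral sub //.
- congr fine; apply: eq_integral => r _; rewrite !fctE D1 /=.
  by rewrite opprK mulr1.
- by move=> r s _ _ rs; rewrite ltrD2l ltrN2.
- by rewrite D1 => ? _; exact: cvg_cst.
- by rewrite D1; exact: is_cvg_cst.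
- by rewrite D1; exact: is_cvg_cst.
- split => /=.
  + by move=> r _; exact: derivableB.
  + apply: cvg_at_right_filter; exact: cx.
  + apply: cvg_at_left_filter; exact: cx.
- exact: continuous_subspaceT.
Qed.

(** Dominated convergence for max (g n - w, 0), which tends to 0 off A. Only the
    upper limit of the g n is controlled, and not at every point: this is how an
    estimate on defects that may fail where a characteristic crosses a kink plane
    is integrated. *)
Lemma prim_limsup (g : nat -> R -> R) (C w x : R) (A : set R) :
  (forall n, continuous (g n)) -> 0 <= x -> 0 <= w ->
  (forall n (r : R), 0 <= r <= x -> 0 <= g n r <= C) ->
  countable A ->
  (forall r e : R, 0 <= r <= x -> ~ A r -> 0 < e ->
     \forall n \near \oo, g n r <= w + e) ->
  forall e : R, 0 < e -> \forall n \near \oo, prim (g n) x <= w * x + e.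
Proof.
move=> cg x0 w0 gC cA gw e e0.
pose m n r := Num.max (g n r - w) 0.
have cm n : continuous (m n).
  move=> r; apply: (@continuous_max _ _ (fun r => g n r - w) (fun=> 0) r).
    by apply: continuousB; [exact: cg|exact: cst_continuous].
  exact: cst_continuous.
have iC : leb.-integrable `[0, x] (EFin \o (fun=> C)).
  exact: (@continuous_integrable (fun=> C) _ _ (@cst_continuous _ _ _)).
have [] := @dominated_convergence _ (measurableTypeR R) R leb `[0, x] _
  (fun n => EFin \o m n) (fun=> 0%E) (EFin \o (fun=> C)) => //.
- by move=> n; have /integrableP[] := @continuous_integrable (m n) 0 x (cm n).
- exists A; split; [exact: countable_measurable|exact: countable_lebesgue_measure0|].
  move=> r /= /not_implyP[]; rewrite in_itv/= => r0x nc; apply: contrapT => nA.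
  apply: nc; apply: cvg_EFin; first by apply: nearW => n; [].
  apply/cvgrPdist_le => eps eps0.
  near=> n; rewrite /= sub0r normrN /m ger0_norm ?le_max ?lexx ?orbT//.
  rewrite ge_max (ltW eps0) andbT lerBlDl; near: n; exact: gw.
- apply: aeW => r n; rewrite /= in_itv/= => /(gC n) /andP[g0 gC'].
  rewrite lee_fin /m ger0_norm ?le_max ?lexx ?orbT// ge_max (le_trans g0 gC').
  by rewrite andbT (le_trans _ gC')// lerBlDl lerDr.
move=> _ _; rewrite integral0 => /fine_cvgP[fin /cvgrPdist_le /(_ e e0) cv].
near=> n; have : `|0 - prim (m n) x| <= e by near: n.
rewrite sub0r normrN => /(le_trans (ler_norm _)) me.
apply: le_trans (_ : prim (fun r => w + m n r) x <= _).
  apply: le_prim; first exact: cg.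
    move=> r; apply: continuousD; first exact: cst_continuous.
    exact: cm.
  by move=> r _; rewrite /m -lerBlDl le_max lexx.
rewrite /prim RintegralD//; last 2 first.
- exact: (@continuous_integrable (fun=> w) _ _ (@cst_continuous _ _ _)).
- exact: continuous_integrable.
by rewrite -/(prim _ _) prim_cst// lerD2l.
Unshelve. all: by end_near. Qed.

End Primitive.

(** * Strict directional derivatives *)

Section ContinuityAt.
Context {R : realType} {T : topologicalType}.
Implicit Types (x : T).

Lemma cont_cst {U : topologicalType} (u : U) x : {for x, continuous (fun=> u)}.
Proof. exact: cvg_cst. Qed.
Lemma cont_id x : {for x, continuous (fun z : T => z)}.
Proof. exact: cvg_id. Qed.
Lemma cont_pair {U V : topologicalType} (f : T -> U) (g : T -> V) x :
  {for x, continuous f} -> {for x, continuous g} ->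
  {for x, continuous (fun z => (f z, g z))}.
Proof. by move=> cf cg; apply: cvg_pair. Qed.
Lemma cont_fst {U V : topologicalType} (f : T -> U * V) x :
  {for x, continuous f} -> {for x, continuous (fun z => (f z).1)}.
Proof. by move=> cf; apply: continuous_comp => //; exact: cvg_fst. Qed.
Lemma cont_snd {U V : topologicalType} (f : T -> U * V) x :
  {for x, continuous f} -> {for x, continuous (fun z => (f z).2)}.
Proof. by move=> cf; apply: continuous_comp => //; exact: cvg_snd. Qed.
Lemma cont_comp {U V : topologicalType} (f : T -> U) (g : U -> V) x :
  {for f x, continuous g} -> {for x, continuous f} ->
  {for x, continuous (fun z => g (f z))}.
Proof. by move=> cg cf; apply: continuous_comp. Qed.
Lemma cont_add {V : normedModType R} (f g : T -> V) x :
  {for x, continuous f} -> {for x, continuous g} ->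
  {for x, continuous (fun z => f z + g z)}.
Proof. exact: continuousD. Qed.
Lemma cont_opp {V : normedModType R} (f : T -> V) x :
  {for x, continuous f} -> {for x, continuous (fun z => - f z)}.
Proof. exact: continuousN. Qed.
Lemma cont_scale {V : normedModType R} (k : T -> R) (f : T -> V) x :
  {for x, continuous k} -> {for x, continuous f} ->
  {for x, continuous (fun z => k z *: f z)}.
Proof. exact: continuousZ. Qed.
Lemma cont_mul (f g : T -> R) x :
  {for x, continuous f} -> {for x, continuous g} ->
  {for x, continuous (fun z => f z * g z)}.
Proof. exact: continuousM. Qed.
Lemma cont_norm {V : normedModType R} (f : T -> V) x :
  {for x, continuous f} -> {for x, continuous (fun z => `|f z|)}.
Proof. by move=> cf; apply: continuous_comp => //; exact: norm_continuous. Qed.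
Lemma cont_min (f g : T -> R) x :
  {for x, continuous f} -> {for x, continuous g} ->
  {for x, continuous (fun z => Num.min (f z) (g z))}.
Proof. exact: (@continuous_min R T f g x). Qed.
Lemma cont_max (f g : T -> R) x :
  {for x, continuous f} -> {for x, continuous g} ->
  {for x, continuous (fun z => Num.max (f z) (g z))}.
Proof. exact: (@continuous_max R T f g x). Qed.

End ContinuityAt.

Create HintDb contdb.

(** Proves continuity of an explicit expression by recursion on its shape,
    closing the leaves from the context or from contdb. *)
Ltac cont :=
  lazymatch goal with
  | |- continuous ?f => let z := fresh "z" in move=> z; change {for z, continuous f}; cont
  | |- {for _, continuous (fun z => z)} => exact: cont_id
  | |- {for _, continuous (fun z => (@?f z, @?g z))} => apply: (@cont_pair _ _ _ f g); cont
  | |- {for _, continuous (fun z => @fst _ _ (@?f z))} => apply: (@cont_fst _ _ _ f); cont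
  | |- {for _, continuous (fun z => @snd _ _ (@?f z))} => apply: (@cont_snd _ _ _ f); cont
  | |- {for _, continuous (fun z => @GRing.add _ (@?f z) (@?g z))} =>
      apply: (@cont_add _ _ _ f g); cont
  | |- {for _, continuous (fun z => @GRing.opp _ (@?f z))} =>
      apply: (@cont_opp _ _ _ f); cont
  | |- {for _, continuous (fun z => @GRing.scale _ _ (@?f z) (@?g z))} =>
      apply: (@cont_scale _ _ _ f g); cont
  | |- {for _, continuous (fun z => @GRing.mul _ (@?f z) (@?g z))} =>
      apply: (@cont_mul _ _ f g); cont
  | |- {for _, continuous (fun z => @Num.norm _ _ (@?f z))} =>
      apply: (@cont_norm _ _ _ f); cont
  | |- {for _, continuous (fun z => Num.min (@?f z) (@?g z))} =>
      apply: (@cont_min _ _ f g); cont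
  | |- {for _, continuous (fun z => Num.max (@?f z) (@?g z))} =>
      apply: (@cont_max _ _ f g); cont
  | |- {for _, continuous (fun z => _)} =>
     first [ exact: cont_cst |
      lazymatch goal with |- {for _, continuous (fun z => ?g (@?f z))} =>
       apply: (@cont_comp _ _ _ f g); [try first [match goal with H : continuous g |- _ => exact: H end
          | solve [auto with contdb nocore]] | cont] end | idtac ]
  | |- _ => idtac
  end.

Section StrictDerivative.
Context {R : realType} {V : normedModType R}.
Implicit Types (f g : V -> R) (p v : V) (w D : R).

(** Strict differentiability along the line v: the estimate is uniform in the base
    point z.1 near p, not only at p. This is what makes the notion stable under
    composition with affine maps and additive in v, and what makes the derivative
    continuous where it exists. *)
Definition sderiv f p v D := forall e : R, 0 < e ->
  \forall z \near (p, 0 : R),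
    `|f (z.1 + z.2 *: v) - f z.1 - z.2 * D| <= e * `|z.2|.

(** Statements about points close to p are obtained by pulling back statements
    about a simpler variable. *)
Lemma near_comp {T U : topologicalType} (m : T -> U) z (u : U) (P : set U) :
  {for z, continuous m} -> m z = u -> (\near u, P u) -> \near z, P (m z).
Proof. by move=> cm <-; exact: cm. Qed.

Lemma is_derive_line f a v (t : R) : derivable f (a + t *: v) v ->
  is_derive t 1 (fun s : R => f (a + s *: v)) ('D_v f (a + t *: v)).
Proof.
move=> df.
have E : (fun h : R => h^-1 *: (((fun s : R => f (a + s *: v)) \o shift t) (h *: 1)
           - f (a + t *: v)))
       = (fun h : R => h^-1 *: ((f \o shift (a + t *: v)) (h *: v) - f (a + t *: v))).
  apply/funext => h /=; congr (_ *: (f _ - _)).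
  by rewrite scalerDl [_ *: 1]mulr1 addrCA.
by apply: DeriveDef; rewrite /derivable /derive E.
Qed.

(** Mean value theorem for s |-> f (a + s v) - s k, for steps h of either sign. *)
Lemma mvt_norm f a v (h k e : R) :
  (forall t : R, `|t| <= `|h| -> derivable f (a + t *: v) v /\
      `|'D_v f (a + t *: v) - k| <= e) ->
  `|f (a + h *: v) - f a - h * k| <= e * `|h|.
Proof.
move=> H.
have cl (x y : R) : (forall t, t \in `[x, y] -> `|t| <= `|h|) ->
    {within `[x, y], continuous (fun s : R => f (a + s *: v))}.
  move=> xy; apply: derivable_within_continuous => t /xy /H[df _].
  by have [] := is_derive_line df.
have dl (x y t : R) : (forall t, t \in `[x, y] -> `|t| <= `|h|) -> t \in `]x, y[%R ->
    is_derive t 1 (fun s : R => f (a + s *: v)) ('D_v f (a + t *: v)).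
  move=> xy /subset_itv_oo_cc /xy /H[df _]; exact: is_derive_line.
have [h0|h0] := leP 0 h.
  have xy t : t \in `[0, h] -> `|t| <= `|h|.
    by rewrite in_itv/= => /andP[t0 th]; rewrite !ger0_norm.
  have [t /xy th E] := MVT_segment h0 (fun t => @dl 0 h t xy) (cl _ _ xy).
  move: E; rewrite scale0r addr0 subr0 => ->.
  by rewrite mulrC -mulrBr normrM mulrC ler_wpM2r//; have [] := H t th.
have xy t : t \in `[h, 0] -> `|t| <= `|h|.
  by rewrite in_itv/= => /andP[t0 th]; rewrite !ler0_norm ?lerN2 ?(ltW h0).
have [t /xy th E] := MVT_segment (ltW h0) (fun t => @dl h 0 t xy) (cl _ _ xy).
move: E; rewrite scale0r addr0 sub0r => E.
have -> : f (a + h *: v) - f a - h * k = ('D_v f (a + t *: v) - k) * h.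
  by rewrite -[X in X - _]opprB E; ring.
by rewrite normrM ler_wpM2r//; have [] := H t th.
Qed.

Lemma nearby_segment p v (P : set V) : (\near p, P p) ->
  \forall z \near (p, 0 : R), forall t : R, `|t| <= `|z.2| -> P (z.1 + t *: v).
Proof.
move=> /nbhs_ballP[d /= d0 dP].
have d20 : 0 < d / 2 by rewrite divr_gt0.
near=> z => t tz; apply: dP; rewrite -ball_normE /=.
have z1 : `|p - z.1| < d / 2.
  near: z; apply: (@near_comp _ _ (fun z : V * R => `|p - z.1|) _ 0 (fun x => x < d/2)).
  - by cont.
  - by rewrite /= subrr normr0.
  - exact: lt_nbhsl d20.
have z2 : `|z.2| * `|v| < d / 2.
  near: z; apply: (@near_comp _ _ (fun z : V * R => `|z.2| * `|v|) _ 0 (fun x => x < d/2)).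
  - by cont.
  - by rewrite /= normr0 mul0r.
  - exact: lt_nbhsl d20.
rewrite opprD addrA (le_lt_trans (ler_normB _ _))// normrZ.
rewrite (splitr d) ltrD// (le_lt_trans _ z2)// ler_wpM2r//.
Unshelve. all: by end_near. Qed.

Lemma C1_sderiv f p v : (\forall a \near p, derivable f a v) ->
  {for p, continuous ('D_v f)} -> sderiv f p v ('D_v f p).
Proof.
move=> df + e e0; move=> /cvgrPdist_le/(_ e e0) cf.
have H : \forall a \near p, derivable f a v /\ `|'D_v f a - 'D_v f p| <= e.
  near=> a; split; first by near: a.
  rewrite distrC; near: a; exact: cf.
near=> z; apply: mvt_norm => t tz.
by move: t tz; near: z; exact: (nearby_segment v H).
Unshelve. all: by end_near. Qed.

Lemma sderiv_near f g p v D : (\forall a \near p, f a = g a) ->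
  sderiv f p v D -> sderiv g p v D.
Proof.
move=> fg sf e e0; near=> z.
have fgz : forall t : R, `|t| <= `|z.2| -> f (z.1 + t *: v) = g (z.1 + t *: v).
  by near: z; exact: (nearby_segment (P := fun a => f a = g a) v fg).
rewrite -fgz// -(addr0 z.1) -(scale0r v) -fgz ?normr0// scale0r !addr0.
by near: z; exact: sf.
Unshelve. all: by end_near. Qed.

Lemma sderiv_is_derive f p v D : sderiv f p v D -> is_derive p v f D.
Proof.
move=> sf.
have H : (fun h : R => h^-1 *: ((f \o shift p) (h *: v) - f p)) @ 0^' --> D.
  apply/cvgrPdist_le => e e0.
  have : \forall h \near (0 : R), `|f (p + h *: v) - f p - h * D| <= e * `|h|.
    apply: (@near_comp _ _ (fun h : R => (p, h)) _ _
      (fun z => `|f (z.1 + z.2 *: v) - f z.1 - z.2 * D| <= e * `|z.2|) _ _ (sf e e0)) => //.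
    by cont.
  move=> {}sf; near=> h.
  have h0 : h != 0 by near: h; exact: nbhs_dnbhs_neq.
  rewrite /= -(ler_pM2r (x := `|h|)) ?normr_gt0// -normrM mulrBl.
  rewrite -[_ *: _]/(_ * _) mulrAC mulVf// mul1r distrC mulrC (addrC (h *: v)) mulrC.
  rewrite (mulrC D); near: h; exact: nbhs_dnbhs.
by apply: DeriveDef; [apply/cvg_ex; exists D|exact/cvg_lim].
Unshelve. all: by end_near. Qed.

(** Moves first along u and then along v. The second step starts from a displaced
    point, which strictness of the derivative allows; this replaces the chain rule
    that partial derivatives alone would not give. *)
Lemma sderiv_lin f p u v (Du Dv al be : R) : sderiv f p u Du -> sderiv f p v Dv ->
  sderiv f p (al *: u + be *: v) (al * Du + be * Dv).
Proof.
move=> su sv e e0.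
pose M := 1 + `|al| + `|be|.
have M0 : 0 < M by rewrite /M -addrA ltr_pwDl// addr_ge0.
have eM : 0 < e / M by rewrite divr_gt0.
near=> z.
have H1 : `|f (z.1 + (al * z.2) *: u) - f z.1 - (al * z.2) * Du| <= e / M * `|al * z.2|.
  near: z; apply: (@near_comp _ _ (fun z : V * R => (z.1, al * z.2)) _ _
    (fun z => `|f (z.1 + z.2 *: u) - f z.1 - z.2 * Du| <= e / M * `|z.2|) _ _ (su _ eM)).
  - by cont.
  - by rewrite /= mulr0.
have H2 : `|f ((z.1 + (al * z.2) *: u) + (be * z.2) *: v) - f (z.1 + (al * z.2) *: u)
     - (be * z.2) * Dv| <= e / M * `|be * z.2|.
  near: z; apply: (@near_comp _ _ (fun z : V * R => (z.1 + (al * z.2) *: u, be * z.2)) _ _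
    (fun z => `|f (z.1 + z.2 *: v) - f z.1 - z.2 * Dv| <= e / M * `|z.2|) _ _ (sv _ eM)).
  - by cont.
  - by rewrite /= !mulr0 scale0r addr0.
rewrite scalerDr !scalerA ![z.2 * _]mulrC addrA.
set A := f _ in H1 H2 *; set B := f _ in H1 H2 *; set C := f _ in H1 *.
rewrite (_ : _ - _ = (C - A - be * z.2 * Dv) + (A - B - al * z.2 * Du)); last by ring.
apply: le_trans (ler_normD _ _) _; apply: le_trans (lerD H2 H1) _.
rewrite !normrM -!mulrDr -mulrDl !mulrA ler_wpM2r// -mulrA ler_piMr ?(ltW e0)//.
by rewrite mulrC ler_pdivrMr// mul1r /M; lra.
Unshelve. all: by end_near. Qed.

(** The derivatives at p and at a nearby point a are both close to the same
    difference quotient based at a. *)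
Lemma sderiv_C1 f p v : (\forall a \near p, exists D, sderiv f a v D) ->
  derivable f p v /\ {for p, continuous ('D_v f)}.
Proof.
move=> H; have [D sf] : exists D, sderiv f p v D by exact: nbhs_singleton H.
have [df Df] := sderiv_is_derive sf.
split=> //; apply/cvgrPdist_le => e e0.
have e2 : 0 < e / 2 by rewrite divr_gt0.
have : \forall a \near p, \forall h \near (0:R),
     `|f (a + h *: v) - f a - h * D| <= e / 2 * `|h|.
  have [[A B]/= [nA nB] AB] := sf _ e2.
  near=> a; near=> h.
  by apply: (AB (a, h)); split => /=; [near: a|near: h].
move=> H2; near=> a.
have [Da sa] : exists D, sderiv f a v D by near: a.
have [_ ->] := sderiv_is_derive sa; rewrite Df.
have : \forall h \near (0 : R)^', `|h| * `|D - Da| <= `|h| * e.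
  near=> h.
  have H3 : `|f (a + h *: v) - f a - h * D| <= e / 2 * `|h|.
    by near: h; apply: nbhs_dnbhs; near: a.
  have H4 : `|f (a + h *: v) - f a - h * Da| <= e / 2 * `|h|.
    near: h; apply: nbhs_dnbhs.
    apply: (@near_comp _ _ (fun h : R => (a, h)) _ _
      (fun z => `|f (z.1 + z.2 *: v) - f z.1 - z.2 * Da| <= e / 2 * `|z.2|) _ _ (sa _ e2)) => //.
    by cont.
  rewrite -normrM (_ : h * _ = (f (a + h *: v) - f a - h * Da) - (f (a + h *: v) - f a - h * D)); last by ring.
  rewrite (le_trans (ler_normB _ _))// (le_trans (lerD H4 H3))//.
  by rewrite -mulrDl -splitr mulrC.
move=> H3.
have [h [h0]] : exists h : R, h != 0 /\ `|h| * `|D - Da| <= `|h| * e.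
  near (0 : R)^' => h; exists h; split; first by near: h; exact: nbhs_dnbhs_neq.
  by near: h.
by rewrite ler_pM2l ?normr_gt0.
Unshelve. all: by end_near. Qed.

End StrictDerivative.

Lemma sderiv_comp {R : realType} {V W : normedModType R} (g : W -> R) (phi : V -> W)
   (p v : V) (w : W) (D : R) :
  {for p, continuous phi} -> (forall a (h : R), phi (a + h *: v) = phi a + h *: w) ->
  sderiv g (phi p) w D -> sderiv (g \o phi) p v D.
Proof.
move=> cphi lphi sg e e0; near=> z; rewrite /= lphi; near: z.
apply: (@near_comp _ _ (fun z : V * R => (phi z.1, z.2)) _ _
  (fun z => `|g (z.1 + z.2 *: w) - g z.1 - z.2 * D| <= e * `|z.2|) _ _ (sg _ e0)) => //.
by cont.
Unshelve. all: by end_near. Qed.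

(** * The defect of differentiability *)

Section Defect.
Context {R : realType} {V : normedModType R}.
Implicit Types (f g : V -> R) (p v : V) (w D k : R) (x y : V * R).

Definition incr f v x : R := f (x.1 + x.2 *: v) - f x.1.

(** Compares the difference quotients G x / x.2 and G y / y.2 after multiplication
    by x.2 * y.2, so that zero steps need no exception. *)
Definition dev (G : V * R -> R) x y : R := y.2 * G x - x.2 * G y.

(** At most w up to arbitrarily small e: the oscillation of the quotients G x / x.2
    as the base point tends to p and the step to 0. It is stated for an arbitrary G
    so that an increment can be split into pieces that are not increments. *)
Definition slope_defect (G : V * R -> R) p w := forall e : R, 0 < e ->
  \forall z \near ((p, 0 : R), (p, 0 : R)),
    `|dev G z.1 z.2| <= (w + e) * `|z.1.2 * z.2.2|.

Definition defect f p v w := slope_defect (incr f v) p w.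

Lemma slope_defect_near (G G' : V * R -> R) p w :
  (\forall x \near (p, 0 : R), G x = G' x) ->
  slope_defect G p w -> slope_defect G' p w.
Proof.
move=> GG' dG e e0; near=> z.
have E1 : G z.1 = G' z.1.
  by near: z; apply: (near_comp (m := fst)) GG' => //; exact: cvg_fst.
have E2 : G z.2 = G' z.2.
  by near: z; apply: (near_comp (m := snd)) GG' => //; exact: cvg_snd.
by rewrite /dev -E1 -E2; near: z; exact: dG.
Unshelve. all: by end_near. Qed.

Lemma slope_defect_le (G : V * R -> R) p w w' : w <= w' ->
  slope_defect G p w -> slope_defect G p w'.
Proof.
move=> ww' dG e e0; near=> z.
apply: le_trans (_ : (w + e) * `|z.1.2 * z.2.2| <= _).
  by near: z; exact: dG.
by rewrite ler_wpM2r// lerD2r.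
Unshelve. all: by end_near. Qed.

(** Quotients that converge do not oscillate in the limit. *)
Lemma slope_defect0 (G : V * R -> R) p D :
  (forall e : R, 0 < e -> \forall x \near (p, 0 : R), `|G x - x.2 * D| <= e * `|x.2|) ->
  slope_defect G p 0.
Proof.
move=> sf e e0; have e2 : 0 < e / 2 by rewrite divr_gt0.
near=> z.
have H1 : `|G z.1 - z.1.2 * D| <= e / 2 * `|z.1.2|.
  near: z; apply: (near_comp (m := fst)) (sf _ e2) => //; exact: cvg_fst.
have H2 : `|G z.2 - z.2.2 * D| <= e / 2 * `|z.2.2|.
  near: z; apply: (near_comp (m := snd)) (sf _ e2) => //; exact: cvg_snd.
have -> : dev G z.1 z.2 = z.2.2 * (G z.1 - z.1.2 * D) - z.1.2 * (G z.2 - z.2.2 * D).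
  by rewrite /dev; ring.
rewrite (le_trans (ler_normB _ _))// !normrM.
have H3 := ler_wpM2l (normr_ge0 z.2.2) H1.
have H4 := ler_wpM2l (normr_ge0 z.1.2) H2.
rewrite (le_trans (lerD H3 H4))//; lra.
Unshelve. all: by end_near. Qed.

Lemma slope_defectD (G G' : V * R -> R) p w w' :
  slope_defect G p w -> slope_defect G' p w' ->
  slope_defect (fun x => G x + G' x) p (w + w').
Proof.
move=> df dg e e0; have e2 : 0 < e / 2 by rewrite divr_gt0.
near=> z.
have H1 : `|dev G z.1 z.2| <= (w + e / 2) * `|z.1.2 * z.2.2| by near: z; exact: df.
have H2 : `|dev G' z.1 z.2| <= (w' + e / 2) * `|z.1.2 * z.2.2| by near: z; exact: dg.
have -> : dev (fun x => G x + G' x) z.1 z.2 = dev G z.1 z.2 + dev G' z.1 z.2.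
  by rewrite /dev; ring.
rewrite (le_trans (ler_normD _ _))// (le_trans (lerD H1 H2))//; lra.
Unshelve. all: by end_near. Qed.

Definition lip_along f v k := forall p (h : R), `|f (p + h *: v) - f p| <= k * `|h|.

(** Two quotients in [- k, k] are at distance at most 2 k: the starting point of
    the halving of defects. *)
Lemma lip_defect f p v k : lip_along f v k -> defect f p v (2 * k).
Proof.
move=> lf e e0; near=> z; rewrite /dev /incr.
rewrite (le_trans (ler_normB _ _))// !normrM.
have H1 := ler_wpM2l (normr_ge0 z.2.2) (lf z.1.1 z.1.2).
have H2 := ler_wpM2l (normr_ge0 z.1.2) (lf z.2.1 z.2.2).
rewrite (le_trans (lerD H1 H2))//.
have : 0 <= e * (`|z.1.2| * `|z.2.2|) by rewrite mulr_ge0 ?(ltW e0)// mulr_ge0.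
lra.
Unshelve. all: by end_near. Qed.

Lemma defect_near f g p v w : (\forall a \near p, f a = g a) ->
  defect f p v w -> defect g p v w.
Proof.
move=> fg; apply: slope_defect_near; near=> x.
have fgx : forall t : R, `|t| <= `|x.2| -> f (x.1 + t *: v) = g (x.1 + t *: v).
  by near: x; exact: (nearby_segment (P := fun a => f a = g a) v fg).
have := fgx 0; rewrite normr0 normr_ge0 scale0r addr0 => /(_ isT) E.
by rewrite /incr fgx// E.
Unshelve. all: by end_near. Qed.

Lemma sderiv_defect f p v D : sderiv f p v D -> defect f p v 0.
Proof. exact: slope_defect0. Qed.

Lemma defectD f g p v w w' : defect f p v w -> defect g p v w' ->
  defect (fun a => f a + g a) p v (w + w').
Proof.
move=> df dg; apply: slope_defect_near (slope_defectD df dg).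
by near=> x; rewrite /incr; ring.
Unshelve. all: by end_near. Qed.

Lemma defectZ k f p v w : defect f p v w -> defect (fun a => k * f a) p v (`|k| * w).
Proof.
move=> df e e0.
have k0 : 0 < `|k| + 1 by rewrite ltr_wpDl.
have e2 : 0 < e / (`|k| + 1) by rewrite divr_gt0.
near=> z.
have H1 : `|dev (incr f v) z.1 z.2| <= (w + e / (`|k| + 1)) * `|z.1.2 * z.2.2|.
  by near: z; exact: df.
have -> : dev (incr (fun a => k * f a) v) z.1 z.2 = k * dev (incr f v) z.1 z.2.
  by rewrite /dev /incr; ring.
rewrite normrM (le_trans (ler_wpM2l (normr_ge0 k) H1))//.
rewrite mulrA ler_wpM2r// mulrDr lerD2l mulrCA ler_piMr ?(ltW e0)//.
by rewrite ler_pdivrMr// mul1r lerDl.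
Unshelve. all: by end_near. Qed.

(** Leibniz rule f1 (g1' - g2') + (f1 - f2) g2' + ... on difference quotients: by
    continuity the terms with f1 - f2 disappear in the limit, and the factors f1
    and g1 are at most X. *)
Lemma defectM f g p v w w' (X : R) : {for p, continuous f} -> {for p, continuous g} ->
  `|f p| <= X -> `|g p| <= X -> 0 <= w -> 0 <= w' ->
  lip_along f v X -> lip_along g v X -> defect f p v w -> defect g p v w' ->
  defect (fun a => f a * g a) p v (X * (w + w')).
Proof.
move=> cf cg fX gX w0 w'0 lf lg df dg e e0.
have X0 : 0 <= X by exact: le_trans fX.
(* With all small quantities at most r <= 1, the error terms sum to at most
   2 M r. *)
pose M := 2 * X + w + w' + 1 + 2 * X.
have M0 : 0 < M by rewrite /M; lra.
pose r := Num.min 1 (e / (2 * M)).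
have r0 : 0 < r by rewrite lt_min ltr01 divr_gt0// mulr_gt0.
have r1 : r <= 1 by rewrite ge_min lexx.
have rM : 2 * M * r <= e.
  by rewrite mulrC -ler_pdivlMr ?mulr_gt0// ge_min lexx orbT.
have clo (F : V -> R) (m : (V * R) * (V * R) -> V) : {for p, continuous F} ->
    {for ((p, 0), (p, 0)), continuous m} -> m ((p, 0), (p, 0)) = p ->
    \forall z \near ((p, 0 : R), (p, 0 : R)), `|F p - F (m z)| <= r.
  move=> cF cm mp; apply: (near_comp cm mp (P := fun a => `|F p - F a| <= r)).
  by move/cvgrPdist_le: cF; apply.
near=> z.
have H1 : `|dev (incr f v) z.1 z.2| <= (w + r) * `|z.1.2 * z.2.2| by near: z; exact: df.
have H2 : `|dev (incr g v) z.1 z.2| <= (w' + r) * `|z.1.2 * z.2.2| by near: z; exact: dg.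
have A1 : `|f p - f (z.1.1 + z.1.2 *: v)| <= r.
  near: z; apply: clo => //; last by rewrite /= scale0r addr0.
  by cont.
have A2 : `|f p - f (z.2.1 + z.2.2 *: v)| <= r.
  near: z; apply: clo => //; last by rewrite /= scale0r addr0.
  by cont.
have A3 : `|g p - g z.1.1| <= r by near: z; apply: clo => //; cont.
have A4 : `|g p - g z.2.1| <= r by near: z; apply: clo => //; cont.
set f1 := f (z.1.1 + _) in A1 *; set f2 := f (z.2.1 + _) in A2 *.
set g1 := g z.1.1 in A3; set g2 := g z.2.1 in A4.
have B1 := lg z.2.1 z.2.2; have B2 := lf z.2.1 z.2.2.
rewrite -/f2 in B2; rewrite -/g2 in B1.
have -> : dev (incr (fun a => f a * g a) v) z.1 z.2 =
   f1 * dev (incr g v) z.1 z.2 + (f1 - f2) * (z.1.2 * incr g v z.2)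
   + (g1 * dev (incr f v) z.1 z.2 + (g1 - g2) * (z.1.2 * incr f v z.2)).
  by rewrite /dev /incr -/f1 -/f2 -/g1 -/g2; ring.
set h := z.1.2 in H1 H2 *; set l := z.2.2 in H1 H2 B1 B2 *.
have f1X : `|f1| <= X + r.
  rewrite (_ : f1 = f p - (f p - f1)); last by rewrite subKr.
  by rewrite (le_trans (ler_normB _ _))// lerD.
have g1X : `|g1| <= X + r.
  rewrite (_ : g1 = g p - (g p - g1)); last by rewrite subKr.
  by rewrite (le_trans (ler_normB _ _))// lerD.
have f12 : `|f1 - f2| <= 2 * r.
  rewrite (_ : f1 - f2 = (f p - f2) - (f p - f1)); last by ring.
  by rewrite (le_trans (ler_normB _ _))// mulrDl mul1r lerD.
have g12 : `|g1 - g2| <= 2 * r.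
  rewrite (_ : g1 - g2 = (g p - g2) - (g p - g1)); last by ring.
  by rewrite (le_trans (ler_normB _ _))// mulrDl mul1r lerD.
have hl0 : 0 <= `|h * l| by [].
have C1 : `|f1 * dev (incr g v) z.1 z.2| <= (X + r) * ((w' + r) * `|h * l|).
  by rewrite normrM ler_pM.
have C2 : `|g1 * dev (incr f v) z.1 z.2| <= (X + r) * ((w + r) * `|h * l|).
  by rewrite normrM ler_pM.
have C3 : `|(f1 - f2) * (h * incr g v z.2)| <= 2 * r * (X * `|h * l|).
  rewrite normrM ler_pM// normrM normrM mulrCA ler_wpM2l//.
have C4 : `|(g1 - g2) * (h * incr f v z.2)| <= 2 * r * (X * `|h * l|).
  rewrite normrM ler_pM// normrM normrM mulrCA ler_wpM2l//.
rewrite (le_trans (ler_normD _ _))// (le_trans (lerD (ler_normD _ _) (ler_normD _ _)))//.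
rewrite (le_trans (lerD (lerD C1 C3) (lerD C2 C4)))//.
have -> : (X + r) * ((w' + r) * `|h * l|) + 2 * r * (X * `|h * l|) +
  ((X + r) * ((w + r) * `|h * l|) + 2 * r * (X * `|h * l|)) =
  (X * (w + w') + (2 * X * r + (w + w') * r + 2 * r * r + 4 * X * r)) * `|h * l| by ring.
rewrite ler_wpM2r// lerD2l (le_trans _ rM)//.
have rr : r * r <= r by rewrite ler_piMl// ltW.
have : 0 <= X * r by rewrite mulr_ge0// ltW.
have : 0 <= w * r by rewrite mulr_ge0// ltW.
have : 0 <= w' * r by rewrite mulr_ge0// ltW.
rewrite /M; lra.
Unshelve. all: by end_near. Qed.

(** Cauchy criterion: without oscillation the quotients at p converge, and then
    those at nearby base points are close to the same limit. *)
Lemma defect0_sderiv f p v : defect f p v 0 -> exists D, sderiv f p v D.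
Proof.
move=> df.
pose qt (h : R) := h^-1 * (f (p + h *: v) - f p).
have qtE (h : R) : h != 0 -> f (p + h *: v) - f p = h * qt h.
  by move=> h0; rewrite /qt mulVKf.
have [D cvD] : exists D, qt h @[h --> 0^'] --> D.
  apply/cvg_ex; apply/cauchy_cvgP; apply/cauchyP => e e0.
  have e2 : 0 < e / 2 by rewrite divr_gt0.
  have [[A B]/= [nA nB] AB] := df _ e2.
  have nA' : \forall h \near (0:R)^', A (p, h).
    apply: nbhs_dnbhs; apply: (@near_comp _ _ (fun h : R => (p, h)) _ _ A _ _ nA) => //.
    by cont.
  have nB' : \forall h \near (0:R)^', B (p, h).
    apply: nbhs_dnbhs; apply: (@near_comp _ _ (fun h : R => (p, h)) _ _ B _ _ nB) => //.
    by cont.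
  have [l [l0 Bl]] : exists l : R, l != 0 /\ B (p, l).
    near (0 : R)^' => l; exists l; split; last by near: l.
    by near: l; exact: nbhs_dnbhs_neq.
  exists (qt l); near=> h.
  have h0 : h != 0 by near: h; exact: nbhs_dnbhs_neq.
  have Ah : A (p, h) by near: h.
  have := AB ((p, h), (p, l)) (conj Ah Bl).
  rewrite /dev /incr /= !qtE// add0r.
  rewrite (_ : _ - _ = h * l * (qt h - qt l)); last by ring.
  rewrite normrM mulrC ler_pM2r ?normr_gt0 ?mulf_neq0// => H.
  rewrite /= -ball_normE /= distrC (le_lt_trans H)//.
  by rewrite ltr_pdivrMr// ltr_pMr// ltr1n.
exists D => e e0.
have e2 : 0 < e / 2 by rewrite divr_gt0.
have [[A B]/= [nA nB] AB] := df _ e2.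
have nB' : \forall h \near (0:R)^', B (p, h).
  apply: nbhs_dnbhs; apply: (@near_comp _ _ (fun h : R => (p, h)) _ _ B _ _ nB) => //.
  by cont.
(* A single small step l at p, compared with all steps at all nearby points,
   gives the uniformity in the base point. *)
have [l [l0 Bl Dl]] : exists l : R, [/\ l != 0, B (p, l) & `|D - qt l| <= e / 2].
  near (0 : R)^' => l; exists l; split.
  - by near: l; exact: nbhs_dnbhs_neq.
  - by near: l.
  - by near: l; move/cvgrPdist_le: cvD; apply.
near=> z.
have Az : A z by near: z.
have := AB (z, (p, l)) (conj Az Bl).
rewrite /dev /incr /= qtE// add0r => H.
rewrite (_ : _ - _ - _ = (f (z.1 + z.2 *: v) - f z.1 - z.2 * qt l) - z.2 * (D - qt l)); last by ring.
rewrite (le_trans (ler_normB _ _))// [leRHS](_ : _ = e / 2 * `|z.2| + e / 2 * `|z.2|); last by rewrite -mulrDl -splitr.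
rewrite lerD//.
  rewrite -(ler_pM2l (x := `|l|)) ?normr_gt0// -normrM.
  rewrite (_ : l * _ = l * (f (z.1 + z.2 *: v) - f z.1) - z.2 * (l * qt l)); last by ring.
  by rewrite (le_trans H)// normrM mulrA mulrC.
by rewrite normrM mulrC ler_wpM2r.
Unshelve. all: by end_near. Qed.

End Defect.

(** * Planes and boxes *)

Section Coordinates.
Context {R : realType}.
Local Notation V3 := (R * R * R)%type.
Implicit Types (p v : V3) (h : R).

Lemma tc_line p v h : tc (p + h *: v) = tc p + h * tc v. Proof. by []. Qed.
Lemma xc_line p v h : xc (p + h *: v) = xc p + h * xc v. Proof. by []. Qed.
Lemma yc_line p v h : yc (p + h *: v) = yc p + h * yc v. Proof. by []. Qed.
Definition line_coord := (tc_line, xc_line, yc_line).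

Lemma cont_tc {T : topologicalType} (f : T -> V3) (z : T) :
  {for z, continuous f} -> {for z, continuous (fun z => tc (f z))}.
Proof. by move=> cf; rewrite /tc; cont. Qed.
Lemma cont_xc {T : topologicalType} (f : T -> V3) (z : T) :
  {for z, continuous f} -> {for z, continuous (fun z => xc (f z))}.
Proof. by move=> cf; rewrite /xc; cont. Qed.
Lemma cont_yc {T : topologicalType} (f : T -> V3) (z : T) :
  {for z, continuous f} -> {for z, continuous (fun z => yc (f z))}.
Proof. by move=> cf; rewrite /yc; cont. Qed.

End Coordinates.

#[global] Hint Extern 1 ({for _, continuous (@tc _)}) =>
  exact: (@cont_tc _ _ _ _ (@cont_id _ _)) : contdb.
#[global] Hint Extern 1 ({for _, continuous (@xc _)}) =>
  exact: (@cont_xc _ _ _ _ (@cont_id _ _)) : contdb.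
#[global] Hint Extern 1 ({for _, continuous (@yc _)}) =>
  exact: (@cont_yc _ _ _ _ (@cont_id _ _)) : contdb.

Lemma near_at_right {R : realType} (P : set R) (x : R) : (\forall h \near x, P h) ->
  \forall h \near x^'+, P h.
Proof.
move=> nP; rewrite near_withinE; near=> h => _; near: h; exact: nP.
Unshelve. all: by end_near. Qed.

Section Planes.
Context {R : realType}.
Local Notation V3 := (R * R * R)%type.
Implicit Types (p v : V3) (h : R) (H : set V3) (s : seq (set V3)).

Lemma plane_near H p : is_plane H -> ~ H p -> \forall a \near p, ~ H a.
Proof.
move=> [n [d [n0 ->]]] /= pd.
apply: (near_comp (m := fun a => tc n * tc a + xc n * xc a + yc n * yc a)
  (P := fun x => x <> d) _ erefl).
  by rewrite /tc /xc /yc; cont.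
near=> x; apply/eqP; near: x; apply: open_nbhs_nbhs; split; first exact: open_neq.
exact/eqP.
Unshelve. all: by end_near. Qed.

(** Two points of the line in the plane put the whole line in the plane. *)
Lemma plane_line H p v (t t' : R) : is_plane H ->
  H (p + t *: v) -> H (p + t' *: v) -> t != t' -> H p.
Proof.
move=> [n [d [n0 ->]]]; rewrite /mkset !line_coord => E E' tt'.
pose k := tc n * tc v + xc n * xc v + yc n * yc v.
have K : (t - t') * k = 0 by rewrite /k; lra.
have k0 : k = 0.
  by move/eqP : K; rewrite mulf_eq0 subr_eq0 (negbTE tt')/= => /eqP.
have : t * k = 0 by rewrite k0 mulr0.
rewrite /k; lra.
Qed.

(** Moves p along the normal of the plane. *)
Lemma off_plane H p (P : set V3) : is_plane H -> (\near p, P p) ->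
  exists2 p', (\near p', P p') & ~ H p'.
Proof.
move=> HH nP; have [Hp|?] := pselect (H p); last by exists p.
have := HH => -[n [d [n0 HE]]].
have nnP : \forall a \near p, \near a, P a by exact: (near_join nP).
have : \forall h \near (0 : R)^', nbhs (p + h *: n) P.
  apply: nbhs_dnbhs; apply: (near_comp _ _ nnP (m := fun h : R => p + h *: n)).
    by cont.
  by rewrite scale0r addr0.
move=> nh; near (0 : R)^' => h; exists (p + h *: n); first by near: h.
have h0 : h != 0 by near: h; exact: nbhs_dnbhs_neq.
move=> Hh.
have H2h : tc n * tc n + xc n * xc n + yc n * yc n = 0.
  move: Hh Hp; rewrite HE /mkset !line_coord => E E'.
  apply: (mulfI h0); lra.
move/negP : n0; apply; apply/eqP.
have sq0 (x y z : R) : x * x + y * y + z * z = 0 -> x = 0 /\ y = 0 /\ z = 0.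
  move=> /eqP; rewrite paddr_eq0 ?addr_ge0 -?expr2 ?sqr_ge0//.
  by rewrite paddr_eq0 ?sqr_ge0// !sqrf_eq0 => /andP[/andP[/eqP ? /eqP ?] /eqP ?].
have [tn [xn yn]] := sq0 _ _ _ H2h.
by case: (n) tn xn yn => [[? ?] ?]; rewrite /tc /xc /yc /= => -> -> ->.
Unshelve. all: by end_near. Qed.

(** A finite union of planes has empty interior: leave the planes one after the
    other, by steps so small that the planes already left are not met again. *)
Lemma generic_point s p (P : set V3) : (forall H, H \in s -> is_plane H) ->
  (\near p, P p) -> exists2 p', P p' & forall H, H \in s -> ~ H p'.
Proof.
elim: s p P => [|H s IH] p P plane nP; first by exists p => //; exact: nbhs_singleton nP.
have Hplane : is_plane H by apply: plane; rewrite mem_head.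
have [p1 nP1 nH1] := off_plane Hplane nP.
have nQ : \forall a \near p1, P a /\ ~ H a.
  by apply: filterI nP1 _; exact: plane_near.
have plane' H' : H' \in s -> is_plane H'.
  by move=> H's; apply: plane; rewrite inE H's orbT.
have [p' [Pp' Hp'] sp'] := IH _ _ plane' nQ.
exists p' => // H'; rewrite inE => /predU1P[-> //|]; exact: sp'.
Qed.

(** The line starts outside every plane, so it meets each of them at most once:
    split the segment at the crossings and apply the mean value theorem on each
    piece. *)
Lemma segment_off_planes s (f : V3 -> R) p v (x y k : R) :
  (forall H, H \in s -> is_plane H) -> (forall H, H \in s -> ~ H p) ->
  x <= y -> 0 <= k -> continuous f ->
  (forall t, x < t < y -> (forall H, H \in s -> ~ H (p + t *: v)) ->
     derivable f (p + t *: v) v /\ `|'D_v f (p + t *: v)| <= k) ->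
  `|f (p + y *: v) - f (p + x *: v)| <= k * (y - x).
Proof.
move=> + + + k0 cf; elim: s x y => [|H s IH] x y plane offp xy df.
  have df' t : t \in `]x, y[%R ->
      is_derive t 1 (fun t : R => f (p + t *: v)) ('D_v f (p + t *: v)).
    by rewrite in_itv/= => /df[//|d _]; exact: is_derive_line.
  have cl : {within `[x, y], continuous (fun t : R => f (p + t *: v))}.
    by apply: continuous_subspaceT; cont.
  move: xy; rewrite le_eqVlt => /predU1P[->|xy].
    by rewrite !subrr normr0 mulr0.
  have [t txy ->] := MVT xy df' cl.
  rewrite normrM (gtr0_norm (x := y - x)) ?subr_gt0// ler_wpM2r ?subr_ge0 ?(ltW xy)//.
  by move: txy; rewrite in_itv/= => /df[].
have plane' H' : H' \in s -> is_plane H'.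
  by move=> H's; apply: plane; rewrite inE H's orbT.
have offp' H' : H' \in s -> ~ H' p.
  by move=> H's; apply: offp; rewrite inE H's orbT.
have Hplane : is_plane H by apply: plane; rewrite mem_head.
have offH : ~ H p by apply: offp; rewrite mem_head.
have [[t [txy Ht]]|nt] := pselect (exists t, x < t < y /\ H (p + t *: v)); last first.
  apply: IH => // t txy off; apply: df => // H'; rewrite inE => /predU1P[-> Ht|].
    by apply: nt; exists t.
  exact: off.
have uniq t' : t' != t -> ~ H (p + t' *: v).
  by move=> t't Ht'; apply: offH; exact: (plane_line Hplane Ht' Ht).
case/andP: txy => xt ty.
have H1 : `|f (p + t *: v) - f (p + x *: v)| <= k * (t - x).
  apply: IH => //; first exact: ltW.
  move=> u /andP[xu ut] off; apply: df; first by rewrite xu (lt_trans ut).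
  move=> H'; rewrite inE => /predU1P[->|]; last exact: off.
  by apply: uniq; rewrite lt_eqF.
have H2 : `|f (p + y *: v) - f (p + t *: v)| <= k * (y - t).
  apply: IH => //; first exact: ltW.
  move=> u /andP[tu uy] off; apply: df; first by rewrite uy (lt_trans xt).
  move=> H'; rewrite inE => /predU1P[->|]; last exact: off.
  by apply: uniq; rewrite gt_eqF.
rewrite -(subrKA (f (p + t *: v))) (le_trans (ler_normD _ _))//.
rewrite (le_trans (lerD H2 H1))//; lra.
Qed.

End Planes.

Section Box.
Context {R : realType}.
Local Notation V3 := (R * R * R)%type.
Variables (a1 b1 a2 b2 tau tau' : R).
Hypotheses (ab1 : a1 < b1) (ab2 : a2 < b2) (tt : tau < tau').
Local Notation P := (Pdom a1 b1 a2 b2 tau tau').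
Implicit Types (p v : V3) (h : R).

(** The interior of the box, in coordinates. *)
Definition Pint : set V3 := [set p | [/\ tau < tc p < tau',
  a1 < xc p < b1 & a2 < yc p < b2]].

Lemma PdomE p : P p <-> [/\ tau <= tc p <= tau', a1 <= xc p <= b1 & a2 <= yc p <= b2].
Proof.
rewrite /Pdom /tc /xc /yc /=; split.
  by move=> [[]]; rewrite /= !in_itv/=.
by move=> [? ? ?]; split; [split|]; rewrite /= in_itv.
Qed.

Lemma Pint_Pdom p : Pint p -> P p.
Proof.
move=> [/andP[? ?] /andP[? ?] /andP[? ?]]; apply/PdomE.
by split; apply/andP; split; exact: ltW.
Qed.

Lemma near_Pint p : Pint p -> \near p, Pint p.
Proof.
have lt2 (g : V3 -> R) (a b : R) : continuous g -> a < g p < b ->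
    \forall z \near p, a < g z < b.
  move=> cg /andP[ag gb]; apply: (near_comp (cg p) erefl (P := fun x => a < x < b)).
  near=> x; apply/andP; split; near: x.
    exact: lt_nbhsr.
  exact: lt_nbhsl.
move=> [/lt2 t /lt2 x /lt2 y].
near=> z; split; near: z.
- by apply: t => z; apply: cont_tc; exact: cont_id.
- by apply: x => z; apply: cont_xc; exact: cont_id.
- by apply: y => z; apply: cont_yc; exact: cont_id.
Unshelve. all: by end_near. Qed.

Lemma interior_Pdom p : P° p <-> Pint p.
Proof.
split => [iP|ip]; last first.
  by apply: filterS (near_Pint ip) => a; exact: Pint_Pdom.
have dirP (v : V3) : exists e : R, [/\ 0 < e, P (p + e *: v) & P (p + (- e) *: v)].
  have c (k : R) : {for 0, continuous (fun h : R => p + (k * h) *: v)} by cont.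
  have E k : p + (k * 0) *: v = p by rewrite mulr0 scale0r addr0.
  have n1 : \forall h \near (0:R)^'+, P (p + (1 * h) *: v).
    by apply: near_at_right; apply: (near_comp (c 1) (E 1)).
  have n2 : \forall h \near (0:R)^'+, P (p + (-1 * h) *: v).
    by apply: near_at_right; apply: (near_comp (c (-1)) (E (-1))).
  near (0:R)^'+ => e; exists e; split => //.
    by rewrite -[e]mul1r; near: e.
  by rewrite -mulN1r; near: e.
have [e1 [e10 /PdomE[p1 _ _] /PdomE[p1' _ _]]] := dirP et.
have [e2 [e20 /PdomE[_ p2 _] /PdomE[_ p2' _]]] := dirP ex.
have [e3 [e30 /PdomE[_ _ p3] /PdomE[_ _ p3']]] := dirP ey.
move: p1 p1' p2 p2' p3 p3'; rewrite !line_coord /tc/xc/yc /= !mulr1.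
move=> /andP[? ?] /andP[? ?] /andP[? ?] /andP[? ?] /andP[? ?] /andP[? ?].
by split; apply/andP; split; rewrite /tc /xc /yc; lra.
Unshelve. all: by end_near. Qed.

Lemma Pint_segment p v (x y t : R) : Pint (p + x *: v) -> Pint (p + y *: v) ->
  x <= t <= y -> Pint (p + t *: v).
Proof.
have aux (a b u w : R) : a < u + x * w < b -> a < u + y * w < b -> x <= t <= y ->
    a < u + t * w < b.
  move=> /andP[l1 l2] /andP[l3 l4] /andP[xt ty].
  have [w0|w0] := leP 0 w.
    have := ler_wpM2r w0 xt; have := ler_wpM2r w0 ty; lra.
  have := ler_wnM2r (ltW w0) xt; have := ler_wnM2r (ltW w0) ty; lra.
move=> [+ + +] [+ + +] xty; rewrite !line_coord => A B C A' B' C'.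
by split; rewrite line_coord; exact: aux.
Qed.

Definition clampr (a b x : R) := Num.max a (Num.min x b).
(** The nearest point of the box. Functions on the box are extended to the whole
    space by composition with it, which keeps bounds and Lipschitz constants and
    avoids one-sided limits at the faces. *)
Definition clamp p : V3 :=
  (clampr tau tau' (tc p), clampr a1 b1 (xc p), clampr a2 b2 (yc p)).

Lemma clampr_in a b x : a <= b -> a <= clampr a b x <= b.
Proof. by move=> ab; rewrite /clampr le_max lexx/= ge_max ab ge_min lexx orbT. Qed.

Lemma clampr_id a b x : a <= x <= b -> clampr a b x = x.
Proof. by move=> /andP[ax xb]; rewrite /clampr min_l// max_r. Qed.

Lemma clamp_in p : P (clamp p).
Proof. by apply/PdomE; split; apply: clampr_in; exact: ltW. Qed.

Lemma clamp_id p : P p -> clamp p = p.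
Proof.
by move=> /PdomE[? ? ?]; rewrite /clamp !clampr_id// /tc /xc /yc -!surjective_pairing.
Qed.

Lemma clampr_cont a b : continuous (clampr a b).
Proof. by rewrite /clampr; cont. Qed.

Lemma clamp_cont : continuous clamp.
Proof.
by rewrite /clamp /clampr; cont.
Qed.

Lemma clampr_line a b x h : exists2 k : R, `|k| <= `|h| &
  clampr a b (x + h) = clampr a b x + k.
Proof.
exists (clampr a b (x + h) - clampr a b x); last by rewrite addrCA subrr addr0.
rewrite /clampr !maxEle !minEle.
have [h0|h0] := leP 0 h; [rewrite (ger0_norm h0)|rewrite (ltr0_norm h0)];
  rewrite ler_norml; apply/andP; (have [?|?] := leP (x + h) b);
  (have [?|?] := leP x b); split; do ?case: (leP a _) => ?; lra.
Qed.

Definition box_center : V3 := ((tau + tau') / 2, (a1 + b1) / 2, (a2 + b2) / 2).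

(** Convexity: the open segment from a point of the box to its centre is interior. *)
Lemma Pint_shrink p (s : R) : P p -> 0 < s < 1 -> Pint (p + s *: (box_center - p)).
Proof.
have aux (a b x : R) : a < b -> a <= x <= b -> 0 < s < 1 ->
    a < x + s * ((a + b) / 2 - x) < b.
  move=> ab /andP[ax xb] /andP[s0 s1].
  have : 0 <= (1 - s) * (x - a) by rewrite mulr_ge0; lra.
  have : 0 <= (1 - s) * (b - x) by rewrite mulr_ge0; lra.
  have : 0 < s * (b - a) by rewrite mulr_gt0; lra.
  by move=> ? ? ?; apply/andP; split; lra.
move=> /PdomE[pt px py] s01; split; rewrite line_coord.
- by rewrite (_ : tc (box_center - p) = (tau + tau') / 2 - tc p)//; exact: aux.
- by rewrite (_ : xc (box_center - p) = (a1 + b1) / 2 - xc p)//; exact: aux.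
- by rewrite (_ : yc (box_center - p) = (a2 + b2) / 2 - yc p)//; exact: aux.
Qed.

(** Generic lines are handled by the mean value theorem, the other interior pairs
    by moving them slightly off the planes, and boundary pairs by shrinking them
    towards the centre of the box. *)
Lemma lip_off_planes (s : seq (set V3)) (f : V3 -> R) v (k : R) :
  (forall H, H \in s -> is_plane H) -> 0 <= k -> continuous f ->
  (forall p, Pint p -> (forall H, H \in s -> ~ H p) ->
     derivable f p v /\ `|'D_v f p| <= k) ->
  forall p h, P p -> P (p + h *: v) -> `|f (p + h *: v) - f p| <= k * `|h|.
Proof.
move=> plane k0 cf df.
(* A strict failure is an open condition on p, so it would also occur at a point
   outside all the planes. *)
have stepB p h : Pint p -> Pint (p + h *: v) -> `|f (p + h *: v) - f p| <= k * `|h|.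
  move=> ip iph; rewrite leNgt; apply/negP => lt.
  have [||p' [ip' iph' lt'] off] := @generic_point _ s p (fun p => [/\ Pint p,
      Pint (p + h *: v) & k * `|h| < `|f (p + h *: v) - f p|]) _ _ => //.
    near=> a; split; near: a.
    - exact: near_Pint.
    - apply: (near_comp (m := fun a : V3 => a + h *: v) (P := Pint) _ erefl).
        by cont.
      exact: near_Pint.
    - apply: (@near_comp _ _ (fun a : V3 => `|f (a + h *: v) - f a|) p _
        (fun x => k * `|h| < x) _ erefl); first by cont.
      exact: lt_nbhsr.
  have ip0 : Pint (p' + 0 *: v) by rewrite scale0r addr0.
  move: lt'; apply/negP; rewrite -leNgt.
  have [h0|h0] := leP 0 h.
    rewrite (ger0_norm h0).
    have := segment_off_planes (v := v) plane off h0 k0 cf.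
    rewrite scale0r addr0 subr0; apply => t /andP[/ltW t0 /ltW t1]; apply: df.
    by apply: Pint_segment ip0 iph' _; rewrite t0.
  rewrite distrC (ltr0_norm h0).
  have := segment_off_planes (v := v) plane off (ltW h0) k0 cf.
  rewrite scale0r addr0 sub0r; apply => t /andP[/ltW t0 /ltW t1]; apply: df.
  by apply: Pint_segment iph' ip0 _; rewrite t0.
(* The homothety of ratio 1 - s towards the centre multiplies the step by 1 - s;
   a strict failure at s = 0 would persist for small s > 0. *)
move=> p h Pp Pph; rewrite leNgt; apply/negP => lt.
pose g (s : R) : R := `|f (p + s *: (box_center - p) + ((1 - s) * h) *: v) - f (p + s *: (box_center - p))|
  - k * `|(1 - s) * h|.
have cg : {for 0, continuous g} by rewrite /g; cont.
have : \forall s \near (0 : R)^'+, 0 < g s.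
  apply: (@near_at_right _ (fun s => 0 < g s)).
  apply: (@near_comp _ _ g (0 : R) _ (fun x : R => 0 < x) cg erefl).
  by apply: lt_nbhsr; rewrite /g !scale0r !addr0 subr0 mul1r; rewrite subr_gt0.
move=> ng; near (0 : R)^'+ => u.
have u01 : 0 < u < 1 by apply/andP; split; near: u; [exact: nbhs_right_gt|exact: nbhs_right_lt].
have : 0 < g u by near: u.
rewrite /g subr_gt0; apply/negP; rewrite -leNgt; apply: stepB.
  exact: Pint_shrink.
rewrite (_ : _ + _ = (p + h *: v) + u *: (box_center - (p + h *: v))).
  exact: Pint_shrink.
by rewrite mulrBl mul1r scalerBl opprD (addrA box_center) (scalerBr u (box_center - p)) scalerA addrACA.
Unshelve. all: by end_near. Qed.

End Box.

(** * Integrals along a moving segment *)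

Section AlongLines.
Context {R : realType} {V : normedModType R}.
Implicit Types (F : V -> R) (p d e : V).

Lemma cont_along F p d : continuous F -> continuous (fun r : R => F (p - r *: d)).
Proof. by move=> cF; cont. Qed.

Lemma norm_prim_increment (f : R -> R) (M x y : R) : continuous f ->
  0 <= x -> 0 <= y -> (forall r, `|f r| <= M) ->
  `|prim f y - prim f x| <= M * `|y - x|.
Proof.
move=> cf x0 y0 fM.
wlog xy : x y x0 y0 / x <= y.
  by move=> H; case: (leP x y) => [|/ltW]; [exact: H|rewrite distrC (distrC y); exact: H].
rewrite (ger0_norm (x := y - x)) ?subr_ge0//.
rewrite -[X in `|X|]subr0 -[X in _ - X](mulr0 (y - x)).
by apply: prim_increment => // r _; rewrite subr0.
Qed.

Lemma not_near_seq (U : normedModType R) (z : U) (P : set U) :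
  ~ (\near z, P z) -> exists2 u : nat -> U, u @ \oo --> z & forall n, ~ P (u n).
Proof.
move=> nP.
have H n : exists a, ball z (n.+1%:R^-1 : R) a /\ ~ P a.
  apply: contrapT => na; apply: nP; apply/nbhs_ballP.
  exists n.+1%:R^-1 => /=; first by rewrite invr_gt0.
  by move=> a za; apply: contrapT => Pa; apply: na; exists a.
have [u Hu] := choice H.
exists u; last by move=> n; have [] := Hu n.
apply/cvgrPdist_lt => e e0; near=> n.
have [] := Hu n; rewrite -ball_normE /= => /lt_trans + _; apply.
by near: n; exact: near_infty_natSinv_lt (PosNum e0).
Unshelve. all: by end_near. Qed.

(** The defect of the integral is at most the integral of the defect. If this
    failed, it would fail along some sequence of pairs tending to (p, 0), for which
    the normalised deviations of the integrands are bounded by 2 K and have upper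
    limit at most w off A, against [prim_limsup]. *)
Lemma slope_defect_prim F d e p (L K w : R) (A : set R) :
  continuous F -> lip_along F e K -> 0 <= w -> 0 <= L ->
  countable A ->
  (forall r, 0 <= r <= L -> ~ A r -> defect F (p - r *: d) e w) ->
  slope_defect (fun x => prim (fun r => incr F e (x.1 - r *: d, x.2)) L) p (w * L).
Proof.
move=> cF lF w0 L0 cA dF eta eta0; apply: contrapT => /not_near_seq[u cu nu].
pose a n : V * R := (u n).1; pose b n : V * R := (u n).2.
pose D n r := dev (incr F e) ((a n).1 - r *: d, (a n).2) ((b n).1 - r *: d, (b n).2).
pose m n : R := `|(a n).2 * (b n).2|.
(* When m n = 0, D n vanishes by DK, and so does the quotient since 1 / 0 = 0. *)
pose g n r : R := `|D n r| / m n.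
have K0 : 0 <= K by have := lF 0 1; rewrite normr1 mulr1; exact: le_trans.
have mge n : 0 <= m n by exact: normr_ge0.
have cD n : continuous (D n).
  by rewrite /D /dev /incr /=; cont.
have DK n r : `|D n r| <= 2 * K * m n.
  rewrite /D /dev /m (le_trans (ler_normB _ _))// !normrM.
  have H1 := ler_wpM2l (normr_ge0 (b n).2) (lF ((a n).1 - r *: d) (a n).2).
  have H2 := ler_wpM2l (normr_ge0 (a n).2) (lF ((b n).1 - r *: d) (b n).2).
  rewrite (le_trans (lerD H1 H2))//; lra.
have gE n r : `|D n r| = g n r * m n.
  rewrite /g; have [m0|m0] := eqVneq (m n) 0; last by rewrite divfK.
  by rewrite m0 mulr0; apply/eqP; rewrite eq_le normr_ge0 andbT;
     rewrite (le_trans (DK n r))// m0 mulr0.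
have cg n : continuous (g n) by rewrite /g; cont; exact: cD.
have := @prim_limsup R g (2 * K) w L (A) cg L0 w0 _ cA _ eta eta0.
case=> [n r _|r e' r0L nA e'0|N _ HN].
- apply/andP; split; first by rewrite /g divr_ge0.
  rewrite /g; have [->|m0] := eqVneq (m n) 0; first by rewrite invr0 mulr0 mulr_ge0.
  by rewrite ler_pdivrMr ?DK// lt_neqAle eq_sym m0 normr_ge0.
- have := dF r r0L nA e' e'0 => dFr.
  have : \forall z \near ((p, 0 : R), (p, 0 : R)),
      `|dev (incr F e) (z.1.1 - r *: d, z.1.2) (z.2.1 - r *: d, z.2.2)| <=
         (w + e') * `|z.1.2 * z.2.2|.
    apply: (near_comp (m := fun z : (V * R) * (V * R) =>
      ((z.1.1 - r *: d, z.1.2), (z.2.1 - r *: d, z.2.2))) _ _ dFr) => //.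
    by cont.
  move=> /cu H; near=> n.
  have Hn : `|D n r| <= (w + e') * m n by near: n.
  rewrite /g; have [->|m0] := eqVneq (m n) 0.
    by rewrite invr0 mulr0 addr_ge0// ltW.
  by rewrite ler_pdivrMr// lt_neqAle eq_sym m0 normr_ge0.
- apply: (nu N); have := HN N (leqnn _) => /= HN'.
  have cI (x : V * R) : continuous (fun r : R => incr F e (x.1 - r *: d, x.2)).
    by rewrite /incr /=; cont.
  have ckI (l : R) (x : V * R) :
      continuous (fun r : R => l * incr F e (x.1 - r *: d, x.2)).
    by rewrite /incr /=; cont.
  have -> : dev (fun x => prim (fun r => incr F e (x.1 - r *: d, x.2)) L) (u N).1 (u N).2
      = prim (D N) L.
    by rewrite /dev -!primZ// -primB//; exact: ckI.
  rewrite (le_trans (norm_prim _ (cD N)))//.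
  have -> : (fun r => `|D N r|) = (fun r => m N * g N r).
    by apply/funext => r; rewrite gE mulrC.
  by rewrite primZ// mulrC ler_wpM2r.
Unshelve. all: by end_near. Qed.

(** The variable end point contributes nothing to the defect, because its position
    L is affine along e near p and the integrand is continuous; only the variation
    of the integrand does. *)
Lemma defect_prim F d e p (L : V -> R) (K w k : R) (A : set R) :
  continuous F -> lip_along F e K ->
  0 <= w -> 0 < L p -> {for p, continuous L} ->
  (\forall z \near (p, 0 : R), L (z.1 + z.2 *: e) = L z.1 + z.2 * k) ->
  countable A ->
  (forall r, 0 <= r <= L p -> ~ A r -> defect F (p - r *: d) e w) ->
  defect (fun q => prim (fun r => F (q - r *: d)) (L q)) p e (w * L p).
Proof.
move=> cF lF w0 L0 cL LE cA dF.
have cf q : continuous (fun r : R => F (q - r *: d)) by exact: cont_along.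
have nL : \forall z \near (p, 0 : R), 0 < L z.1 /\ 0 < L (z.1 + z.2 *: e).
  have npos : \near p, 0 < L p.
    by apply: (@near_comp _ _ L p _ (fun x : R => 0 < x) cL erefl); exact: lt_nbhsr.
  near=> z; split; near: z.
    by apply: (near_comp (m := fst)) npos => //; exact: cvg_fst.
  apply: (@near_comp _ _ (fun z : V * R => z.1 + z.2 *: e) _ _ (fun q => 0 < L q)) npos.
    by cont.
  by rewrite /= scale0r addr0.
(* The increment is G1, from the motion of the end point, plus J x (L p), the
   variation of the integrand over a fixed range, plus G2, its variation over
   the small range between L p and L x.1. G1 is strictly differentiable, and G2
   is a product of two small factors. *)
pose G1 (x : V * R) := prim (fun r => F (x.1 + x.2 *: e - r *: d)) (L (x.1 + x.2 *: e))
   - prim (fun r => F (x.1 + x.2 *: e - r *: d)) (L x.1).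
pose J (x : V * R) l := prim (fun r => incr F e (x.1 - r *: d, x.2)) l.
pose G2 (x : V * R) := J x (L x.1) - J x (L p).
have cJ (x : V * R) : continuous (fun r : R => incr F e (x.1 - r *: d, x.2)).
  by rewrite /incr /=; cont.
have D1 : slope_defect G1 p 0.
  apply: (@slope_defect0 _ _ _ _ (k * F (p - L p *: d))) => eta eta0.
  pose eta' := eta / (`|k| + 1).
  have k1 : 0 < `|k| + 1 by rewrite ltr_wpDl.
  have eta'0 : 0 < eta' by rewrite divr_gt0.
  have : \forall z \near (p, L p), `|F (z.1 - z.2 *: d) - F (p - L p *: d)| <= eta'.
    have : {for (p, L p), continuous (fun z : V * R => F (z.1 - z.2 *: d))} by cont.
    move=> /cvgrPdist_le /(_ _ eta'0) H; near=> z; rewrite distrC; near: z; exact: H.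
  move=> [[U W]/= [nU nW] UW].
  have [del /= del0 delW] := (nbhs_ballP _ _).1 nW.
  near=> x.
  have Ux : U (x.1 + x.2 *: e).
    near: x; apply: (@near_comp _ _ (fun z : V * R => z.1 + z.2 *: e) _ _ U) nU.
      by cont.
    by rewrite /= scale0r addr0.
  have B1 : `|L p - L x.1| < del.
    near: x; apply: (@near_comp _ _ (fun x : V * R => `|L p - L x.1|) _ 0 (fun y => y < del)).
    - apply: (@cont_norm _ _ _ (fun x : V * R => L p - L x.1)).
      apply: (@cont_add _ _ _ (fun=> L p) (fun x : V * R => - L x.1)).
        exact: cont_cst.
      apply: (@cont_opp _ _ _ (fun x : V * R => L x.1)).
      by apply: (@cont_comp _ _ _ (fun x : V * R => x.1) L) => //; exact: cvg_fst.
    - by rewrite /= subrr normr0.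
    - exact: lt_nbhsl.
  have B2 : `|L p - L (x.1 + x.2 *: e)| < del.
    near: x; apply: (@near_comp _ _ (fun x : V * R => `|L p - L (x.1 + x.2 *: e)|) _ 0 (fun y => y < del)).
    - apply: (@cont_norm _ _ _ (fun x : V * R => L p - L (x.1 + x.2 *: e))).
      apply: (@cont_add _ _ _ (fun=> L p) (fun x : V * R => - L (x.1 + x.2 *: e))).
        exact: cont_cst.
      apply: (@cont_opp _ _ _ (fun x : V * R => L (x.1 + x.2 *: e))).
      apply: (@cont_comp _ _ _ (fun x : V * R => x.1 + x.2 *: e) L).
        by rewrite scale0r addr0.
      by cont.
    - by rewrite /= scale0r addr0 subrr normr0.
    - exact: lt_nbhsl.
  have [pos1 pos2] : 0 < L x.1 /\ 0 < L (x.1 + x.2 *: e) by near: x.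
  have Ex : L (x.1 + x.2 *: e) = L x.1 + x.2 * k by near: x.
  set q := x.1 + x.2 *: e in Ux B2 pos2 Ex *.
  have between r : (L x.1 <= r <= L q) || (L q <= r <= L x.1) ->
      `|F (q - r *: d) - F (p - L p *: d)| <= eta'.
    move=> Hr; apply: (UW (q, r)); split => //=; apply: delW.
    rewrite -ball_normE /=; move: B1 B2; rewrite !ltr_norml.
    by case/orP: Hr => /andP[? ?] /andP[? ?] /andP[? ?]; apply/andP; split; lra.
  have bnd : `|G1 x - (L q - L x.1) * F (p - L p *: d)| <= eta' * `|L q - L x.1|.
    rewrite /G1 -/q; have [le|/ltW le] := leP (L x.1) (L q).
      rewrite [X in _ <= _ * X]ger0_norm ?subr_ge0//; apply: prim_increment => //.
        exact: ltW.
      by move=> r Hr; apply: between; rewrite Hr.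
    rewrite -normrN [X in `|X|](_ : _ = (prim (fun r => F (q - r *: d)) (L x.1)
      - prim (fun r => F (q - r *: d)) (L q)) - (L x.1 - L q) * F (p - L p *: d)); last by ring.
    rewrite [X in _ <= _ * X]distrC [X in _ <= _ * X]ger0_norm ?subr_ge0//.
    apply: prim_increment => //; first exact: ltW.
    by move=> r Hr; apply: between; rewrite Hr orbT.
  have Eq : L q - L x.1 = x.2 * k by rewrite Ex addrAC subrr add0r.
  move: bnd; rewrite Eq normrM mulrA => bnd.
  rewrite (le_trans bnd)// mulrCA mulrC ler_wpM2r//.
  rewrite /eta' mulrAC ler_pdivrMr// ler_wpM2l ?(ltW eta0)//.
  by rewrite lerDl.
have D2 : slope_defect G2 p 0.
  apply: (@slope_defect0 _ _ _ _ 0) => eta eta0.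
  have K0 : 0 <= K by have := lF 0 1; rewrite normr1 mulr1; exact: le_trans.
  have K1 : 0 < K + 1 by rewrite ltr_wpDl.
  near=> x.
  have [pos1 _] : 0 < L x.1 /\ 0 < L (x.1 + x.2 *: e) by near: x.
  rewrite mulr0 subr0 /G2 /J.
  apply: le_trans (norm_prim_increment (M := K * `|x.2|) _ _ _ _) _ => //.
  - exact: ltW.
  - exact: ltW.
  - by move=> r; exact: lF.
  rewrite mulrAC ler_wpM2r//.
  have B : `|L x.1 - L p| <= eta / (K + 1).
    near: x.
    have H : \forall a \near p, `|L a - L p| <= eta / (K + 1).
      have e1 : 0 < eta / (K + 1) by rewrite divr_gt0.
      move/cvgrPdist_le : (cL) => /(_ _ e1) H; near=> x.
      rewrite distrC; near: x; exact: H.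
    by apply: (near_comp (m := fst)) H => //; exact: cvg_fst.
  rewrite (le_trans (ler_wpM2l K0 B))// mulrCA ler_piMr ?(ltW eta0)//.
  by rewrite ler_pdivrMr// mul1r lerDl.
have D3 := slope_defect_prim cF lF w0 (ltW L0) cA dF.
have := slope_defectD (slope_defectD D1 D2) D3.
rewrite !add0r; apply: slope_defect_near; near=> x.
rewrite /incr /G1 /G2 /J /incr /=.
rewrite [prim _ (L x.1) - _](_ : _ = prim (fun r => F (x.1 + x.2 *: e - r *: d)) (L x.1)
  - prim (fun r => F (x.1 - r *: d)) (L x.1) - prim (fun r => incr F e (x.1 - r *: d, x.2)) (L p)).
  by rewrite /incr /=; ring.
congr (_ - _); rewrite -primB//; congr prim; apply/funext => r.
by rewrite addrAC.
Unshelve. all: by end_near. Qed.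

End AlongLines.

(** * Characteristics *)

Lemma ord4_ind (P : 'I_4 -> Prop) : P i1 -> P i2 -> P i3 -> P i4 -> forall i, P i.
Proof.
move=> P1 P2 P3 P4 [[|[|[|[|//]]]] Hi].
- by rewrite (_ : Ordinal Hi = i1)//; exact: val_inj.
- by rewrite (_ : Ordinal Hi = i2)//; exact: val_inj.
- by rewrite (_ : Ordinal Hi = i3)//; exact: val_inj.
- by rewrite (_ : Ordinal Hi = i4)//; exact: val_inj.
Qed.

Section Characteristics.
Context {R : realType}.
Local Notation V3 := (R * R * R)%type.
Variables (c a1 b1 a2 b2 tau tau' : R).
Hypotheses (c0 : 0 < c) (ab1 : a1 < b1) (ab2 : a2 < b2) (tt : tau < tau').
Hypothesis T1 : tau' - tau <= 1.
Local Notation P := (Pdom a1 b1 a2 b2 tau tau').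
Local Notation Pint := (Pint a1 b1 a2 b2 tau tau').
Implicit Types (p v : V3) (h r : R) (i j : 'I_4).

(** Families indexed by the four velocities. *)
Definition sel {T : Type} (x1 x2 x3 x4 : T) i : T :=
  match val i with 0%N => x1 | 1%N => x2 | 2%N => x3 | _ => x4 end.

(** Direction of the i-th characteristics, normalised so that the parameter along
    them is elapsed time. *)
Definition dir : 'I_4 -> V3 := sel (1, c, 0) (1, 0, c) (1, 0, - c) (1, - c, 0).

(** Time since the i-th characteristic through p met the wall it comes from, when
    it is prolonged to times before tau. *)
Definition ell i p : R := sel (xc p - a1) (yc p - a2) (b2 - yc p) (b1 - xc p) i / c.

Definition ell_lin i v : R := sel (xc v) (yc v) (- yc v) (- xc v) i / c.

(** Time since the i-th characteristic through p entered the box, at t = tau or at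
    the wall. *)
Definition len i p : R := Num.min (tc p - tau) (ell i p).

(** The points whose i-th characteristic enters through the edge where t = tau
    meets the wall. The solution may fail to be differentiable there. *)
Definition kink i : set V3 := [set p | tc p - tau = ell i p].

Lemma ell_line i p v h : ell i (p + h *: v) = ell i p + h * ell_lin i v.
Proof.
rewrite /ell /ell_lin mulrA -mulrDl !line_coord; congr (_ / c); move: i.
by apply: ord4_ind; rewrite /sel /=; ring.
Qed.

Lemma ell_dir i : ell_lin i (dir i) = 1.
Proof.
rewrite /ell_lin -(divff (lt0r_neq0 c0)); congr (_ / c); move: i.
by apply: ord4_ind; rewrite /sel /dir /= /xc /yc /= ?opprK.
Qed.

Lemma tc_dir i : tc (dir i) = 1.
Proof. by move: i; apply: ord4_ind. Qed.

(** Along a characteristic of another index, the time since the wall j grows at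
    speed 0 or -1 instead of 1: characteristics of different indices are transverse
    to each other's kink planes. *)
Lemma ell_dir_neq i j : j != i -> 1 - ell_lin j (dir i) != 0.
Proof.
have c1 := divff (lt0r_neq0 c0).
by move: i j; apply: ord4_ind; apply: ord4_ind => // _;
  rewrite /ell_lin /dir /sel /xc /yc /= ?oppr0 ?mul0r ?subr0 ?oner_neq0//
    mulNr ?c1 opprK; apply: lt0r_neq0; lra.
Qed.

Lemma ell_lin_unit i e : e \in [:: et; ex; ey] -> `|ell_lin i e| <= c^-1.
Proof.
have ci : `|c^-1| <= c^-1 by rewrite ger0_norm// invr_ge0 ltW.
move=> He; rewrite /ell_lin normrM -[leRHS]mul1r ler_pM//; move: i.
by move: He; rewrite !inE => /or3P[] /eqP ->; apply: ord4_ind;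
  rewrite /sel /et /ex /ey /xc /yc /= ?oppr0 ?normrN ?normr0 ?normr1.
Qed.

Lemma tc_unit e : e \in [:: et; ex; ey] -> `|tc e : R| <= 1.
Proof.
by rewrite !inE => /or3P[] /eqP ->; rewrite /tc /= ?normr0 ?normr1.
Qed.

Lemma ell_ge0 i p : P p -> 0 <= ell i p.
Proof.
move=> /PdomE[_ /andP[? ?] /andP[? ?]]; rewrite /ell divr_ge0 ?(ltW c0)//.
by move: i; apply: ord4_ind; rewrite /sel /= subr_ge0.
Qed.

Lemma ell_gt0 i p : Pint p -> 0 < ell i p.
Proof.
move=> [_ /andP[? ?] /andP[? ?]]; rewrite /ell divr_gt0//.
by move: i; apply: ord4_ind; rewrite /sel /= subr_gt0.
Qed.

Lemma len_ge0 i p : P p -> 0 <= len i p.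
Proof.
move=> Pp; rewrite /len le_min ell_ge0// andbT subr_ge0.
by have /PdomE[/andP[]] := Pp.
Qed.

Lemma len_le1 i p : P p -> len i p <= 1.
Proof.
move=> /PdomE[/andP[_ ?] _ _]; by rewrite /len ge_min (le_trans _ T1)// lerD2r.
Qed.

Lemma len_gt0 i p : Pint p -> 0 < len i p.
Proof.
by move=> ip; rewrite /len lt_min ell_gt0// andbT subr_gt0; have [/andP[]] := ip.
Qed.

Lemma ell_cont i : continuous (ell i).
Proof.
by move: i; apply: ord4_ind; rewrite /ell /sel /=; cont.
Qed.

Lemma len_cont i : continuous (len i).
Proof.
move=> z; apply: (@cont_min _ _ (fun p => tc p - tau) (ell i)); last exact: ell_cont.
by cont.
Qed.

Lemma kink_plane i : is_plane (kink i).
Proof.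
have nc : c != 0 by exact: lt0r_neq0.
have mulc (x y : R) : (x = y / c) = (c * x = y).
  apply/propext; split=> [->|<-]; first by rewrite mulrC divfK.
  by rewrite mulrAC divff// mul1r.
have nz (x y : R) : ((c, x, y) : V3) != 0.
  by apply/negP => /eqP/(congr1 tc); rewrite /tc /= => /eqP; rewrite (negbTE nc).
move: i; apply: ord4_ind.
- exists (c, -1, 0), (c * tau - a1); split=> //; apply/seteqP.
  by split=> p; rewrite /kink /ell /sel /= mulc /tc /xc /yc /=; lra.
- exists (c, 0, -1), (c * tau - a2); split=> //; apply/seteqP.
  by split=> p; rewrite /kink /ell /sel /= mulc /tc /xc /yc /=; lra.
- exists (c, 0, 1), (c * tau + b2); split=> //; apply/seteqP.
  by split=> p; rewrite /kink /ell /sel /= mulc /tc /xc /yc /=; lra.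
- exists (c, 1, 0), (c * tau + b1); split=> //; apply/seteqP.
  by split=> p; rewrite /kink /ell /sel /= mulc /tc /xc /yc /=; lra.
Qed.

Lemma subr_line p v r : p - r *: v = p + (- r) *: v.
Proof. by rewrite scaleNr. Qed.

Lemma Pdom_back i p r : P p -> 0 <= r <= len i p -> P (p - r *: dir i).
Proof.
move=> /PdomE[Ht Hx Hy] /andP[r0]; rewrite le_min => /andP[rt].
rewrite /ell ler_pdivlMr// mulrC subr_line => rl.
have cr : 0 <= c * r by rewrite mulr_ge0// ltW.
apply/PdomE; rewrite !line_coord tc_dir mulr1; split; first lra.
- by move: i rl; apply: ord4_ind; rewrite /sel /dir /xc /yc /= => rl;
    apply/andP; split; move: Hx; rewrite /xc; lra.
- by move: i rl; apply: ord4_ind; rewrite /sel /dir /xc /yc /= => rl;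
    apply/andP; split; move: Hy; rewrite /yc; lra.
Qed.

Lemma Pint_back i p r : Pint p -> 0 <= r < len i p -> Pint (p - r *: dir i).
Proof.
move=> [Ht Hx Hy] /andP[r0]; rewrite lt_min => /andP[rt].
rewrite /ell ltr_pdivlMr// mulrC subr_line => rl.
have cr : 0 <= c * r by rewrite mulr_ge0// ltW.
split; rewrite line_coord; rewrite ?tc_dir ?mulr1.
- lra.
- by move: i rl; apply: ord4_ind; rewrite /sel /dir /xc /yc /= => rl;
    apply/andP; split; move: Hx; rewrite /xc; lra.
- by move: i rl; apply: ord4_ind; rewrite /sel /dir /xc /yc /= => rl;
    apply/andP; split; move: Hy; rewrite /yc; lra.
Qed.

Lemma len_line i p r : len i (p + r *: dir i) = len i p + r.
Proof.
rewrite /len ell_line ell_dir line_coord tc_dir mulr1 addrAC.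
by rewrite /Num.min ltrD2r; case: ifP.
Qed.

Lemma len_lip i p h e : e \in [:: et; ex; ey] ->
  `|len i (p + h *: e) - len i p| <= (1 + c^-1) * `|h|.
Proof.
move=> He; rewrite /len ell_line line_coord.
have H1 : `|h * tc e| <= (1 + c^-1) * `|h|.
  rewrite normrM mulrC ler_wpM2r// (le_trans (tc_unit He))// lerDl.
  by rewrite invr_ge0 ltW.
have H2 : `|h * ell_lin i e| <= (1 + c^-1) * `|h|.
  rewrite normrM mulrC ler_wpM2r// (le_trans (ell_lin_unit i He))//.
  by rewrite lerDr.
move: H1 H2; rewrite !ler_norml => /andP[? ?] /andP[? ?].
by apply/andP; rewrite !minEle; (have [?|?] := leP (tc p - tau) (ell i p));
  (have [?|?] := leP (tc p + h * tc e - tau) (ell i p + h * ell_lin i e));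
  split; lra.
Qed.

(** Off the kink plane the minimum that defines len is locally one of its two
    affine branches. *)
Lemma len_affine i p e : ~ kink i p ->
  exists k, \forall z \near (p, 0 : R), len i (z.1 + z.2 *: e) = len i z.1 + z.2 * k.
Proof.
move=> nk; pose g p := ell i p - (tc p - tau).
have cg : continuous g.
  move=> q; apply: (@cont_add _ _ _ (ell i) (fun p => - (tc p - tau))); first exact: ell_cont.
  by cont.
have g0 : g p != 0 by apply/eqP => /eqP; rewrite subr_eq0 => /eqP gp; exact: nk.
have cline : {for (p, 0 : R), continuous (fun z : V3 * R => z.1 + z.2 *: e)} by cont.
have near2 (Q : set R) : (\forall x \near g p, Q x) ->
    \forall z \near (p, 0 : R), Q (g z.1) /\ Q (g (z.1 + z.2 *: e)).
  move=> nQ; have nq : \forall a \near p, Q (g a) by exact: (@near_comp _ _ g p _ Q (cg p) erefl).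
  near=> z; split; near: z.
    have cfst : {for (p, 0 : R), continuous (fun z : V3 * R => z.1)} by cont.
    exact: (@near_comp _ _ (fun z : V3 * R => z.1) (p, 0) p (fun a => Q (g a)) cfst erefl nq).
  apply: (@near_comp _ _ (fun z : V3 * R => z.1 + z.2 *: e) _ _ (fun a => Q (g a)) cline) nq.
  by rewrite /= scale0r addr0.
have [gp|gp|gp] := ltgtP (g p) 0; last by rewrite gp eqxx in g0.
  exists (ell_lin i e).
  have /near2 H : \forall x \near g p, x < 0 by exact: lt_nbhsl.
  near=> z; have [] : g z.1 < 0 /\ g (z.1 + z.2 *: e) < 0 by near: z.
  rewrite /g !subr_lt0 => ? ?; rewrite /len !min_r ?ltW//; exact: ell_line.
exists (tc e).
have /near2 H : \forall x \near g p, 0 < x by exact: lt_nbhsr.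
near=> z; have [] : 0 < g z.1 /\ 0 < g (z.1 + z.2 *: e) by near: z.
rewrite /g !subr_gt0 => ? ?; rewrite /len !min_l ?ltW// line_coord addrAC //.
Unshelve. all: by end_near. Qed.

Lemma kink_back i p r : kink i (p - r *: dir i) <-> kink i p.
Proof.
rewrite /kink /= subr_line line_coord ell_line ell_dir tc_dir.
by split; lra.
Qed.

(** The characteristic meets the kink plane of any other index transversally, hence
    at most once, and its own plane never. *)
Lemma kink_crossings i p : ~ kink i p ->
  exists2 A : set R, finite_set A & forall r, ~ A r -> forall j, ~ kink j (p - r *: dir i).
Proof.
move=> nk.
exists [set r | exists2 j, j != i & kink j (p - r *: dir i)].
  apply: (@sub_finite_set _ _ (range (fun j : 'I_4 =>
     (tc p - tau - ell j p) / (1 - ell_lin j (dir i))))); last exact: finite_image.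
  move=> r /= [j ji]; rewrite /kink /= subr_line line_coord ell_line tc_dir => E.
  exists j => //.
  have nz := ell_dir_neq ji.
  by apply: (mulIf nz); rewrite divfK//; lra.
move=> r nA j kj; have [ji|ji] := eqVneq j i.
  by apply: nk; apply/(kink_back i p r); rewrite -{1}ji.
by apply: nA; exists j.
Qed.

End Characteristics.

(** * Norms and transported data *)

(** A function continuous on A only becomes continuous everywhere once its argument
    is kept in A. *)
Lemma continuous_retract {T U W : topologicalType} (A : set U) (f : U -> W) (g : T -> U) :
  {within A, continuous f} -> continuous g -> (forall x, A (g x)) ->
  continuous (fun x => f (g x)).
Proof.
move=> /subspace_continuousP cf cg Ag x B /= nB.
have nfB : \forall y \near g x, A y -> B (f y) by have := cf _ (Ag x) B nB.
have H : nbhs x (fun y => A (g y) -> B (f (g y))) := cg x _ nfB.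
have : nbhs x (fun y => B (f (g y))) by apply: filterS H => y; apply.
by [].
Qed.

Lemma scale_realE {R : realType} (x y : R) : x *: y = x * y.
Proof. by []. Qed.

Section Norms.
Context {R : realType}.
Local Notation V3 := (R * R * R)%type.

Lemma norm_oo_leP {V : normedModType R} (A : set V) (f : V -> R) (k : R) :
  (norm_oo A f <= k%:E)%E <-> (forall p, A p -> `|f p| <= k).
Proof.
split=> [H p Ap|H].
  by rewrite -lee_fin; apply: le_trans H; apply: ereal_sup_ubound; exists p.
by apply: ge_ereal_sup => _ [p Ap <-]; rewrite lee_fin H.
Qed.

Lemma norm1_leP (A : set V3) (f : V3 -> R) (k : R) :
  (norm1 A f <= k%:E)%E <-> (forall p, A p -> `|f p| <= k) /\
   (forall e, e \in [:: et; ex; ey] -> forall p, A° p -> derivable f p e ->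
      `|'D_e f p| <= k).
Proof.
rewrite /norm1 !ge_max; split.
  move=> /and4P[/norm_oo_leP H /norm_oo_leP Ht /norm_oo_leP Hx /norm_oo_leP Hy].
  split=> // e; rewrite !inE => /or3P[] /eqP -> p Ap df.
  - exact: Ht.
  - exact: Hx.
  - exact: Hy.
move=> [H Hd]; apply/and4P; split; apply/norm_oo_leP => // p [Ap df].
- by apply: Hd => //; rewrite !inE eqxx.
- by apply: Hd => //; rewrite !inE eqxx orbT.
- by apply: Hd => //; rewrite !inE eqxx !orbT.
Qed.

Lemma vec2_decomp (z : R * R) : z = z.1 *: e1 + z.2 *: e2.
Proof.
case: z => x y; rewrite /e1 /e2 /=.
by congr (_, _); rewrite /= ?scale_realE; ring.
Qed.

Lemma C1_sderiv_plane (g : R * R -> R) (z w : R * R) :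
  (\forall a \near z, C1_at [:: e1; e2] g a) ->
  sderiv g z w (w.1 * 'D_e1 g z + w.2 * 'D_e2 g z).
Proof.
move=> H; have He1 : e1 \in [:: e1; e2 : R * R] by rewrite inE eqxx.
have He2 : e2 \in [:: e1; e2 : R * R] by rewrite !inE eqxx orbT.
rewrite [X in sderiv _ _ X](vec2_decomp w).
apply: sderiv_lin; apply: C1_sderiv.
- by near=> a; have [] : derivable g a e1 /\ _ := (near H a _) _ He1.
- by have /(_ _ He1)[] := nbhs_singleton H.
- by near=> a; have [] : derivable g a e2 /\ _ := (near H a _) _ He2.
- by have /(_ _ He2)[] := nbhs_singleton H.
Unshelve. all: by end_near. Qed.

Lemma rect_interior (a b a' b' : R) z : a < z.1 < b -> a' < z.2 < b' ->
  (rect a b a' b')° z.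
Proof.
move=> /andP[? ?] /andP[? ?].
have lt2 (g : R * R -> R) (x y : R) : continuous g -> x < g z -> g z < y ->
    \forall w \near z, x < g w < y.
  move=> cg xg gy; apply: (near_comp (cg z) erefl (P := fun u => x < u < y)).
  near=> u; apply/andP; split; near: u; [exact: lt_nbhsr|exact: lt_nbhsl].
rewrite /interior /=; near=> w; split => /=; rewrite in_itv/=.
  have : a < w.1 < b by near: w; apply: (lt2 (fun z : R * R => z.1)) => //; cont.
  by move=> /andP[/ltW -> /ltW ->].
have : a' < w.2 < b' by near: w; apply: (lt2 (fun z : R * R => z.2)) => //; cont.
by move=> /andP[/ltW -> /ltW ->].
Unshelve. all: by end_near. Qed.

End Norms.

Section Data.
Context {R : realType}.
Local Notation V3 := (R * R * R)%type.
Variables (c a1 b1 a2 b2 tau tau' : R).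
Hypotheses (c0 : 0 < c) (ab1 : a1 < b1) (ab2 : a2 < b2) (tt : tau < tau').
Local Notation P := (Pdom a1 b1 a2 b2 tau tau').
Local Notation Pint := (Pint a1 b1 a2 b2 tau tau').
Local Notation ell := (ell c a1 b1 a2 b2).
Local Notation len := (len c a1 b1 a2 b2 tau).
Local Notation kink := (kink c a1 b1 a2 b2 tau).
Local Notation Om := (Omega a1 b1 a2 b2).
Implicit Types (p v : V3) (h r : R) (i j : 'I_4).

(** Where the i-th characteristic through p meets t = tau, in coordinates (x, y). *)
Definition foot_init i p : R * R := sel
  (xc p - c * (tc p - tau), yc p) (xc p, yc p - c * (tc p - tau))
  (xc p, yc p + c * (tc p - tau)) (xc p + c * (tc p - tau), yc p) i.

Definition foot_init_lin i v : R * R := sel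
  (xc v - c * tc v, yc v) (xc v, yc v - c * tc v)
  (xc v, yc v + c * tc v) (xc v + c * tc v, yc v) i.

Definition cross i p : R := sel (yc p) (xc p) (xc p) (yc p) i.

(** Where the i-th characteristic through p meets the wall, in the coordinates of
    the boundary datum: time first. *)
Definition foot_wall i p : R * R := (tc p - ell i p, cross i p).

Definition foot_wall_lin i v : R * R := (tc v - ell_lin c i v, cross i v).

Definition lo i : R := sel a2 a1 a1 a2 i.
Definition hi i : R := sel b2 b1 b1 b2 i.
Definition bdom i : set (R * R) := rect tau tau' (lo i) (hi i).

(** The edge of the wall of index i at time tau, as a curve in the (x, y) plane. *)
Definition inlet i (y : R) : R * R := sel (a1, y) (y, a2) (y, b2) (b1, y) i.

Lemma foot_init_line i p v h : foot_init i (p + h *: v) = foot_init i p + h *: foot_init_lin i v.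
Proof.
move: i; apply: ord4_ind; rewrite /foot_init /foot_init_lin /sel /= /tc /xc /yc /=;
  by congr (_, _); rewrite /= ?scale_realE; ring.
Qed.

Lemma foot_wall_line i p v h : foot_wall i (p + h *: v) = foot_wall i p + h *: foot_wall_lin i v.
Proof.
rewrite /foot_wall /foot_wall_lin ell_line line_coord.
congr (_, _); rewrite /= ?scale_realE; first by ring.
by move: i; apply: ord4_ind; rewrite /cross /sel /=.
Qed.

Lemma foot_init_dir i p h : foot_init i (p + h *: dir c i) = foot_init i p.
Proof.
rewrite foot_init_line (_ : foot_init_lin i (dir c i) = 0) ?scaler0 ?addr0//.
by move: i; apply: ord4_ind; rewrite /foot_init_lin /dir /sel /= /tc /xc /yc /=;
  congr (_, _); ring.
Qed.

Lemma foot_wall_dir i p h : foot_wall i (p + h *: dir c i) = foot_wall i p.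
Proof.
rewrite foot_wall_line (_ : foot_wall_lin i (dir c i) = 0) ?scaler0 ?addr0//.
rewrite /foot_wall_lin ell_dir// tc_dir subrr; congr (_, _).
by move: i; apply: ord4_ind.
Qed.

Lemma foot_init_cont i : continuous (foot_init i).
Proof. by move: i; apply: ord4_ind; rewrite /foot_init /sel /=; cont. Qed.

Lemma cross_cont i : continuous (cross i).
Proof. by move: i; apply: ord4_ind; rewrite /cross /sel /=; cont. Qed.

Lemma foot_wall_cont i : continuous (foot_wall i).
Proof.
move=> z; apply: (@cont_pair _ _ _ (fun p => tc p - ell i p) (cross i)).
  apply: (@cont_add _ _ _ (fun p => tc p) (fun p => - ell i p)); first by cont.
  by apply: (@cont_opp _ _ _ (ell i)); exact: ell_cont.
exact: cross_cont.
Qed.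

Lemma lohi i : lo i <= hi i.
Proof. by move: i; apply: ord4_ind; rewrite /lo /hi /sel /= ltW. Qed.

Definition clamp2 (a b a' b' : R) (z : R * R) : R * R :=
  (clampr a b z.1, clampr a' b' z.2).

Lemma clamp2_in a b a' b' z : a <= b -> a' <= b' -> rect a b a' b' (clamp2 a b a' b' z).
Proof. by move=> ab ab'; split; rewrite /= in_itv/= clampr_in. Qed.

Lemma clamp2_cont a b a' b' : continuous (clamp2 a b a' b').
Proof. by rewrite /clamp2 /clampr; cont. Qed.

Lemma clamp2_id a b a' b' z : rect a b a' b' z -> clamp2 a b a' b' z = z.
Proof.
by case: z => u v [/=]; rewrite !in_itv/= => uv uv'; rewrite /clamp2 !clampr_id.
Qed.

Lemma clampr_lo (a b x : R) : a <= b -> x <= a -> clampr a b x = a.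
Proof. by move=> ab xa; rewrite /clampr min_l ?max_l// (le_trans xa). Qed.

Lemma clampr_hi (a b x : R) : a <= b -> b <= x -> clampr a b x = b.
Proof. by move=> ab bx; rewrite /clampr min_r// max_r. Qed.

Lemma cross_in i p : P p -> lo i <= cross i p <= hi i.
Proof. by move=> /PdomE[Ht Hx Hy]; move: i; apply: ord4_ind. Qed.

Lemma cross_int i p : Pint p -> lo i < cross i p < hi i.
Proof. by move=> [Ht Hx Hy]; move: i; apply: ord4_ind. Qed.

Lemma Omega_foot_init i p : P p -> tc p - tau <= ell i p -> Om (foot_init i p).
Proof.
move=> /PdomE[/andP[Ht _] Hx Hy]; rewrite /ell ler_pdivlMr// mulrC => H.
have ct : 0 <= c * (tc p - tau) by rewrite mulr_ge0 ?(ltW c0)// subr_ge0.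
by move: i H; apply: ord4_ind; rewrite /sel /foot_init /= => H; split; rewrite /= in_itv/=;
  rewrite ?Hx ?Hy//; apply/andP; split; move: Hx Hy => /andP[? ?] /andP[? ?]; lra.
Qed.

Lemma Omega_foot_init_int i p : Pint p -> tc p - tau < ell i p -> Om° (foot_init i p).
Proof.
move=> [/andP[Ht _] Hx Hy]; rewrite /ell ltr_pdivlMr// mulrC => H.
have ct : 0 <= c * (tc p - tau) by rewrite mulr_ge0 ?(ltW c0)// subr_ge0 ltW.
by move: i H; apply: ord4_ind; rewrite /sel /foot_init /= => H; apply: rect_interior => //=;
  apply/andP; split; move: Hx Hy => /andP[? ?] /andP[? ?]; lra.
Qed.

(** When the characteristic comes from the wall, its foot on t = tau lies behind
    the wall, and clamping brings it back to the edge. *)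
Lemma foot_init_inlet i p : P p -> ell i p <= tc p - tau ->
  clamp2 a1 b1 a2 b2 (foot_init i p) = inlet i (cross i p).
Proof.
move=> /PdomE[/andP[Ht _] Hx Hy]; rewrite /ell ler_pdivrMr// mulrC => H.
have l1 := ltW ab1; have l2 := ltW ab2.
move: i H; apply: ord4_ind; rewrite /sel /foot_init /inlet /cross /clamp2 /= => H;
  rewrite ?(clampr_id Hx) ?(clampr_id Hy).
- by rewrite clampr_lo//; lra.
- by rewrite clampr_lo//; lra.
- by rewrite clampr_hi//; lra.
- by rewrite clampr_hi//; lra.
Qed.

Lemma bdom_foot_wall i p : P p -> ell i p <= tc p - tau -> bdom i (foot_wall i p).
Proof.
move=> Pp le; split; rewrite /= in_itv/=; last exact: cross_in.
have := ell_ge0 c0 i Pp; have /PdomE[/andP[? ?] _ _] := Pp.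
by move=> ?; apply/andP; split; lra.
Qed.

Lemma bdom_foot_wall_int i p : Pint p -> ell i p < tc p - tau -> (bdom i)° (foot_wall i p).
Proof.
move=> ip le; apply: rect_interior; rewrite /=; last exact: cross_int.
have := ell_gt0 c0 i ip; have [/andP[? ?] _ _] := ip.
by move=> ?; apply/andP; split; lra.
Qed.

Variables (Ntau bdat : 'I_4 -> R * R -> R).

(** The value transported along the i-th characteristic. On the initial
    side of the kink plane the last two terms cancel; on the wall side the first
    and the last one do, by compatibility. A single expression makes continuity across the kink
    plane, and constancy along characteristics, immediate. *)
Definition datum i p : R :=
  Ntau i (clamp2 a1 b1 a2 b2 (foot_init i p))
  + (bdat i (clamp2 tau tau' (lo i) (hi i) (foot_wall i p))
     - bdat i (tau, clampr (lo i) (hi i) (cross i p))).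

Hypothesis gtau : forall i, good_datum Om (Ntau i).
Hypothesis gb : forall i, good_datum (bdom i) (bdat i).
Hypothesis comp : forall i y, lo i <= y <= hi i -> Ntau i (inlet i y) = bdat i (tau, y).

Lemma datum_cont i : continuous (datum i).
Proof.
have [_ c1 _ _ _] := gtau i; have [_ c2 _ _ _] := gb i.
have k1 : continuous (fun p => Ntau i (clamp2 a1 b1 a2 b2 (foot_init i p))).
  apply: (continuous_retract c1) => [|p]; last by apply: clamp2_in; exact: ltW.
  move=> p; apply: (@cont_comp _ _ _ (foot_init i) (clamp2 a1 b1 a2 b2)).
    exact: clamp2_cont.
  exact: foot_init_cont.
have k2 : continuous (fun p => bdat i (clamp2 tau tau' (lo i) (hi i) (foot_wall i p))).
  apply: (continuous_retract c2) => [|p].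
    move=> p; apply: (@cont_comp _ _ _ (foot_wall i) (clamp2 tau tau' (lo i) (hi i))).
      exact: clamp2_cont.
    exact: foot_wall_cont.
  by apply: clamp2_in; [exact: ltW|exact: lohi].
have k3 : continuous (fun p => bdat i (tau, clampr (lo i) (hi i) (cross i p))).
  apply: (continuous_retract c2) => [p|p].
    apply: (@cont_pair _ _ _ (fun=> tau) (fun p => clampr (lo i) (hi i) (cross i p))).
      exact: cont_cst.
    apply: (@cont_comp _ _ _ (cross i)); last exact: cross_cont.
    exact: clampr_cont.
  by split; rewrite /= in_itv/= ?lexx ?(ltW tt)// clampr_in// lohi.
move=> p; apply: (cont_add (k1 p)).
exact: (cont_add (k2 p) (cont_opp (k3 p))).
Qed.

Lemma datum_foot_init i p : P p -> tc p - tau <= ell i p -> datum i p = Ntau i (foot_init i p).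
Proof.
move=> Pp le; rewrite /datum clamp2_id; last exact: Omega_foot_init.
rewrite {1}/clamp2 /foot_wall /= clampr_lo ?subrr ?addr0//; first exact: ltW.
by rewrite lerBlDr -lerBlDl.
Qed.

Lemma datum_foot_wall i p : P p -> ell i p <= tc p - tau -> datum i p = bdat i (foot_wall i p).
Proof.
move=> Pp le; rewrite /datum foot_init_inlet// comp ?cross_in// clamp2_id; last exact: bdom_foot_wall.
by rewrite clampr_id ?cross_in// addrC subrK.
Qed.

Lemma datum_dir i p h : datum i (p + h *: dir c i) = datum i p.
Proof.
rewrite /datum foot_init_dir foot_wall_dir (_ : cross i (p + h *: dir c i) = cross i p)//.
by have := congr1 snd (foot_wall_dir i p h).
Qed.

Lemma datum_ge0 i p : P p -> 0 <= datum i p.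
Proof.
move=> Pp; have [pos _ _ _ _] := gtau i; have [posb _ _ _ _] := gb i.
have [le|/ltW le] := leP (tc p - tau) (ell i p).
  by rewrite datum_foot_init//; apply: pos; exact: Omega_foot_init.
by rewrite datum_foot_wall//; apply: posb; exact: bdom_foot_wall.
Qed.

Lemma near_side p (Q : V3 -> R) : continuous Q -> 0 < Q p -> \forall a \near p, 0 < Q a.
Proof.
move=> cQ Qp; apply: (@near_comp _ _ Q p _ (fun x : R => 0 < x) (cQ p) erefl).
exact: lt_nbhsr.
Qed.

Lemma side_cont i : continuous (fun p => ell i p - (tc p - tau)).
Proof.
move=> p; apply: (@cont_add _ _ _ (ell i) (fun p => - (tc p - tau))); first exact: ell_cont.
by cont.
Qed.

Lemma side_contN i : continuous (fun p => (tc p - tau) - ell i p).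
Proof.
move=> p; apply: (@cont_add _ _ _ (fun p => tc p - tau) (fun p => - ell i p)).
  by cont.
by apply: (@cont_opp _ _ _ (ell i)); exact: ell_cont.
Qed.

(** Off its kink plane the datum is locally a C1 function of an affine function of
    the point. The second clause identifies its derivative with that of one of the
    transported data, over whose norms q is a maximum. *)
Lemma datum_pieces i p e : Pint p -> ~ kink i p ->
  exists2 D, sderiv (datum i) p e D &
  ((P `&` (foot_init i) @^-1` Om)° p /\ is_derive p e (Ntau i \o foot_init i) D) \/
  ((P `&` (foot_wall i) @^-1` (bdom i))° p /\ is_derive p e (bdat i \o foot_wall i) D).
Proof.
move=> ip nk.
have [lt|lt|/esym eq] := ltgtP (tc p - tau) (ell i p); last by case: nk.
- have nside : \forall a \near p, Pint a /\ 0 < ell i a - (tc a - tau).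
    apply: filterI; first exact: near_Pint.
    have gt : 0 < ell i p - (tc p - tau) by rewrite subr_gt0.
    exact: (near_side (@side_cont i) gt).
  have S : exists D, sderiv (Ntau i \o foot_init i) p e D.
    have [_ _ _ C1 _] := gtau i.
    exists ((foot_init_lin i e).1 * 'D_e1 (Ntau i) (foot_init i p) + (foot_init_lin i e).2 * 'D_e2 (Ntau i) (foot_init i p)).
    apply: (sderiv_comp (w := foot_init_lin i e)).
    - exact: foot_init_cont.
    - by move=> a h; exact: foot_init_line.
    - apply: C1_sderiv_plane.
      have := Omega_foot_init_int ip lt.
      move=> /nbhs_interior; apply: filterS => a; exact: C1.
  have [D SD] := S; exists D; last first.
    left; split; last exact: sderiv_is_derive.
    apply: filterS nside => a [/Pint_Pdom Pa]; rewrite subr_gt0 => /ltW lea.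
    by split => //; exact: Omega_foot_init.
  apply: sderiv_near SD; apply: filterS nside => a [/Pint_Pdom Pa]; rewrite subr_gt0 => /ltW lea.
  by rewrite datum_foot_init.
- have nside : \forall a \near p, Pint a /\ 0 < (tc a - tau) - ell i a.
    apply: filterI; first exact: near_Pint.
    have gt : 0 < (tc p - tau) - ell i p by rewrite subr_gt0.
    exact: (near_side (@side_contN i) gt).
  have S : exists D, sderiv (bdat i \o foot_wall i) p e D.
    have [_ _ _ C1 _] := gb i.
    exists ((foot_wall_lin i e).1 * 'D_e1 (bdat i) (foot_wall i p) + (foot_wall_lin i e).2 * 'D_e2 (bdat i) (foot_wall i p)).
    apply: (sderiv_comp (w := foot_wall_lin i e)).
    - exact: foot_wall_cont.
    - by move=> a h; exact: foot_wall_line.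
    - apply: C1_sderiv_plane.
      have := bdom_foot_wall_int ip lt.
      move=> /nbhs_interior; apply: filterS => a; exact: C1.
  have [D SD] := S; exists D; last first.
    right; split; last exact: sderiv_is_derive.
    apply: filterS nside => a [/Pint_Pdom Pa]; rewrite subr_gt0 => /ltW lea.
    by split => //; exact: bdom_foot_wall.
  apply: sderiv_near SD; apply: filterS nside => a [/Pint_Pdom Pa]; rewrite subr_gt0 => /ltW lea.
  by rewrite datum_foot_wall.
Qed.

Variable q : R.
Hypothesis qtau : forall i, (norm1 (P `&` (foot_init i) @^-1` Om) (Ntau i \o foot_init i) <= q%:E)%E.
Hypothesis qb : forall i, (norm1 (P `&` (foot_wall i) @^-1` (bdom i)) (bdat i \o foot_wall i) <= q%:E)%E.

Lemma datum_bound i p : P p -> `|datum i p| <= q.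
Proof.
move=> Pp; have /norm1_leP[Q1 _] := qtau i; have /norm1_leP[Q2 _] := qb i.
have [le|/ltW le] := leP (tc p - tau) (ell i p).
  by rewrite datum_foot_init//; apply: Q1; split => //; exact: Omega_foot_init.
by rewrite datum_foot_wall//; apply: Q2; split => //; exact: bdom_foot_wall.
Qed.

Lemma q_ge0 : 0 <= q.
Proof.
have Pc : P (clamp a1 b1 a2 b2 tau tau' 0) by exact: clamp_in.
exact: le_trans (datum_bound i1 Pc).
Qed.

Lemma datum_sderiv i p e : Pint p -> ~ kink i p ->
  exists D, sderiv (datum i) p e D.
Proof. by move=> ip nk; have [D SD _] := datum_pieces e ip nk; exists D. Qed.

(** The derivative is bounded by q on both sides of the kink plane, and the datum
    is continuous across it. *)
Lemma datum_lip i p e h : e \in [:: et; ex; ey] -> P p -> P (p + h *: e) ->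
  `|datum i (p + h *: e) - datum i p| <= q * `|h|.
Proof.
move=> He; apply: (@lip_off_planes _ a1 b1 a2 b2 tau tau' _ _ _ [:: kink i]) => //.
- by move=> H; rewrite inE => /eqP ->; exact: kink_plane.
- exact: q_ge0.
- exact: datum_cont.
move=> {p h} p ip off; have nk : ~ kink i p by apply: off; rewrite mem_head.
have [D /sderiv_is_derive[dd ->] [[iA [df <-]]|[iA [df <-]]]] := datum_pieces e ip nk.
- have /norm1_leP[_ Q] := qtau i; split => //; exact: Q.
- have /norm1_leP[_ Q] := qb i; split => //; exact: Q.
Qed.

End Data.

(** * The integral equation *)

Section Halving.
Context {R : realType}.
Implicit Types (a b C : R).

Lemma le_geo a b C : (forall n, a <= b + C / 2 ^+ n) -> a <= b.
Proof.
move=> H; rewrite leNgt; apply/negP => ba.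
have d0 : 0 < a - b by rewrite subr_gt0.
have [n Hn] : exists n : nat, C / (a - b) < n%:R.
  exists (Num.bound `|C / (a - b)|); apply: le_lt_trans (ler_norm _) _.
  by apply: archi_boundP.
have n2 : n%:R <= 2 ^+ n :> R.
  by rewrite -natrX ler_nat ltnW// ltn_expl.
have := H n; apply/negP; rewrite -ltNge addrC -ltrBrDr.
by rewrite ltr_pdivrMr ?exprn_gt0// mulrC -ltr_pdivrMr// (lt_le_trans Hn).
Qed.

(** Defects, negative parts and differences of solutions are all shown to vanish by
    this induction, letting n grow. *)
Lemma halving (A : R -> Prop) C : 0 <= C -> A C ->
  (forall B, 0 <= B -> A B -> A (B / 2)) -> forall n, A (C / 2 ^+ n).
Proof.
move=> C0 AC step; elim=> [|n IH]; first by rewrite expr0 divr1.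
by rewrite exprSr invfM mulrA; apply: step => //; rewrite divr_ge0// exprn_ge0.
Qed.

(** The intervals of radius 2 C / 2 ^ n around u n are nested; the limit is the
    supremum of their left ends. *)
Lemma geometric_limit (u : nat -> R) C :
  (forall n, `|u n.+1 - u n| <= C / 2 ^+ n) ->
  exists l, forall n, `|l - u n| <= 2 * C / 2 ^+ n.
Proof.
move=> H; pose d n : R := 2 * C / 2 ^+ n.
have dS n : d n - d n.+1 = C / 2 ^+ n.
  by rewrite /d exprSr invfM; field; rewrite expf_neq0.
have d0 n : 0 <= d n.
  have : 0 <= C / 2 ^+ n by exact: le_trans (H n).
  by rewrite /d -mulrA => ?; rewrite mulr_ge0.
pose lo n := u n - d n; pose up n := u n + d n.
have loS n : lo n <= lo n.+1.
  by have := H n; rewrite ler_norml => /andP[? ?]; have := dS n; rewrite /lo; lra.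
have upS n : up n.+1 <= up n.
  by have := H n; rewrite ler_norml => /andP[? ?]; have := dS n; rewrite /up; lra.
have lomono n m : (n <= m)%N -> lo n <= lo m.
  elim: m => [|m IH]; first by rewrite leqn0 => /eqP ->.
  by rewrite leq_eqVlt ltnS => /predU1P[-> //|/IH/le_trans]; apply.
have upmono n m : (n <= m)%N -> up m <= up n.
  elim: m => [|m IH]; first by rewrite leqn0 => /eqP ->.
  by rewrite leq_eqVlt ltnS => /predU1P[-> //|/IH]; exact: le_trans.
have loup n m : lo n <= up m.
  apply: le_trans (lomono _ _ (leq_maxl n m)) _.
  apply: le_trans (upmono _ _ (leq_maxr n m)).
  by rewrite /lo /up; have := d0 (maxn n m); lra.
have hs : has_sup (range lo).
  split; first by exists (lo 0), 0.
  by exists (up 0) => _ [n _ <-].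
exists (sup (range lo)) => n; rewrite -/(d n) ler_norml; apply/andP; split.
  have : lo n <= sup (range lo) by apply: sup_ubound; [case: hs|exists n].
  by rewrite /lo; lra.
have : sup (range lo) <= up n by apply: sup_le_ub; [case: hs|move=> _ [m _ <-]].
by rewrite /up; lra.
Qed.

End Halving.

Section Transport.
Context {R : realType}.
Local Notation V3 := (R * R * R)%type.
Variables (c S a1 b1 a2 b2 tau tau' : R).
Hypotheses (c0 : 0 < c) (S0 : 0 < S) (ab1 : a1 < b1) (ab2 : a2 < b2) (tt : tau < tau').
Hypothesis T1 : tau' - tau <= 1.
Local Notation P := (Pdom a1 b1 a2 b2 tau tau').
Local Notation len := (len c a1 b1 a2 b2 tau).
Local Notation clamp := (clamp a1 b1 a2 b2 tau tau').
Local Notation units := [:: et; ex; ey].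
Implicit Types (p v : V3) (h r : R) (i j : 'I_4) (N M : 'I_4 -> V3 -> R).

Lemma vec3_decomp p : p = tc p *: et + xc p *: ex + yc p *: ey.
Proof.
case: p => [[x y] z]; rewrite /et /ex /ey /tc /xc /yc /=.
by congr (_, _, _); rewrite /= ?scale_realE; ring.
Qed.

(** Go from one point to the other parallel to the axes. *)
Lemma lip_continuous (f : V3 -> R) k :
  (forall e, e \in units -> lip_along f e k) -> continuous f.
Proof.
move=> lf p.
have lt : lip_along f et k by apply: lf; rewrite !inE eqxx.
have lx : lip_along f ex k by apply: lf; rewrite !inE eqxx orbT.
have ly : lip_along f ey k by apply: lf; rewrite !inE eqxx !orbT.
have step a : `|f p - f a| <= k * (`|tc (p - a)| + `|xc (p - a)| + `|yc (p - a)|).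
  have E : p = a + tc (p - a) *: et + xc (p - a) *: ex + yc (p - a) *: ey.
    by rewrite -2!addrA [in RHS](addrA (_ *: et)) -vec3_decomp addrC subrK.
  rewrite [X in f X - _]E.
  set u := a + _; set w := u + _.
  have H1 := lt a (tc (p - a)); have H2 := lx u (xc (p - a)).
  have H3 := ly w (yc (p - a)).
  rewrite (_ : _ - f a = (f (w + yc (p - a) *: ey) - f w) + (f w - f u) + (f u - f a)); last by ring.
  rewrite (le_trans (ler_normD _ _))// (le_trans (lerD (ler_normD _ _) (lexx _)))//.
  rewrite (le_trans (lerD (lerD H3 H2) H1))//; lra.
apply/cvgrPdist_le => e e0; near=> a; apply: le_trans (step a) _.
near: a.
have cg : {for p, continuous (fun a : V3 => k * (`|tc (p - a)| + `|xc (p - a)| + `|yc (p - a)|))}.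
  by rewrite /tc /xc /yc; cont.
apply: (@near_comp _ _ _ p 0 (fun x : R => x <= e) cg).
  by rewrite subrr /tc /xc /yc /= normr0 !addr0 mulr0.
near=> x; apply: ltW; near: x; exact: lt_nbhsl.
Unshelve. all: by end_near. Qed.

(** Clamping can only shorten a displacement along an axis, and keeps it parallel
    to that axis. *)
Lemma clamp_line p h e : e \in units ->
  exists2 k, `|k| <= `|h| & clamp (p + h *: e) = clamp p + k *: e.
Proof.
have E0 (x y : R) : x + y *: 0 = x by rewrite scale_realE mulr0 addr0.
rewrite !inE => /or3P[] /eqP ->; rewrite /clamp !line_coord /et /ex /ey /tc /xc /yc /=
  !mulr0 !mulr1 !addr0.
- have [k kh E] := clampr_line tau tau' p.1.1 h.
  by exists k => //; rewrite E; congr (_, _, _); rewrite /= ?scale_realE; ring.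
- have [k kh E] := clampr_line a1 b1 p.1.2 h.
  by exists k => //; rewrite E; congr (_, _, _); rewrite /= ?scale_realE; ring.
- have [k kh E] := clampr_line a2 b2 p.2 h.
  by exists k => //; rewrite E; congr (_, _, _); rewrite /= ?scale_realE; ring.
Qed.

(** The set on which the Picard map is studied. The Lipschitz bound is along the
    axes only, so it passes to the partial derivatives with the same constant. *)
Definition lip_ball (X : R) N := forall i, (forall p, `|N i p| <= X) /\
  (forall e, e \in units -> lip_along (N i) e X).

Definition src N i p : R := sel 1 (-1) (-1) 1 i * Q c S N p.

Lemma norm_src N i p : `|src N i p| = `|Q c S N p|.
Proof.
by rewrite /src normrM; move: i; apply: ord4_ind; rewrite /sel /= ?normrN normr1 mul1r.
Qed.

Lemma src_sub N M i p q : `|src N i p - src M i q| = `|Q c S N p - Q c S M q|.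
Proof.
rewrite /src -mulrBr normrM; move: i.
by apply: ord4_ind; rewrite /sel /= ?normrN normr1 mul1r.
Qed.

(** The axis and the signed speed of the i-th velocity, to match the partial
    derivatives of the system. *)
Definition side : 'I_4 -> V3 := sel ex ey ey ex.
Definition speed : 'I_4 -> R := sel c c (- c) (- c).

Lemma side_unit i : side i \in units.
Proof. by move: i; apply: ord4_ind; rewrite /side /sel /= !inE eqxx ?orbT. Qed.

Lemma dirE i : dir c i = 1 *: et + speed i *: side i.
Proof.
have v3 (x y z x' y' z' : R) : x = x' -> y = y' -> z = z' ->
  ((x, y, z) : V3) = (x', y', z') by move=> -> -> ->.
move: i; apply: ord4_ind; rewrite /dir /side /speed /sel /=;
  by apply: v3; rewrite /= ?scale_realE; ring.
Qed.

Lemma broadwellP N p : broadwell_at c S N p <->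
  forall i, 'D_et (N i) p + speed i * 'D_(side i) (N i) p = src N i p.
Proof.
rewrite /broadwell_at /src; split=> [[B1 B2 B3 B4]|B].
  apply: ord4_ind; rewrite /speed /side /sel /= ?mul1r ?mulN1r ?mulNr //.
have := (B i1, B i2, B i3, B i4).
by rewrite /speed /side /sel /= !mul1r !mulN1r !mulNr => -[[[]]].
Qed.

Lemma norm_prod_le (x y X : R) : `|x| <= X -> `|y| <= X -> `|x * y| <= X ^+ 2.
Proof. by move=> xX yX; rewrite normrM expr2 ler_pM. Qed.

(** Used with X a common bound and B either a distance between two quadruples or an
    increment of one. *)
Lemma norm_prod_sub (x y x' y' X B : R) : `|x| <= X -> `|y'| <= X ->
  `|x - x'| <= B -> `|y - y'| <= B -> `|x * y - x' * y'| <= 2 * X * B.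
Proof.
move=> xX yX xB yB.
rewrite (_ : _ - _ = x * (y - y') + (x - x') * y'); last by ring.
apply: le_trans (ler_normD _ _) _.
have H1 : `|x * (y - y')| <= X * B by rewrite normrM ler_pM.
have H2 : `|(x - x') * y'| <= B * X by rewrite normrM ler_pM.
rewrite (le_trans (lerD H1 H2))//; lra.
Qed.

Lemma Q_bound N p X : (forall i, `|N i p| <= X) -> `|Q c S N p| <= 4 * c * S * X ^+ 2.
Proof.
move=> NX; rewrite /Q normrM ger0_norm; last by rewrite !mulr_ge0// ltW.
have H1 := norm_prod_le (NX i2) (NX i3); have H2 := norm_prod_le (NX i1) (NX i4).
have cS : 0 <= 2 * c * S by rewrite !mulr_ge0// ltW.
have := ler_wpM2l cS (le_trans (ler_normB _ _) (lerD H1 H2)).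
by move=> H; rewrite (le_trans H)//; lra.
Qed.

Lemma Q_sub N M p q X B : (forall i, `|N i p| <= X) -> (forall i, `|M i q| <= X) ->
  (forall i, `|N i p - M i q| <= B) ->
  `|Q c S N p - Q c S M q| <= 8 * c * S * X * B.
Proof.
move=> NX MX NM; rewrite /Q -mulrBr normrM ger0_norm; last by rewrite !mulr_ge0// ltW.
have H1 := norm_prod_sub (NX i2) (MX i3) (NM i2) (NM i3).
have H2 := norm_prod_sub (NX i1) (MX i4) (NM i1) (NM i4).
have cS : 0 <= 2 * c * S by rewrite !mulr_ge0// ltW.
have := ler_wpM2l cS (le_trans (ler_normB _ _) (lerD H1 H2)).
rewrite (_ : N i2 p * N i3 p - M i2 q * M i3 q - (N i1 p * N i4 p - M i1 q * M i4 q)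
 = N i2 p * N i3 p - N i1 p * N i4 p - (M i2 q * M i3 q - M i1 q * M i4 q)); last by ring.
by move=> H; rewrite (le_trans H)//; lra.
Qed.

Section Ball.
Variables (X : R).
Hypothesis X0 : 0 <= X.

Lemma lip_ball_cont N i : lip_ball X N -> continuous (N i).
Proof. by move=> /(_ i)[_ lN]; exact: lip_continuous lN. Qed.

Lemma src_cont N i : lip_ball X N -> continuous (src N i).
Proof.
move=> BN; have c1 := lip_ball_cont (i := i1) BN; have c2 := lip_ball_cont (i := i2) BN.
have c3 := lip_ball_cont (i := i3) BN; have c4 := lip_ball_cont (i := i4) BN.
by rewrite /src /Q; cont.
Qed.

Lemma src_bound N i p : lip_ball X N -> `|src N i p| <= 4 * c * S * X ^+ 2.
Proof. by move=> BN; rewrite norm_src; apply: Q_bound => j; have [] := BN j. Qed.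

Lemma src_lip N i e : lip_ball X N -> e \in units ->
  lip_along (src N i) e (8 * c * S * X ^+ 2).
Proof.
move=> BN He p h; rewrite src_sub expr2 !mulrA -[X in _ <= X]mulrA.
by apply: Q_sub => j; have [bN lN] := BN j => //; exact: lN.
Qed.

(** The right-hand side of the integral equation, computed at the clamped point so
    that a fixed point is defined, bounded and Lipschitz on the whole space. *)
Definition picard (D : 'I_4 -> V3 -> R) N i p : R :=
  D i (clamp p) + prim (fun r => src N i (clamp p - r *: dir c i)) (len i (clamp p)).

Variables (D : 'I_4 -> V3 -> R) (q : R).
Hypothesis Dq : forall i p, P p -> `|D i p| <= q.
Hypothesis Dlip : forall i e, e \in units -> forall p h, P p -> P (p + h *: e) ->
  `|D i (p + h *: e) - D i p| <= q * `|h|.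
Hypothesis qX : q + (12 * c * S + 4 * S) * X ^+ 2 <= X.

Let X2 : 0 <= X ^+ 2. Proof. exact: sqr_ge0. Qed.
Let cS : 0 <= c * S. Proof. by rewrite mulr_ge0// ltW. Qed.

(** A step h along an axis changes the integrand by at most 8 c S X^2 |h| and, by
    [len_lip], the length of the interval by at most (1 + 1 / c) |h|, while the
    integrand is at most 4 c S X^2. This adds up to (12 c S + 4 S) X^2 |h|, to which
    the datum adds q |h|. *)
Lemma picard_lip_ball N : lip_ball X N -> lip_ball X (picard D N).
Proof.
move=> BN i; pose f p r := src N i (p - r *: dir c i).
have cf p : continuous (f p) by apply: cont_along; exact: src_cont.
have cSX : 0 <= c * S * X ^+ 2 by rewrite mulr_ge0.
have SX : 0 <= S * X ^+ 2 by rewrite mulr_ge0// ltW.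
have Pc p : P (clamp p) by exact: clamp_in.
split=> [p|e He p h]; rewrite /picard.
  apply: le_trans (ler_normD _ _) _; apply: le_trans qX; apply: lerD; first exact: Dq.
  have l0 := len_ge0 c0 i (Pc p); have l1 := len_le1 c T1 i (Pc p).
  have := norm_prim_increment (cf (clamp p)) (lexx 0) l0 (fun r => src_bound i _ BN).
  rewrite prim0 !subr0 (ger0_norm l0) => /le_trans; apply.
  rewrite (le_trans (ler_piMr _ l1)) ?mulr_ge0//; first by rewrite ltW.
  by rewrite ltW.
  by lra.
have [k kh E] := clamp_line p h He.
have Pp'k : P (clamp p + k *: e) by rewrite -E.
rewrite E; move: (clamp p) (Pc p) Pp'k => {E} p' Pp' Pp'k.
have l0 := len_ge0 c0 i Pp'; have l1 := len_le1 c T1 i Pp'.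
have m0 := len_ge0 c0 i Pp'k.
have H1 : `|prim (f (p' + k *: e)) (len i (p' + k *: e)) - prim (f (p' + k *: e)) (len i p')|
    <= 4 * c * S * X ^+ 2 * ((1 + c^-1) * `|k|).
  apply: le_trans (norm_prim_increment (cf _) l0 m0 (fun r => src_bound i _ BN)) _.
  by rewrite ler_wpM2l ?len_lip//; lra.
have H2 : `|prim (f (p' + k *: e)) (len i p') - prim (f p') (len i p')|
    <= 8 * c * S * X ^+ 2 * `|k|.
  rewrite -primB//.
  have cff : continuous (fun r => f (p' + k *: e) r - f p' r).
    by move=> r; apply: (cont_add (cf _ r)); exact: (cont_opp (cf p' r)).
  have K0 : 0 <= 8 * c * S * X ^+ 2 * `|k| by rewrite mulr_ge0//; lra.
  have fK r : `|f (p' + k *: e) r - f p' r| <= 8 * c * S * X ^+ 2 * `|k|.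
    by rewrite /f addrAC; exact: src_lip.
  have := norm_prim_increment cff (lexx 0) l0 fK.
  rewrite prim0 !subr0 (ger0_norm l0) => /le_trans; apply.
  exact: ler_piMr.
have H3 := Dlip i He Pp' Pp'k.
rewrite [X in `|X|](_ : _ = (D i (p' + k *: e) - D i p')
  + ((prim (f (p' + k *: e)) (len i (p' + k *: e)) - prim (f (p' + k *: e)) (len i p'))
  + (prim (f (p' + k *: e)) (len i p') - prim (f p') (len i p')))); last first.
  by rewrite /f; ring.
apply: le_trans (ler_normD _ _) _.
apply: le_trans (lerD H3 (le_trans (ler_normD _ _) (lerD H1 H2))) _.
apply: le_trans (_ : X * `|k| <= _); last by rewrite ler_wpM2l.
apply: le_trans (ler_wpM2r (normr_ge0 k) qX).
rewrite mulrA -!mulrDl ler_wpM2r// lerD2l.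
rewrite (_ : 4 * c * S * X ^+ 2 * (1 + c^-1) = 4 * c * S * X ^+ 2 + 4 * S * X ^+ 2); first lra.
by field; exact: lt0r_neq0.
Qed.

Hypothesis X8 : 8 * c * S * X <= 1 / 2.

(** The source is 8 c S X-Lipschitz in the quadruple, and the interval of
    integration has length at most 1. *)
Lemma picard_contract N M B : lip_ball X N -> lip_ball X M -> 0 <= B ->
  (forall i p, `|N i p - M i p| <= B) ->
  forall i p, `|picard D N i p - picard D M i p| <= B / 2.
Proof.
move=> BN BM B0 NM i p; rewrite /picard.
have Pp : P (clamp p) by exact: clamp_in.
move: (clamp p) Pp => {}p Pp.
have l0 := len_ge0 c0 i Pp; have l1 := len_le1 c T1 i Pp.
have cN : continuous (fun r => src N i (p - r *: dir c i)).
  by apply: cont_along; exact: src_cont.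
have cM : continuous (fun r => src M i (p - r *: dir c i)).
  by apply: cont_along; exact: src_cont.
rewrite [X in `|X|](_ : _ = prim (fun r => src N i (p - r *: dir c i)) (len i p)
  - prim (fun r => src M i (p - r *: dir c i)) (len i p)); last by ring.
rewrite -primB//.
have cNM : continuous (fun r => src N i (p - r *: dir c i) - src M i (p - r *: dir c i)).
  by move=> r; apply: (cont_add (cN r)); exact: (cont_opp (cM r)).
have NM2 r : `|src N i (p - r *: dir c i) - src M i (p - r *: dir c i)| <= B / 2.
  rewrite src_sub; apply: le_trans (Q_sub (X := X) (B := B) _ _ _) _ => [j|j|j|].
  - by have [] := BN j.
  - by have [] := BM j.
  - exact: NM.
  - by rewrite mulrC ler_wpM2l// -div1r.
have := norm_prim_increment cNM (lexx 0) l0 NM2.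
rewrite prim0 !subr0 (ger0_norm l0) => /le_trans; apply.
by rewrite ler_piMr// divr_ge0.
Qed.

(** The iterates from 0 converge geometrically; the inequalities that define the
    ball pass to pointwise limits. *)
Lemma picard_fixpoint : exists2 N, lip_ball X N & forall i p, N i p = picard D N i p.
Proof.
pose u n := iter n (picard D) (fun _ _ => 0).
have Bu n : lip_ball X (u n).
  elim: n => [i|n IH]; last exact: picard_lip_ball.
  by split=> [p|e _ p h]; rewrite /u /= ?subrr normr0// mulr_ge0.
have du n i p : `|u n.+1 i p - u n i p| <= X / 2 ^+ n.
  move: i p; elim: n => [|n IH] i p.
    by rewrite expr0 divr1 /u /= subr0; have [+ _] := Bu 1%N i; apply.
  rewrite exprSr invfM mulrA.
  apply: (picard_contract (Bu n.+1) (Bu n)) => //.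
  by rewrite divr_ge0// exprn_ge0.
have /choice[f Hf] : forall z : 'I_4 * V3, exists l, forall n,
    `|l - u n z.1 z.2| <= 2 * X / 2 ^+ n.
  by move=> [i p]; apply: geometric_limit => n; exact: du.
pose N i p := f (i, p).
have Nu i p n : `|N i p - u n i p| <= 2 * X / 2 ^+ n by exact: (Hf (i, p)).
have BN : lip_ball X N.
  move=> i; split=> [p|e He p h].
    apply: (le_geo (C := 2 * X)) => n.
    have [/(_ p) H _] := Bu n i.
    rewrite -(subrK (u n i p) (N i p)) (le_trans (ler_normD _ _))// addrC lerD//.
  apply: (le_geo (C := 2 * X + 2 * X)) => n.
  have [_ /(_ e He p h) H] := Bu n i.
  rewrite (_ : N i (p + h *: e) - N i p = (u n i (p + h *: e) - u n i p)
    + ((N i (p + h *: e) - u n i (p + h *: e)) - (N i p - u n i p))); last by ring.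
  rewrite (le_trans (ler_normD _ _))// lerD// mulrDl.
  by rewrite (le_trans (ler_normB _ _))// lerD.
exists N => // i p; apply/eqP; rewrite -subr_eq0 -normr_le0.
apply: (le_geo (C := 2 * X)) => n; rewrite add0r.
have H1 := Nu i p n.+1.
have H2 : `|picard D N i p - picard D (u n) i p| <= 2 * X / 2 ^+ n / 2.
  apply: picard_contract => //.
  by rewrite divr_ge0 ?exprn_ge0// mulr_ge0.
rewrite (_ : N i p - picard D N i p = (N i p - u n.+1 i p) - (picard D N i p - picard D (u n) i p)).
  rewrite (le_trans (ler_normB _ _))// (le_trans (lerD H1 H2))//.
  by rewrite exprSr invfM mulrA -splitr.
by rewrite /u /=; ring.
Qed.

End Ball.
End Transport.

(** * Regularity and sign of the solution of the integral equation *)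

Section OneVariable.
Context {R : realType}.

Lemma lip_derive {V : normedModType R} (f : V -> R) (p e : V) (k : R) :
  lip_along f e k -> derivable f p e -> `|'D_e f p| <= k.
Proof.
move=> lf df; apply/ler_addgt0Pr => eps eps0.
have /cvgrPdist_le/(_ _ eps0) H : h^-1 *: ((f \o shift p) (h *: e) - f p) @[h --> 0^'] --> 'D_e f p.
  exact: df.
near (0 : R)^' => h.
have h0 : h != 0 by near: h; exact: nbhs_dnbhs_neq.
have Hh : `|'D_e f p - h^-1 *: ((f \o shift p) (h *: e) - f p)| <= eps by near: h.
rewrite -(subrK (h^-1 *: ((f \o shift p) (h *: e) - f p)) ('D_e f p)).
rewrite (le_trans (ler_normD _ _))// addrC lerD//.
rewrite scale_realE normrM normfV mulrC ler_pdivrMr ?normr_gt0//= (addrC _ p).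
exact: lf.
Unshelve. all: by end_near. Qed.

(** Run back from L to the last time at which u was nonnegative: since then u has
    been negative, so it has decreased at rate at most k. *)
Lemma barrier (u g : R -> R) (L k : R) : 0 <= L -> 0 <= k -> continuous u -> 0 <= u 0 ->
  (forall r, 0 < r < L -> is_derive r 1 u (g r)) ->
  (forall r, 0 < r < L -> u r < 0 -> - k <= g r) -> - (k * L) <= u L.
Proof.
move=> L0 k0 cu u0 du gk.
have kL : 0 <= k * L by rewrite mulr_ge0.
have [uL|uL] := leP 0 (u L); first by rewrite (le_trans _ uL)// oppr_le0.
(* sup E is the last time at which u is nonnegative. *)
pose E : set R := [set r | 0 <= r <= L /\ 0 <= u r].
have hE : has_sup E.
  by split; [exists 0; rewrite /E /= lexx L0|exists L => r [/andP[]]].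
pose s := sup E.
have s0 : 0 <= s by apply: sup_ubound; [case: hE|rewrite /E /= lexx L0].
have sL : s <= L by apply: sup_le_ub; [case: hE|move=> r [/andP[]]].
have us : 0 <= u s.
  rewrite leNgt; apply/negP => us.
  have /nbhs_ballP[d /= d0 dP] : \forall r \near s, u r < 0.
    apply: (@near_comp _ _ u s _ (fun x : R => x < 0) (cu s) erefl); exact: lt_nbhsl.
  have [r Er rs] := sup_adherent d0 hE.
  have : u r < 0.
    apply: dP; rewrite -ball_normE /= ger0_norm; first by rewrite -/s in rs; lra.
    by rewrite subr_ge0; apply: sup_ubound => //; case: hE.
  by apply/negP; rewrite -leNgt; case: Er.
have neg r : s < r <= L -> u r < 0.
  move=> /andP[sr rL]; rewrite ltNge; apply/negP => ur.
  have : r <= s.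
    apply: sup_ubound; first by case: hE.
    by split=> //; rewrite rL (le_trans s0)// ltW.
  by rewrite leNgt sr.
have sL' : s < L by rewrite lt_neqAle sL andbT; apply/eqP => sE; move: us; rewrite sE leNgt uL.
have cl : {within `[s, L], continuous u} by apply: continuous_subspaceT.
have dl r : r \in `]s, L[%R -> is_derive r 1 u (g r).
  by rewrite in_itv/= => /andP[sr rL]; apply: du; rewrite rL (le_lt_trans s0).
have [r] := MVT sL' dl cl; rewrite in_itv/= => /andP[sr rL] E'.
have gr : - k <= g r.
  by apply: gk; [rewrite rL (le_lt_trans s0)|apply: neg; rewrite sr ltW].
have sL0 : 0 <= L - s by rewrite subr_ge0.
have := ler_wpM2r sL0 gr; rewrite -E'.
have : 0 <= k * s by rewrite mulr_ge0.
lra.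
Qed.

Lemma halving_eps (C e : R) : 0 < e -> exists n, C / 2 ^+ n <= e.
Proof.
move=> e0; apply: contrapT => H.
suff : e <= 0 by rewrite leNgt e0.
apply: (@le_geo _ _ _ C) => n; rewrite add0r leNgt; apply/negP => /ltW le.
by apply: H; exists n.
Qed.

End OneVariable.

Section FixedPoint.
Context {R : realType}.
Local Notation V3 := (R * R * R)%type.
Variables (c S a1 b1 a2 b2 tau tau' : R).
Hypotheses (c0 : 0 < c) (S0 : 0 < S) (ab1 : a1 < b1) (ab2 : a2 < b2) (tt : tau < tau').
Hypothesis T1 : tau' - tau <= 1.
Local Notation P := (Pdom a1 b1 a2 b2 tau tau').
Local Notation Pint := (Pint a1 b1 a2 b2 tau tau').
Local Notation len := (len c a1 b1 a2 b2 tau).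
Local Notation kink := (kink c a1 b1 a2 b2 tau).
Local Notation clamp := (clamp a1 b1 a2 b2 tau tau').
Local Notation picard := (picard c S a1 b1 a2 b2 tau tau').
Local Notation src := (src c S).
Local Notation dir := (dir c).
Local Notation units := [:: et; ex; ey].
Implicit Types (p v : V3) (h r : R) (i j : 'I_4).
Variables (X : R) (D N : 'I_4 -> V3 -> R).
Hypothesis X0 : 0 <= X.
Hypothesis X8 : 8 * c * S * X <= 1 / 2.
Hypothesis BN : lip_ball X N.
Hypothesis NE : forall i p, N i p = picard D N i p.
Hypothesis Dreg : forall i p e, Pint p -> ~ kink i p -> exists d, sderiv (D i) p e d.
Hypothesis Ddir : forall i p h, D i (p + h *: dir i) = D i p.
Hypothesis Dge0 : forall i p, P p -> 0 <= D i p.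

Let cN i : continuous (N i). Proof. exact: lip_ball_cont BN. Qed.
Let cF i : continuous (src N i). Proof. exact: src_cont BN. Qed.

Lemma mild_Pdom i p : P p ->
  N i p = D i p + prim (fun r => src N i (p - r *: dir i)) (len i p).
Proof. by move=> Pp; rewrite NE /picard clamp_id. Qed.

(** The source is quadratic with factors bounded by X, so the Leibniz rule
    multiplies defects by 2 c S * 2 * 2 X. *)
Lemma src_defect i p e w : 0 <= w -> e \in units ->
  (forall j, defect (N j) p e w) -> defect (src N i) p e (8 * c * S * X * w).
Proof.
move=> w0 He dN.
have pr j k : defect (fun a => N j a * N k a) p e (X * (w + w)).
  have [bj lj] := BN j; have [bk lk] := BN k.
  apply: defectM => //; try exact: cN.
  - exact: lj.
  - exact: lk.
have D1 := defectD (pr i2 i3) (defectZ (-1) (pr i1 i4)).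
have D2 := defectZ (sel 1 (-1) (-1) 1 i * (2 * c * S)) D1.
have Enorm : `|sel 1 (-1) (-1) 1 i * (2 * c * S)| = 2 * c * S.
  have cS : 0 <= 2 * c * S by rewrite !mulr_ge0// ltW.
  rewrite normrM (ger0_norm cS); move: (i); apply: ord4_ind;
    by rewrite /sel /= ?normrN normr1 mul1r.
rewrite Enorm normrN normr1 in D2.
have E : src N i = (fun a => sel 1 (-1) (-1) 1 i * (2 * c * S) * (N i2 a * N i3 a + -1 * (N i1 a * N i4 a))).
  by apply/funext => a; rewrite /src /Q; ring.
rewrite E; apply: slope_defect_le D2; lra.
Qed.

(** Apply [defect_prim] to the integral equation: the datum has no defect off the
    kink plane, the integrand has defect at most 8 c S X w except at the finitely
    many crossings and at the entry point, and the length is at most 1. *)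
Lemma defect_halving w : 0 <= w ->
  (forall i e p, e \in units -> Pint p -> ~ kink i p -> defect (N i) p e w) ->
  forall i e p, e \in units -> Pint p -> ~ kink i p -> defect (N i) p e (w / 2).
Proof.
move=> w0 dN i e p He ip nk.
have [d sd] := Dreg e ip nk.
have [k lenE] := len_affine e nk.
have [A cA HA] := kink_crossings c0 nk.
have l0 := len_gt0 c0 i ip; have l1 := len_le1 c T1 i (Pint_Pdom ip).
have [_ lF] := BN i.
have cAl : countable (A `|` [set len i p]).
  by apply: finite_set_countable; rewrite finite_setU.
have w8 : 0 <= 8 * c * S * X * w by rewrite !mulr_ge0// ltW.
have dF r : 0 <= r <= len i p -> ~ (A `|` [set len i p]) r ->
    defect (src N i) (p - r *: dir i) e (8 * c * S * X * w).
  move=> /andP[r0 rl] /not_orP[nA nl]; apply: src_defect => // j; apply: dN => //.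
    apply: Pint_back => //; rewrite r0 lt_neqAle rl andbT; exact/eqP.
  exact: HA.
have D1 := defect_prim (@cF i) (src_lip c0 S0 i BN He) w8 l0
  (@len_cont _ c a1 b1 a2 b2 tau i p) lenE cAl dF.
have D2 := defectD (sderiv_defect sd) D1.
apply: (@defect_near _ _ (fun q => D i q + prim (fun r => src N i (q - r *: dir i)) (len i q))).
  near=> a; rewrite mild_Pdom//; apply: Pint_Pdom; near: a; exact: near_Pint.
apply: slope_defect_le D2; rewrite add0r.
rewrite (le_trans (ler_piMr w8 l1))//.
have := ler_wpM2r w0 X8; lra.
Unshelve. all: by end_near. Qed.

Lemma mild_sderiv i e p : e \in units -> Pint p -> ~ kink i p -> exists d, sderiv (N i) p e d.
Proof.
move=> He ip nk; apply: defect0_sderiv => eps eps0.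
have := @halving R (fun w => forall i e p, e \in units -> Pint p -> ~ kink i p ->
  defect (N i) p e w) (2 * X) _ _ defect_halving.
move=> H; have e2 : 0 < eps / 2 by rewrite divr_gt0.
have [n Hn] := halving_eps (2 * X) e2.
have := H _ _ n i e p He ip nk (eps / 2) e2 => dn.
near=> z; apply: le_trans (_ : (2 * X / 2 ^+ n + eps / 2) * `|z.1.2 * z.2.2| <= _).
  near: z; apply: dn; first by rewrite mulr_ge0.
  by move=> j e' p' He' _ _; have [_ lN] := BN j; apply: lip_defect; exact: lN.
by rewrite ler_wpM2r// add0r [leRHS]splitr lerD2r.
Unshelve. all: by end_near. Qed.

Lemma mild_C1 i p : Pint p -> ~ kink i p -> C1_at units (N i) p.
Proof.
move=> ip nk e He; apply: sderiv_C1; near=> a; apply: mild_sderiv => //; near: a.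
  exact: near_Pint.
by apply: plane_near => //; exact: kink_plane.
Unshelve. all: by end_near. Qed.

(** Holds on the kink planes too: along the characteristic the datum is constant
    and the integral starts from a fixed point, so this is the fundamental theorem
    of calculus. *)
Lemma mild_dir i p : Pint p -> is_derive p (dir i) (N i) (src N i p).
Proof.
(* G is the source as a function of the time since the entry point. *)
move=> ip; pose L := len i p; pose G r := src N i (p - L *: dir i + r *: dir i).
have cG : continuous G.
  rewrite /G => z; apply: (@cont_comp _ _ _ (fun r : R => p - L *: dir i + r *: dir i) (src N i)).
    exact: cF.
  by cont.
have L0 : 0 < L by exact: (len_gt0 c0 i ip).
have GL : G L = src N i p by rewrite /G subrK.
have lineE s : P (p + s *: dir i) -> N i (p + s *: dir i) = D i p + prim G (L + s).
  move=> Ps; rewrite mild_Pdom// Ddir len_line// -/L; congr (_ + _).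
  rewrite -(prim_rev cG); last first.
    by have := len_ge0 c0 i Ps; rewrite len_line.
  congr prim; apply/funext => r; rewrite /G; congr (src N i _).
  rewrite addrAC -!addrA; congr (p + _).
  by rewrite -!scaleNr -!scalerDl; congr (_ *: _); lra.
have dG := is_derive_prim cG L0.
have [ddG DG] := dG.
have E0 : N i p = D i p + prim G L.
  by have := lineE 0; rewrite scale0r !addr0; apply; exact: Pint_Pdom.
have cv : h^-1 *: ((N i \o shift p) (h *: dir i) - N i p) @[h --> 0^'] --> src N i p.
  have cvG : h^-1 *: ((prim G \o shift L) (h *: 1) - prim G L) @[h --> 0^'] --> G L.
    by rewrite -DG; exact: ddG.
  rewrite -GL; apply: cvg_trans cvG; apply: near_eq_cvg; near=> h.
  have Ph : P (p + h *: dir i).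
    near: h; apply: nbhs_dnbhs; apply: (@near_comp _ _ (fun h : R => p + h *: dir i) 0 p P).
    - by cont.
    - by rewrite scale0r addr0.
    - by near=> a; apply: Pint_Pdom; near: a; exact: near_Pint.
  rewrite /= (addrC _ p) lineE// E0 [h *: 1]mulr1 (addrC h); congr (_ *: _); ring.
by apply: DeriveDef; [apply/cvg_ex; eexists; exact: cv|exact/cvg_lim].
Unshelve. all: by end_near. Qed.

(** The derivative along the characteristic is the combination of partial
    derivatives in the equation, by strict differentiability. *)
Lemma mild_broadwell p : Pint p -> (forall i, ~ kink i p) -> broadwell_at c S N p.
Proof.
move=> ip nk; apply/broadwellP => i.
have [dt st] := mild_sderiv (mem_head et [:: ex; ey] : (et : V3) \in units) ip (nk i).
have [de se] := mild_sderiv (side_unit i) ip (nk i).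
have [_ <-] := mild_dir i ip; rewrite dirE.
have [_ ->] := sderiv_is_derive (sderiv_lin 1 (speed c i) st se).
have [_ ->] := sderiv_is_derive st; have [_ ->] := sderiv_is_derive se.
by rewrite mul1r.
Qed.

(** A negative product has one factor in [- m, 0] and the other in [0, X]. *)
Lemma prod_lower (x y m : R) : 0 <= m -> - m <= x -> - m <= y -> `|x| <= X -> `|y| <= X ->
  - (X * m) <= x * y.
Proof.
move=> m0 xm ym; rewrite !ler_norml => /andP[? xX] /andP[? yX].
have Xm : 0 <= X * m by rewrite mulr_ge0.
have [x0|x0] := leP 0 x.
  have [y0|y0] := leP 0 y.
    by rewrite (le_trans _ (mulr_ge0 x0 y0))// oppr_le0.
  have H1 := ler_wpM2l x0 ym; have H2 := ler_wpM2r m0 xX; lra.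
have [y0|y0] := leP 0 y.
  have H1 := ler_wpM2r y0 xm; have H2 := ler_wpM2l m0 yX; lra.
have : 0 <= x * y by rewrite mulr_le0// ltW.
lra.
Qed.

(** The gain products are at least - X m by [prod_lower]. The loss term is a
    product with factor - N_i, which is positive and at most X, while the other
    factor is at least - m. *)
Lemma src_lower i p m : 0 <= m -> (forall j, - m <= N j p) -> N i p < 0 ->
  - (4 * c * S * X * m) <= src N i p.
Proof.
move=> m0 Nm Ni.
have cS : 0 <= 2 * c * S by rewrite !mulr_ge0// ltW.
have NX j : `|N j p| <= X by have [] := BN j.
have gain j k : - (X * m) <= N j p * N k p by apply: prod_lower.
have loss k : - (X * m) <= - (N i p * N k p).
  rewrite -mulNr.
  have Ni0 : 0 <= - N i p by rewrite oppr_ge0 ltW.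
  have H1 := ler_wpM2l Ni0 (Nm k).
  have H2 : - N i p * m <= X * m.
    rewrite ler_wpM2r//; have := NX i; rewrite ler_norml => /andP[]; lra.
  lra.
have fin (x y : R) : - (X * m) <= x -> - (X * m) <= y ->
    - (4 * c * S * X * m) <= 2 * c * S * (x + y).
  move=> xX yX; have := ler_wpM2l cS (lerD xX yX); lra.
move: i Ni loss; apply: ord4_ind => Ni loss; rewrite /src /sel /Q /=.
- rewrite [leRHS](_ : _ = 2 * c * S * (N i2 p * N i3 p + - (N i1 p * N i4 p))); last by ring.
  by apply: fin; [exact: gain|exact: loss].
- rewrite [leRHS](_ : _ = 2 * c * S * (N i1 p * N i4 p + - (N i2 p * N i3 p))); last by ring.
  by apply: fin; [exact: gain|exact: loss].
- rewrite [leRHS](_ : _ = 2 * c * S * (N i1 p * N i4 p + - (N i3 p * N i2 p))); last by ring.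
  by apply: fin; [exact: gain|exact: loss].
- rewrite [leRHS](_ : _ = 2 * c * S * (N i2 p * N i3 p + - (N i4 p * N i1 p))); last by ring.
  by apply: fin; [exact: gain|exact: loss].
Qed.

(** Apply [barrier] along the characteristic through p, from its entry point, where
    N_i equals the nonnegative datum. *)
Lemma nonneg_halving m : 0 <= m -> (forall i p, Pint p -> - m <= N i p) ->
  forall i p, Pint p -> - (m / 2) <= N i p.
Proof.
move=> m0 Nm i p ip.
pose L := len i p; pose q := p - L *: dir i.
have L0 : 0 < L by exact: (len_gt0 c0 i ip).
have L1 : L <= 1 := len_le1 c T1 i (Pint_Pdom ip).
have qL : q + L *: dir i = p by rewrite /q subrK.
have Pq : P q by apply: Pdom_back => //; [exact: Pint_Pdom|rewrite lexx ltW].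
have Nq : 0 <= N i q.
  rewrite mild_Pdom// (_ : len i q = 0) ?prim0 ?addr0 ?Dge0//.
  by rewrite /q subr_line len_line// -/L subrr.
have iq r : 0 < r < L -> Pint (q + r *: dir i).
  move=> /andP[r0 rL].
  rewrite (_ : q + r *: dir i = p - (L - r) *: dir i); last first.
    by rewrite /q scalerBl opprB -!addrA; congr (p + _); rewrite addrC.
  by apply: Pint_back => //; rewrite -/L; apply/andP; split; lra.
have k0 : 0 <= 4 * c * S * X * m by rewrite !mulr_ge0// ltW.
have := @barrier R (fun r => N i (q + r *: dir i)) (fun r => src N i (q + r *: dir i))
  L (4 * c * S * X * m) (ltW L0) k0.
rewrite scale0r addr0 qL => B.
apply: le_trans (B _ Nq _ _).
- rewrite lerN2 (le_trans (ler_piMr k0 L1))//.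
  have := ler_wpM2r m0 X8; lra.
- by move=> z; apply: (@cont_comp _ _ _ (fun r : R => q + r *: dir i) (N i)); [exact: cN|cont].
- move=> r r0L; have [dd DD] := mild_dir i (iq r r0L).
  by rewrite -DD; exact: is_derive_line.
- move=> r r0L; apply: src_lower => // j; exact: Nm (iq r r0L).
Qed.

Lemma mild_ge0 i p : P p -> 0 <= N i p.
Proof.
move=> Pp.
have int p' : Pint p' -> 0 <= N i p'.
  move=> ip; rewrite -oppr_le0; apply: (@le_geo _ _ _ X) => n; rewrite add0r lerNl.
  apply: (@halving R (fun m => forall i p, Pint p -> - m <= N i p) X X0 _ nonneg_halving) => //.
  by move=> j a _; have [/(_ a) + _] := BN j; rewrite ler_norml => /andP[].
rewrite leNgt; apply/negP => Np.
have : \forall s \near (0 : R)^'+, N i (p + s *: (box_center a1 b1 a2 b2 tau tau' - p)) < 0.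
  apply: near_at_right.
  apply: (@near_comp _ _ (fun s : R => N i (p + s *: (box_center a1 b1 a2 b2 tau tau' - p))) (0 : R)
     _ (fun x : R => x < 0) _ erefl).
    by apply: (@cont_comp _ _ _ (fun s : R => p + s *: _) (N i)); [exact: cN|cont].
  by rewrite scale0r addr0; exact: lt_nbhsl.
move=> H; near (0 : R)^'+ => s.
have : N i (p + s *: (box_center a1 b1 a2 b2 tau tau' - p)) < 0 by near: s.
apply/negP; rewrite -leNgt; apply: int; apply: Pint_shrink => //.
by apply/andP; split; near: s; [exact: nbhs_right_gt|exact: nbhs_right_lt].
Unshelve. all: by end_near. Qed.

End FixedPoint.

(** * Uniqueness *)

Section Uniqueness.
Context {R : realType}.
Local Notation V3 := (R * R * R)%type.
Variables (c S a1 b1 a2 b2 tau tau' : R).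
Hypotheses (c0 : 0 < c) (S0 : 0 < S) (ab1 : a1 < b1) (ab2 : a2 < b2) (tt : tau < tau').
Hypothesis T1 : tau' - tau <= 1.
Local Notation P := (Pdom a1 b1 a2 b2 tau tau').
Local Notation Pint := (Pint a1 b1 a2 b2 tau tau').
Local Notation len := (len c a1 b1 a2 b2 tau).
Local Notation ell := (ell c a1 b1 a2 b2).
Local Notation clamp := (clamp a1 b1 a2 b2 tau tau').
Local Notation src := (src c S).
Local Notation dir := (dir c).
Local Notation units := [:: et; ex; ey].
Implicit Types (p v : V3) (h r : R) (i j : 'I_4).

Lemma near_off_planes (s : seq (set V3)) p : (forall H, H \in s -> is_plane H) ->
  (forall H, H \in s -> ~ H p) -> \forall a \near p, forall H, H \in s -> ~ H a.
Proof.
elim: s => [|H s IH] plane off; first by near=> a.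
have nH : \forall a \near p, ~ H a.
  by apply: plane_near; [apply: plane|apply: off]; rewrite mem_head.
have ns : \forall a \near p, forall H, H \in s -> ~ H a.
  by apply: IH => H' H's; [apply: plane|apply: off]; rewrite inE H's orbT.
near=> a => H'; rewrite inE => /predU1P[->|H's]; first by near: a.
by move: H' H's; near: a.
Unshelve. all: by end_near. Qed.

(** Same passage as in [mild_broadwell], read from the equation to the derivative
    along the characteristic. *)
Lemma C1_dir (N : 'I_4 -> V3 -> R) i p : (\forall a \near p, C1_at units (N i) a) ->
  broadwell_at c S N p -> is_derive p (dir i) (N i) (src N i p).
Proof.
move=> C1 /broadwellP B; rewrite -B dirE.
have st : sderiv (N i) p et ('D_et (N i) p).
  have Het : (et : V3) \in units by rewrite mem_head.
  apply: C1_sderiv; last by have [] := nbhs_singleton C1 _ Het.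
  by near=> a; have [] := (near C1 a _) _ Het.
have ss : sderiv (N i) p (side i) ('D_(side i) (N i) p).
  apply: C1_sderiv; last by have [] := nbhs_singleton C1 _ (side_unit i).
  by near=> a; have [] := (near C1 a _) _ (side_unit i).
have := sderiv_is_derive (sderiv_lin 1 (speed c i) st ss).
by rewrite mul1r.
Unshelve. all: by end_near. Qed.

Lemma sol_dir (Ntau : 'I_4 -> R * R -> R) N1m N2m N3p N4p (M : 'I_4 -> V3 -> R) :
  is_solution c S a1 b1 a2 b2 tau tau' Ntau N1m N2m N3p N4p M ->
  exists2 s : seq (set V3), (forall H, H \in s -> is_plane H) &
    forall i p, Pint p -> (forall H, H \in s -> ~ H p) ->
      is_derive p (dir i) (M i) (src M i p).
Proof.
move=> [_ [Pi [/finite_seqP[s ->] plane sol] _ _]].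
have plane' H : H \in s -> is_plane H by exact: plane.
exists s => // i p ip off.
have sol' a : Pint a -> (forall H, H \in s -> ~ H a) ->
    (forall i, C1_at units (M i) a) /\ broadwell_at c S M a.
  by move=> ia offa; apply: sol => //; apply/interior_Pdom.
apply: C1_dir; last by have [] := sol' p ip off.
near=> a; have [] : (forall i, C1_at units (M i) a) /\ broadwell_at c S M a.
  apply: sol'; near: a; first exact: near_Pint.
  exact: near_off_planes.
by [].
Unshelve. all: by end_near. Qed.

(** Entry points lie on t = tau or on the wall of index i, where the conditions
    prescribe the value. *)
Lemma sol_entry (Ntau : 'I_4 -> R * R -> R) N1m N2m N3p N4p (M M' : 'I_4 -> V3 -> R) :
  is_solution c S a1 b1 a2 b2 tau tau' Ntau N1m N2m N3p N4p M ->
  is_solution c S a1 b1 a2 b2 tau tau' Ntau N1m N2m N3p N4p M' ->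
  forall i p, P p -> len i p = 0 -> M i p = M' i p.
Proof.
move=> [_ _ iM bM] [_ _ iM' bM'] i p Pp.
have /PdomE[Ht Hx Hy] := Pp.
rewrite /len /Num.min; case: ifP => _.
  move=> /eqP; rewrite subr_eq0 => /eqP tp.
  have Op : Omega a1 b1 a2 b2 (xc p, yc p) by split; rewrite /= in_itv.
  by have := iM i _ _ Op; have := iM' i _ _ Op; rewrite -tp /tc /xc /yc -!surjective_pairing => -> ->.
rewrite /ell => /eqP; rewrite mulf_eq0 invr_eq0 (negbTE (lt0r_neq0 c0)) orbF => /eqP.
have pE : p = (tc p, xc p, yc p) by rewrite /tc /xc /yc -!surjective_pairing.
have Pp' : P (tc p, xc p, yc p) by rewrite -pE.
have [B1 B2 B3 B4] := bM _ _ _ Pp'; have [B1' B2' B3' B4'] := bM' _ _ _ Pp'.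
move: i; apply: ord4_ind; rewrite /sel /= => /eqP; rewrite subr_eq0 => /eqP E; rewrite pE.
- by rewrite E B1 B1'.
- by rewrite E B2 B2'.
- by rewrite -E B3 B3'.
- by rewrite -E B4 B4'.
Qed.

Lemma sol_unique (Ntau : 'I_4 -> R * R -> R) N1m N2m N3p N4p (M M' : 'I_4 -> V3 -> R) X :
  0 <= X -> 8 * c * S * X <= 1 / 2 ->
  is_solution c S a1 b1 a2 b2 tau tau' Ntau N1m N2m N3p N4p M ->
  is_solution c S a1 b1 a2 b2 tau tau' Ntau N1m N2m N3p N4p M' ->
  (forall i p, P p -> `|M i p| <= X) -> (forall i p, P p -> `|M' i p| <= X) ->
  forall i p, P p -> M i p = M' i p.
Proof.
move=> X0 X8 sM sM' MX MX'.
have [s plane dM] := sol_dir sM; have [s' plane' dM'] := sol_dir sM'.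
have entry := sol_entry sM sM'.
have [cM _ _ _] := sM; have [cM' _ _ _] := sM'.
(* A solution is continuous on the box only; clamped, it is so everywhere. *)
have cc i : continuous (fun p => M i (clamp p) - M' i (clamp p)).
  have c1 := continuous_retract (cM i) (@clamp_cont _ a1 b1 a2 b2 tau tau') (clamp_in ab1 ab2 tt).
  have c2 := continuous_retract (cM' i) (@clamp_cont _ a1 b1 a2 b2 tau tau') (clamp_in ab1 ab2 tt).
  by move=> z; apply: (cont_add (c1 z)); exact: (cont_opp (c2 z)).
have step B : 0 <= B -> (forall i p, P p -> `|M i p - M' i p| <= B) ->
    forall i p, P p -> `|M i p - M' i p| <= B / 2.
  move=> B0 HB i p Pp.
  have l0 := len_ge0 c0 i Pp; have l1 := len_le1 c T1 i Pp.
  have Pq : P (p - len i p *: dir i) by apply: Pdom_back => //; rewrite l0 lexx.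
  have qp : p - len i p *: dir i + len i p *: dir i = p by rewrite subrK.
  have Eq : M i (p - len i p *: dir i) = M' i (p - len i p *: dir i).
    by apply: entry => //; rewrite subr_line len_line// subrr.
  have plane2 H : H \in s ++ s' -> is_plane H.
    by rewrite mem_cat => /orP[/plane|/plane'].
  have B20 : 0 <= B / 2 by rewrite divr_ge0.
  have dw p' : Pint p' -> (forall H, H \in s ++ s' -> ~ H p') ->
      derivable (fun p => M i (clamp p) - M' i (clamp p)) p' (dir i) /\
      `|'D_(dir i) (fun p => M i (clamp p) - M' i (clamp p)) p'| <= B / 2.
    move=> ip' off.
    have d1 : is_derive p' (dir i) (M i) (src M i p').
      by apply: dM => // H Hs; apply: off; rewrite mem_cat Hs.
    have d2 : is_derive p' (dir i) (M' i) (src M' i p').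
      by apply: dM' => // H Hs; apply: off; rewrite mem_cat Hs orbT.
    have [d3 E3] := is_deriveB d1 d2.
    have nE : \forall a \near p', (M i - M' i) a = M i (clamp a) - M' i (clamp a).
      near=> a; rewrite clamp_id//; apply: Pint_Pdom; near: a; exact: near_Pint.
    split; first exact: near_eq_derivable nE d3.
    rewrite -(near_eq_derive (dir i) nE) E3 src_sub.
    apply: le_trans (Q_sub (X := X) (B := B) c0 S0 _ _ _) _.
    - by move=> j; apply: MX; exact: Pint_Pdom.
    - by move=> j; apply: MX'; exact: Pint_Pdom.
    - by move=> j; apply: HB; exact: Pint_Pdom.
    - have := ler_wpM2r B0 X8; lra.
  have Pqp : P (p - len i p *: dir i + len i p *: dir i) by rewrite qp.
  have := lip_off_planes ab1 ab2 tt plane2 B20 (cc i) dw Pq Pqp.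
  rewrite qp !clamp_id// Eq subrr subr0 (ger0_norm l0) => /le_trans; apply.
  exact: ler_piMr.
move=> i p Pp; apply/eqP; rewrite -subr_eq0 -normr_le0.
apply: (@le_geo _ _ _ (2 * X)) => n; rewrite add0r.
apply: (@halving R (fun B => forall i p, P p -> `|M i p - M' i p| <= B) (2 * X) _ _ step) => //.
  by rewrite mulr_ge0.
move=> j a Pa; rewrite (le_trans (ler_normB _ _))// mulrDl mul1r lerD ?MX ?MX'//.
Unshelve. all: by end_near. Qed.

End Uniqueness.

Section Finiteness.
Context {R : realType}.
Local Notation V3 := (R * R * R)%type.
Local Notation units := [:: et; ex; ey].

Lemma bounded_le {T : Type} (A : set T) (f : T -> R) :
  [bounded f x | x in A] -> exists2 k : R, 0 <= k & forall x, A x -> `|f x| <= k.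
Proof.
by move=> /pinfty_ex_gt0[k k0 H]; exists k => //; exact: ltW.
Qed.

Lemma le_bounded {T : Type} (A : set T) (f : T -> R) (k : R) :
  (forall x, A x -> `|f x| <= k) -> [bounded f x | x in A].
Proof.
move=> H; exists k; split; first exact: num_real.
by move=> M kM x Ax; rewrite /= (le_trans (H x Ax))// ltW.
Qed.

(** Chain rule for an affine phi. The vectors u and v show that phi is onto, hence
    open, so that interior points are sent to points where the derivatives of g
    exist and are bounded. *)
Lemma transported_norm1_fin (a1 b1 a2 b2 tau tau' : R) (D : set (R * R)) (g : R * R -> R)
    (phi phil : V3 -> R * R) (u v : V3) :
  good_datum D g -> continuous phi ->
  (forall a h w, phi (a + h *: w) = phi a + h *: phil w) ->
  phil u = e1 -> phil v = e2 ->
  exists k, (transported_norm1 a1 b1 a2 b2 tau tau' D g phi <= k%:E)%E.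
Proof.
move=> [_ _ /bounded_le[k k0 gk] C1 bd] cphi lphi Eu Ev.
have He1 : (e1 : R * R) \in [:: e1; e2] by rewrite mem_head.
have He2 : (e2 : R * R) \in [:: e1; e2] by rewrite !inE eqxx orbT.
have [k1 k10 H1] := bounded_le (bd e1 He1).
have [k2 k20 H2] := bounded_le (bd e2 He2).
pose n (w : V3) := `|(phil w).1| * k1 + `|(phil w).2| * k2.
have n0 w : 0 <= n w by rewrite addr_ge0// mulr_ge0.
exists (k + (n et + n ex + n ey)); apply/norm1_leP; split=> [p [_ Dp]|e He p iA _].
  apply: (le_trans (gk _ Dp)); have := n0 et; have := n0 ex; have := n0 ey; lra.
have iD : D° (phi p).
  (* an affine section of phi through p *)
  pose psi (z : R * R) := p + (z.1 - (phi p).1) *: u + (z.2 - (phi p).2) *: v.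
  have phipsi z : phi (psi z) = z.
    rewrite /psi !lphi Eu Ev; case: z => z1 z2; case: (phi p) => w1 w2 /=.
    by congr (_, _); rewrite /= ?scale_realE; ring.
  have cpsi : {for phi p, continuous psi} by rewrite /psi; cont.
  have psip : psi (phi p) = p by rewrite /psi !subrr !scale0r !addr0.
  have := near_comp cpsi psip iA.
  by apply: filterS => z [_]; rewrite /= phipsi.
have nC : \forall a \near phi p, C1_at [:: e1; e2] g a.
  by move: iD => /nbhs_interior; apply: filterS => a; exact: C1.
have := sderiv_comp (cphi p) (fun a h => lphi a h e) (C1_sderiv_plane (phil e) nC).
move=> /sderiv_is_derive[_ ->].
have ne : n e <= n et + n ex + n ey.
  have := n0 et; have := n0 ex; have := n0 ey.
  by move: He; rewrite !inE => /or3P[] /eqP ->; lra.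
apply: le_trans (_ : n e <= _); last by rewrite (le_trans ne)// lerDr.
have C1p := C1 _ iD.
rewrite (le_trans (ler_normD _ _))// !normrM lerD// ler_wpM2l//.
- by apply: H1; split => //; have [] := C1p _ He1.
- by apply: H2; split => //; have [] := C1p _ He2.
Qed.

End Finiteness.

Lemma bigmax8_leP {R : realType} (x1 x2 x3 x4 x5 x6 x7 x8 k : \bar R) :
  (\big[maxe/-oo]_(v <- [:: x1; x2; x3; x4; x5; x6; x7; x8]) v <= k)%E <->
  [/\ x1 <= k, x2 <= k, x3 <= k & x4 <= k]%E /\ [/\ x5 <= k, x6 <= k, x7 <= k & x8 <= k]%E.
Proof.
rewrite !big_cons big_nil !ge_max leNye andbT; split.
  by move=> /and5P[-> -> -> -> /and4P[-> -> -> ->]].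
by move=> [[-> -> -> ->] [-> -> -> ->]].
Qed.

Section QFinite.
Context {R : realType}.
Local Notation V3 := (R * R * R)%type.
Variables (c a1 b1 a2 b2 tau tau' : R).
Hypotheses (c0 : 0 < c) (ab1 : a1 < b1) (ab2 : a2 < b2) (tt : tau < tau').
Variables (Ntau : 'I_4 -> R * R -> R) (N1m N2m N3p N4p : R * R -> R).
Local Notation bdat := (sel N1m N2m N3p N4p).
Local Notation bdom := (bdom a1 b1 a2 b2 tau tau').
Local Notation foot_init := (foot_init c tau).
Local Notation foot_wall := (foot_wall c a1 b1 a2 b2).
Local Notation Om := (Omega a1 b1 a2 b2).
Local Notation P := (Pdom a1 b1 a2 b2 tau tau').
Local Notation TN := (transported_norm1 a1 b1 a2 b2 tau tau').
Local Notation qe := (q_ext c a1 b1 a2 b2 tau tau' Ntau N1m N2m N3p N4p).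

Lemma q_ext_leP (k : \bar R) : (qe <= k)%E <->
  forall i, (TN Om (Ntau i) (foot_init i) <= k)%E /\ (TN (bdom i) (bdat i) (foot_wall i) <= k)%E.
Proof.
rewrite /q_ext bigmax8_leP; split.
  by move=> [[H1 H2 H3 H4] [H5 H6 H7 H8]]; apply: ord4_ind; split; assumption.
by move=> H; split; split; first [exact: (H i1).1|exact: (H i2).1|exact: (H i3).1
  |exact: (H i4).1|exact: (H i1).2|exact: (H i2).2|exact: (H i3).2|exact: (H i4).2].
Qed.

Hypothesis good : good_data a1 b1 a2 b2 tau tau' Ntau N1m N2m N3p N4p.

Lemma good_bdat i : good_datum (bdom i) (bdat i).
Proof.
have [_ g1 g2 g3 g4] := good; move: i.
by apply: ord4_ind; [exact: g1|exact: g2|exact: g3|exact: g4].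
Qed.

Lemma transported_norms_fin i : (exists k, (TN Om (Ntau i) (foot_init i) <= k%:E)%E) /\
  (exists k, (TN (bdom i) (bdat i) (foot_wall i) <= k%:E)%E).
Proof.
have [gt _ _ _ _] := good; split.
  have cf : continuous (foot_init i) by exact: foot_init_cont.
  have lf a h w : foot_init i (a + h *: w) = foot_init i a + h *: foot_init_lin c i w by exact: foot_init_line.
  apply: (@transported_norm1_fin _ a1 b1 a2 b2 tau tau' Om (Ntau i) (foot_init i)
    (foot_init_lin c i) ex ey (gt i) cf lf).
  - by move: (i); apply: ord4_ind; rewrite /foot_init_lin /sel /tc /xc /yc /= ?mulr0 ?subr0 ?addr0.
  - by move: (i); apply: ord4_ind; rewrite /foot_init_lin /sel /tc /xc /yc /= ?mulr0 ?subr0 ?addr0.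
have cf : continuous (foot_wall i) by exact: foot_wall_cont.
have lf a h w : foot_wall i (a + h *: w) = foot_wall i a + h *: foot_wall_lin c i w by exact: foot_wall_line.
apply: (@transported_norm1_fin _ a1 b1 a2 b2 tau tau' (bdom i) (bdat i) (foot_wall i)
  (foot_wall_lin c i) et (sel ey ex ex ey i) (good_bdat i) cf lf).
- by move: (i); apply: ord4_ind;
    rewrite /foot_wall_lin /cross /ell_lin /sel /tc /xc /yc /= ?oppr0 ?mul0r ?subr0.
- by move: (i); apply: ord4_ind;
    rewrite /foot_wall_lin /cross /ell_lin /sel /tc /xc /yc /= ?oppr0 ?mul0r ?subr0.
Qed.

Lemma q_ext_fin : qe \is a fin_num.
Proof.
have /choice[k1 H1] i := (transported_norms_fin i).1.
have /choice[k2 H2] i := (transported_norms_fin i).2.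
pose K : R := \sum_i (`|k1 i| + `|k2 i|).
have kK i : k1 i <= K /\ k2 i <= K.
  have : `|k1 i| + `|k2 i| <= K.
    by rewrite /K (bigD1 i)//= lerDl sumr_ge0.
  have := ler_norm (k1 i); have := ler_norm (k2 i).
  have := normr_ge0 (k1 i); have := normr_ge0 (k2 i).
  by split; lra.
have qK : (qe <= K%:E)%E.
  apply/q_ext_leP => i; have [K1 K2] := kK i.
  by split; [apply: le_trans (H1 i) _|apply: le_trans (H2 i) _]; rewrite lee_fin.
(* The first norm is over a set that contains the corner (tau, a1, a2), so it is
   not the supremum -oo of the empty set. *)
have q0 : (0 <= qe)%E.
  have /q_ext_leP/(_ i1)[+ _] : (qe <= qe)%E by [].
  apply: le_trans; rewrite /transported_norm1 /norm1 le_max; apply/orP; left.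
  have Pp : P (tau, a1, a2) by apply/PdomE; rewrite /tc /xc /yc /= !lexx !ltW.
  apply: le_trans (_ : (`|Ntau i1 (foot_init i1 (tau, a1, a2))|%:E <= _)%E); first by rewrite lee_fin.
  apply: ereal_sup_ubound; exists (tau, a1, a2) => //; split=> //.
  have Hl : tc (tau, a1, a2) - tau <= ell c a1 b1 a2 b2 i1 (tau, a1, a2).
    by rewrite (_ : tc (tau, a1, a2) = tau)// subrr; exact: (ell_ge0 c0 i1 Pp).
  exact: (Omega_foot_init c0 Pp Hl).
by rewrite ge0_fin_numE// (le_lt_trans qK)// ltry.
Qed.

(** Finiteness matters here: q is read off an extended real maximum, and
    bounds the norms only because that maximum is finite. *)
Lemma q_bounds i :
  (TN Om (Ntau i) (foot_init i) <= (q c a1 b1 a2 b2 tau tau' Ntau N1m N2m N3p N4p)%:E)%E /\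
  (TN (bdom i) (bdat i) (foot_wall i) <= (q c a1 b1 a2 b2 tau tau' Ntau N1m N2m N3p N4p)%:E)%E.
Proof.
have /q_ext_leP : (qe <= (q c a1 b1 a2 b2 tau tau' Ntau N1m N2m N3p N4p)%:E)%E.
  by rewrite /q fineK// q_ext_fin.
by apply.
Qed.

End QFinite.

(** The second conclusion is where being the smaller root counts. *)
Lemma smaller_root {R : realType} (p q : R) : 0 < p -> 0 <= q -> 4 * p * q <= 1 ->
  let X := (1 - Num.sqrt (1 - 4 * p * q)) / (2 * p) in
  [/\ 0 <= X, 2 * p * X <= 1 & q + p * X ^+ 2 = X].
Proof.
move=> p0 q0 pq; set d := Num.sqrt _ => X.
have d0 : 0 <= d by exact: sqrtr_ge0.
have d2 : d ^+ 2 = 1 - 4 * p * q by rewrite sqr_sqrtr// subr_ge0.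
have pq0 : 0 <= p * q by rewrite mulr_ge0// ltW.
have d1 : d <= 1.
  rewrite -(ler_pXn2r (n := 2)) ?nnegrE// expr1n d2; lra.
have pX : 2 * p * X = 1 - d by rewrite /X mulrC divfK// mulf_neq0// lt0r_neq0.
have p2 : 0 < 2 * p by rewrite mulr_gt0.
split.
- by rewrite /X divr_ge0 ?subr_ge0// ltW.
- by rewrite pX; lra.
have p4 : 4 * p != 0 by rewrite mulf_neq0// lt0r_neq0.
apply: (mulfI p4).
rewrite mulrDr (_ : 4 * p * (p * X ^+ 2) = (2 * p * X) ^+ 2); last by ring.
rewrite (_ : 4 * p * X = 2 * (2 * p * X)); last by ring.
by rewrite pX sqrrB d2; ring.
Qed.

(** * The constants of the theorem *)

(** From sigma >= c S one gets p >= mu (sigma + c S) >= (8 + 4 / c) * 2 c S =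
    16 c S + 8 S, and q <= q_sigma; the bound on T is 4 p q_sigma <= 1 in disguise.
    The two last conclusions follow from 2 p X <= 1 and q_sigma + p X^2 = X. *)
Lemma bound_constants (R : realType) (c S R0 sigma T q : R) :
  0 < c -> 0 < S -> 0 < R0 -> c * S <= sigma -> 0 <= q -> 0 <= T ->
  (T%:E <= mine 1%:E ((1 / (lambda c * sigma * R0))%:E *
    ((if q == 0%R then +oo%E else (1 / (4 * (q * (1 + delta c * sigma * R0)) * (sigma + c * S)))%:E)
       - (mu c)%:E)))%E ->
  let p := (mu c + lambda c * sigma * R0 * T) * (sigma + c * S) in
  let qs := q * (1 + delta c * sigma * R0) in
  let X := (1 - Num.sqrt (1 - 4 * p * qs)) / (2 * p) in
  [/\ T <= 1, 0 <= X, 8 * c * S * X <= 1 / 2 &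
      q + (12 * c * S + 4 * S) * X ^+ 2 <= X].
Proof.
move=> c0 S0 R00 sg q0 T0 HT p qs X.
have cS : 0 < c * S by rewrite mulr_gt0.
have s0 : 0 < sigma by exact: lt_le_trans sg.
have ci : 0 < c^-1 by rewrite invr_gt0.
have mu8 : 8 + 4 / c <= mu c by rewrite /mu; lra.
have la0 : 0 < lambda c * sigma * R0 by rewrite !mulr_gt0// /lambda; lra.
have de0 : 0 <= delta c * sigma * R0 by rewrite !mulr_ge0 ?ltW// /delta; lra.
have ss : 0 < sigma + c * S by rewrite addr_gt0.
have pmu : mu c * (sigma + c * S) <= p.
  rewrite /p; apply: ler_wpM2r; first exact: ltW.
  by rewrite lerDl mulr_ge0// ltW.
(* mu contributes 8 + 4 / c, and sigma + c S at least 2 c S. *)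
have p16 : 16 * c * S + 8 * S <= p.
  apply: le_trans pmu; apply: le_trans (_ : (8 + 4 / c) * (2 * (c * S)) <= _).
    rewrite (_ : (8 + 4 / c) * (2 * (c * S)) = 16 * c * S + 8 * S)//.
    by field; exact: lt0r_neq0.
  by apply: ler_pM => //; lra.
have p0 : 0 < p by apply: lt_le_trans p16; rewrite -mulrA; lra.
have qqs : q <= qs by rewrite /qs ler_peMr// lerDl.
have qs0 : 0 <= qs by exact: le_trans qqs.
move: HT; rewrite le_min lee_fin => /andP[T1 HT].
have pq : 4 * p * qs <= 1.
  move: HT; have [qE _|qn HT] := eqVneq q 0; first by rewrite /qs qE mul0r mulr0.
  have qs1 : 0 < qs by apply: lt_le_trans qqs; rewrite lt_neqAle eq_sym qn.
  move: HT; rewrite -/qs -EFinB -EFinM lee_fin div1r.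
  rewrite ler_pdivlMl// -/(lambda c * _ * _).
  have D0 : 0 < 4 * qs * (sigma + c * S) by apply: mulr_gt0 => //; apply: mulr_gt0.
  rewrite lerBrDr ler_pdivlMr// /p => H.
  by apply: le_trans H; rewrite le_eqVlt; apply/orP; left; apply/eqP; ring.
have [X0 pX XE] := smaller_root p0 qs0 pq.
rewrite -/X in X0 pX XE.
split=> //.
  have := ler_wpM2r X0 p16; have : 0 <= S * X by rewrite mulr_ge0// ltW.
  lra.
rewrite -[leRHS]XE lerD// ler_wpM2r ?sqr_ge0//; lra.
Qed.

(** * Existence and uniqueness *)

Unset Implicit Arguments.

Theorem theorem2p2 (R : realType) (c S R0 : R)
    (c_gt0 : 0 < c) (S_gt0 : 0 < S) (R0_gt0 : 0 < R0) :
  exists sigma0 : R, forall sigma : R, sigma0 <= sigma ->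
  forall (a1 b1 a2 b2 tau tau' : R)
    (Ntau : 'I_4 -> R * R -> R) (N1m N2m N3p N4p : R * R -> R),
  a1 < b1 -> a2 < b2 -> 0 <= tau -> tau < tau' ->
  good_data a1 b1 a2 b2 tau tau' Ntau N1m N2m N3p N4p ->
  compatible_data a1 b1 a2 b2 tau Ntau N1m N2m N3p N4p ->
  q c a1 b1 a2 b2 tau tau' Ntau N1m N2m N3p N4p
    < 1 / (4 * mu c * (1 + delta c * sigma * R0) * (sigma + c * S)) ->
  ((tau' - tau)%:E
    <= time_bound c S a1 b1 a2 b2 tau tau' Ntau N1m N2m N3p N4p R0 sigma)%E ->
  exists N : 'I_4 -> R * R * R -> R,
    is_bounded_solution c S a1 b1 a2 b2 tau tau' Ntau N1m N2m N3p N4p R0 sigma N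
    /\ forall M : 'I_4 -> R * R * R -> R,
      is_bounded_solution c S a1 b1 a2 b2 tau tau' Ntau N1m N2m N3p N4p R0 sigma M ->
      forall i p, Pdom a1 b1 a2 b2 tau tau' p -> M i p = N i p.
Proof.
(* The threshold c S is the one [bound_constants] asks for. *)
exists (c * S) => sigma sg a1 b1 a2 b2 tau tau' Ntau N1m N2m N3p N4p ab1 ab2 _ tt good comp _ HT.
pose bdat := sel N1m N2m N3p N4p.
pose qq := q c a1 b1 a2 b2 tau tau' Ntau N1m N2m N3p N4p.
pose P := Pdom a1 b1 a2 b2 tau tau'.
have qb := q_bounds c_gt0 ab1 ab2 tt good.
have qtau i := (qb i).1; have qbd i := (qb i).2.
have gtau : forall i, good_datum (Omega a1 b1 a2 b2) (Ntau i) by case: good.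
have gb := good_bdat good.
have cmp i y : lo a1 a2 i <= y <= hi b1 b2 i -> Ntau i (inlet a1 b1 a2 b2 i y) = bdat i (tau, y).
  have [C1 C2] := comp.
  by move: i; apply: ord4_ind => Hy; [exact: (C1 y Hy).1|exact: (C2 y Hy).1
    |exact: (C2 y Hy).2|exact: (C1 y Hy).2].
have q0 : 0 <= qq by exact: (q_ge0 c_gt0 ab1 ab2 tt cmp qtau qbd).
have T0 : 0 <= tau' - tau by rewrite subr_ge0 ltW.
have [T1 X0 X8 qX] := bound_constants c_gt0 S_gt0 R0_gt0 sg q0 T0 HT.
set X := (1 - _) / _ in X0 X8 qX.
pose D := datum c a1 b1 a2 b2 tau tau' Ntau bdat.
have Dq : forall i p, P p -> `|D i p| <= qq.
  by move=> i p; exact: (datum_bound c_gt0 ab1 ab2 tt cmp qtau qbd).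
have Dlip : forall i e, e \in [:: et; ex; ey] -> forall p h, P p -> P (p + h *: e) ->
    `|D i (p + h *: e) - D i p| <= qq * `|h|.
  by move=> i e He p h; exact: (datum_lip c_gt0 ab1 ab2 tt gtau gb cmp qtau qbd).
have [N BN NE] := picard_fixpoint c_gt0 S_gt0 ab1 ab2 tt T1 X0 Dq Dlip qX X8.
have Dreg : forall i p e, Pint a1 b1 a2 b2 tau tau' p -> ~ kink c a1 b1 a2 b2 tau i p ->
    exists d, sderiv (D i) p e d.
  by move=> i p e; exact: (datum_sderiv c_gt0 ab1 ab2 tt gtau gb cmp).
have Ddir : forall i p h, D i (p + h *: dir c i) = D i p.
  by move=> i p h; exact: datum_dir.
have Dge0 : forall i p, P p -> 0 <= D i p.
  by move=> i p; exact: (datum_ge0 c_gt0 ab1 ab2 tt gtau gb cmp).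
have entry i p : P p -> len c a1 b1 a2 b2 tau i p = 0 -> N i p = D i p.
  by move=> Pp l0; rewrite (mild_Pdom NE)// l0 prim0 addr0.
have wall i p : P p -> ell c a1 b1 a2 b2 i p = 0 -> N i p = bdat i (tc p, cross i p).
  move=> Pp l0; have Ht : 0 <= tc p - tau by have /PdomE[/andP[+ _] _ _] := Pp; rewrite subr_ge0.
  rewrite entry//; last by rewrite /len l0 min_r.
  have le : ell c a1 b1 a2 b2 i p <= tc p - tau by rewrite l0.
  by rewrite /D (datum_foot_wall c_gt0 ab1 ab2 cmp Pp le) /foot_wall l0 subr0.
have cN i : continuous (N i) by exact: lip_ball_cont BN.
have dX i e p : e \in [:: et; ex; ey] -> derivable (N i) p e -> `|'D_e (N i) p| <= X.
  by move=> He; apply: lip_derive; have [_] := BN i; apply.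
have sN : is_solution c S a1 b1 a2 b2 tau tau' Ntau N1m N2m N3p N4p N.
  split.
  - by move=> i; exact: continuous_subspaceT.
  - exists (range (kink c a1 b1 a2 b2 tau)); split.
    + exact: finite_image.
    + by move=> _ [i _ <-]; exact: kink_plane.
    + move=> p /(interior_Pdom _ _ _ _) ip off.
      have nk i : ~ kink c a1 b1 a2 b2 tau i p by apply: off; exists i.
      split; first by move=> i; exact: (mild_C1 c_gt0 S_gt0 T1 X0 X8 BN NE Dreg).
      exact: (mild_broadwell c_gt0 S_gt0 T1 X0 X8 BN NE Dreg Ddir).
  - move=> i x y [/=]; rewrite !in_itv/= => Hx Hy.
    have Pp : P (tau, x, y) by apply/PdomE; split; rewrite /tc /xc /yc //= lexx ltW.
    have t0 : tc (tau, x, y) - tau = 0 by rewrite /tc subrr.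
    have l0 : 0 <= ell c a1 b1 a2 b2 i (tau, x, y) by exact: ell_ge0 Pp.
    rewrite entry//; last by rewrite /len t0 min_l.
    rewrite /D datum_foot_init ?t0//; congr (Ntau i _).
    by move: (i); apply: ord4_ind; rewrite /foot_init /sel /= t0 mulr0 ?subr0 ?addr0.
  - move=> t x y /PdomE[]; rewrite /tc /xc /yc /= => Ht Hx Hy.
    have l1 := ltW ab1; have l2 := ltW ab2.
    have P1 : P (t, a1, y) by apply/PdomE; rewrite /tc /xc /yc /= lexx l1.
    have P2 : P (t, x, a2) by apply/PdomE; rewrite /tc /xc /yc /= lexx l2.
    have P3 : P (t, x, b2) by apply/PdomE; rewrite /tc /xc /yc /= lexx l2.
    have P4 : P (t, b1, y) by apply/PdomE; rewrite /tc /xc /yc /= lexx l1.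
    split.
    + by apply: (wall i1) => //; rewrite /ell /sel /xc /= subrr mul0r.
    + by apply: (wall i2) => //; rewrite /ell /sel /yc /= subrr mul0r.
    + by apply: (wall i3) => //; rewrite /ell /sel /yc /= subrr mul0r.
    + by apply: (wall i4) => //; rewrite /ell /sel /xc /= subrr mul0r.
exists N; split.
  split=> //.
  - by move=> i p; exact: (mild_ge0 c_gt0 S_gt0 ab1 ab2 tt T1 X0 X8 BN NE Ddir Dge0).
  - move=> i e He; apply: (le_bounded (k := X)) => p [_ df]; exact: dX.
  - apply: bigmax_le => [|i _]; first exact: leNye.
    apply/norm1_leP; split=> [p _|e He p _ df]; last exact: dX.
    by have [+ _] := BN i; apply.
move=> M [sM _ _ MX] i p Pp.
apply: (sol_unique c_gt0 S_gt0 ab1 ab2 tt T1 X0 X8 sM sN) => // j a Pa.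
  have : (norm1 P (M j) <= X%:E)%E by apply: le_trans MX; exact: le_bigmax.
  by move=> /norm1_leP[+ _]; apply.
by have [+ _] := BN j; apply.
Qed.
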